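(* Let $A,A'$ be Lie algebroids over the same manifold $M$ and let $\varphi:A\rightarrow A'$ be a base-preserving morphism of Lie algebroids. Then the simple characteristic class $\mu_1(\varphi)\in H^1(A)$ is equal to the modular class $\mu(A)-\varphi^*\mu(A')\in H^1(A)$ of the morphism $\varphi$.
   Context: Everything is $C^\infty$. For a Lie algebroid $(A,\sharp_A,[\,,]_A)$ over $M$, $\Omega^k(A)=\Gamma\wedge^kA^*$ is the space of $A$-forms, $d_A$ the Lie algebroid exterior differential, and $H^*(A)$ the cohomology of $(\Omega^*(A),d_A)$. $\Gamma$ denotes spaces of cross sections. A base-preserving morphism is a vector bundle map over the identity of $M$ that commutes with anchors and brackets; $\varphi^*:H^*(A')\to H^*(A)$ is the induced homomorphism. An $A$-connection on a vector bundle $V\to M$ is an $\mathbb{R}$-bilinear map $\nabla:\Gamma A\times\Gamma V\to\Gamma V$ with $\nabla_{fa}v=f\nabla_av$, $\nabla_a(fv)=f\nabla_av+(\sharp_Aa)(f)v$. The dual $A$-connection $\nabla^*$ on $V^*$ is given by $\langle\nabla^*_a\nu,v\rangle=(\sharp_Aa)\langle\nu,v\rangle-\langle\nu,\nabla_av\rangle$. If $g$ is a (positive definite) metric on $V$, an $A$-connection is orthogonal if $\nabla g=0$. Distinguished pair: a pair $(\nabla,\nabla')$ of $A$-connections on $A$, $A'$, respectively, such that (i) $\nabla'_a(\varphi b)=\varphi(\nabla_ab)$ for $a,b\in\Gamma A$ ($\varphi$-compatibility); (ii) $\nabla_vk(x)=[\tilde v,k]_A(x)$ for all $x\in M$, $v\in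 A_x$, $k\in\Gamma(\ker\varphi)$ (sections of $A$ with values in $\ker\varphi$); (iii) $\nabla'_va'(x)=[\varphi\tilde v,a']_{A'}(x)$ mod $\mathrm{im}\,\varphi_x$ for all $x\in M$, $v\in A_x$, $a'\in\Gamma A'$. Here $\tilde v$ is any cross section of $A$ extending $v$ (the conditions do not depend on the extension). The class $\mu_1(\varphi)$: take a distinguished pair $(\nabla,\nabla')$ and put $\nabla^1=\nabla\oplus\nabla'^*$ on $S=A\oplus A'^*$; take metrics $g_A,g_{A'}$ on $A,A'$ with orthogonal $A$-connections $\nabla^{g_A},\nabla^{g_{A'}}$ and put $\nabla^0=\nabla^{g_A}\oplus(\nabla^{g_{A'}})^*$. Then $\mu_1(\varphi)=[\Delta(\nabla^0,\nabla^1)c_1]\in H^1(A)$, where $c_1$ is the trace and $\Delta(\nabla^0,\nabla^1)c_1$ is the $d_A$-closed $1$-$A$-form $a\mapsto \mathrm{tr}(\nabla^1_a-\nabla^0_a)$ (trace of the endomorphism $\nabla^1_a-\nabla^0_a$ of $S$). The class is independent of the choices. Modular class $\mu(A)$ of a Lie algebroid $A$, with $s=\mathrm{rank}\,A$, $m=\dim M$: the line bundle $\wedge^sA\otimes\wedge^mT^*M$ has a flat $A$-connection given, in terms of local bases $(b_i)$ of $A$ and local coordinates $(x^h)$, by $$\nabla_{b_i}\bigl((\wedge_{j}b_j)\otimes(\wedge_hdx^h)\bigr)=\sum_{j=1}^sb_1\wedge\dots\wedge[b_i,b_j]_A\wedge\dots\wedge b_s\otimes(\wedge_hdx^h)+(\wedge_jb_j)\otimes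 L_{\sharp_Ab_i}(\wedge_hdx^h),$$ $L$ being the Lie derivative. For a nowhere vanishing section $\sigma$ (which exists if the line bundle is trivial; otherwise one passes to its double covering, i.e. $\sigma$ is defined up to sign, which does not affect what follows) one has $\nabla_a\sigma=\lambda(a)\sigma$ with $\lambda$ a $d_A$-closed $1$-$A$-form, and $\mu(A)=[\lambda]\in H^1(A)$, which is independent of $\sigma$. *)

(* Defs.v *)
From HB Require Import structures.
From mathcomp Require Import all_boot all_order all_algebra.
From mathcomp Require Import all_classical all_reals all_analysis.
Import Order.TTheory GRing.Theory Num.Theory.
Import numFieldNormedType.Exports.

Set Implicit Arguments.
Unset Strict Implicit.
Unset Printing Implicit Defensive.

Local Open Scope classical_set_scope.
Local Open Scope ring_scope.

(** * Smooth functions and smooth manifolds *)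

(* Meant for open [U]: all iterated partial derivatives of order at most [k]
   exist and are continuous on [U]. *)
Fixpoint Ck_on (R : realType) (m k : nat) (U : set 'rV[R]_m)
    (f : 'rV[R]_m -> R) : Prop :=
  (forall y, U y -> {for y, continuous f}) /\
  (if k is k'.+1 then
     forall i : 'I_m,
       (forall y, U y -> derivable f y (delta_mx 0 i)) /\
       Ck_on k' U (fun y => 'D_(delta_mx 0 i) f y)
   else True).

Definition smooth_on (R : realType) (m : nat) (U : set 'rV[R]_m)
    (f : 'rV[R]_m -> R) : Prop :=
  forall k, Ck_on k U f.

(* The charts [chart i] and their inverses are total functions, only meaningful
   on [chart_dom i] and on its image respectively. *)
Record manifold (R : realType) (m : nat) := Manifold {
  points :> topologicalType;
  chart_idx : Type;
  chart_dom : chart_idx -> set points;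
  chart : chart_idx -> points -> 'rV[R]_m;
  chart_inv : chart_idx -> 'rV[R]_m -> points;
  manifold_hausdorff : hausdorff_space points;
  manifold_second_countable : @second_countable points;
  chart_dom_open : forall i, open (chart_dom i);
  chart_dom_cover : forall x, exists i, chart_dom i x;
  chart_image_open : forall i, open (chart i @` chart_dom i);
  chartK : forall i x, chart_dom i x -> chart_inv i (chart i x) = x;
  chart_continuous : forall i x, chart_dom i x -> {for x, continuous (chart i)};
  chart_inv_continuous : forall i y, (chart i @` chart_dom i) y ->
    {for y, continuous (chart_inv i)};
  chart_transition : forall i j (l : 'I_m),
    smooth_on (chart i @` (chart_dom i `&` chart_dom j))
      (fun y => chart j (chart_inv i y) 0 l)
}.
Arguments chart_dom {R m} M i : rename.
Arguments chart {R m} M i x : rename.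
Arguments chart_inv {R m} M i y : rename.

Definition smooth_in (R : realType) (m : nat) (M : manifold R m)
    (U : set M) (f : M -> R) : Prop :=
  forall i, smooth_on (chart M i @` (chart_dom M i `&` U)) (f \o chart_inv M i).

Definition smooth (R : realType) (m : nat) (M : manifold R m) (f : M -> R) :
  Prop := smooth_in setT f.

(** * Tangent vectors and vector fields, as derivations of C^oo(M) *)

(* Only the values of a tangent vector on smooth functions are meaningful. *)
Definition tvec (R : realType) (m : nat) (M : manifold R m) := (M -> R) -> R.

Definition is_tvec (R : realType) (m : nat) (M : manifold R m) (x : M)
    (D : tvec M) : Prop :=
  (forall (c : R) f g, smooth f -> smooth g ->
     D (fun z => c * f z + g z) = c * D f + D g) /\
  (forall f g, smooth f -> smooth g ->
     D (fun z => f z * g z) = D f * g x + f x * D g).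

Definition vfield (R : realType) (m : nat) (M : manifold R m) := M -> tvec M.

Definition vf_app (R : realType) (m : nat) (M : manifold R m) (X : vfield M)
  (f : M -> R) : M -> R := fun x => X x f.

Definition is_vfield (R : realType) (m : nat) (M : manifold R m)
    (X : vfield M) : Prop :=
  (forall x, is_tvec x (X x)) /\ (forall f, smooth f -> smooth (vf_app X f)).

Definition vf_bracket (R : realType) (m : nat) (M : manifold R m)
    (X Y : vfield M) : vfield M :=
  fun x f => X x (vf_app Y f) - Y x (vf_app X f).

(** * Smooth vector bundles *)

(* A family of vector spaces together with local frames over an open cover,
   with smooth transition functions. *)
Record vbundle (R : realType) (m : nat) (M : manifold R m) := VBundle {
  fiber :> M -> vectType R;
  rank : nat;
  triv_idx : Type;
  triv_dom : triv_idx -> set M;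
  frame : triv_idx -> forall x, rank.-tuple (fiber x);
  triv_dom_open : forall j, open (triv_dom j);
  triv_dom_cover : forall x, exists j, triv_dom j x;
  frame_basis : forall j x, triv_dom j x -> basis_of fullv (frame j x);
  frame_smooth : forall j k (p q : 'I_rank),
    smooth_in (triv_dom j `&` triv_dom k)
      (fun x => coord (frame j x) p (tnth (frame k x) q))
}.
Arguments triv_dom {R m M} E j : rename.
Arguments frame {R m M} E j x : rename.

(* Not necessarily smooth: see [is_section] for the elements of Gamma(E). *)
Definition section (R : realType) (m : nat) (M : manifold R m)
  (E : vbundle M) := forall x : M, E x.

Definition is_section (R : realType) (m : nat) (M : manifold R m)
    (E : vbundle M) (s : section E) : Prop :=
  forall j p, smooth_in (triv_dom E j) (fun x => coord (frame E j x) p (s x)).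

Definition sec_add (R : realType) (m : nat) (M : manifold R m)
  (E : vbundle M) (s t : section E) : section E := fun x => s x + t x.

Definition sec_scale (R : realType) (m : nat) (M : manifold R m)
  (E : vbundle M) (f : M -> R) (s : section E) : section E :=
  fun x => f x *: s x.

Lemma Ck_on_sub (R : realType) (m k : nat) (U V : set 'rV[R]_m) f :
  U `<=` V -> Ck_on k V f -> Ck_on k U f.
Proof.
move=> UV; elim: k f => [|k IH] f /= [cf df]; split=> //.
- by move=> y /UV; apply: cf.
- by move=> y /UV; apply: cf.
- by move=> i; have [di ci] := df i; split; [move=> y /UV; apply: di|apply: IH].
Qed.

Lemma Ck_on_ext (R : realType) (m k : nat) (U : set 'rV[R]_m) f g :
  open U -> (forall y, U y -> f y = g y) -> Ck_on k U f -> Ck_on k U g.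
Proof.
move=> oU; elim: k f g => [|k IH] f g fg /= [cf df];
  have nfg y : U y -> \forall z \near y, f z = g z;
  (try by move=> Uy; apply: filterS (open_nbhs_nbhs (conj oU Uy)) => z; apply: fg);
  have cg y : U y -> {for y, continuous g};
  (try by move=> Uy; have := cf _ Uy; rewrite /prop_for /continuous_at -(fg _ Uy);
    apply: cvg_trans; apply: near_eq_cvg (nfg _ Uy)).
  by [].
split=> // i; have [di ci] := df i; split=> [y Uy|].
  exact: near_eq_derivable (nfg _ Uy) (di _ Uy).
by apply: IH ci => y Uy; apply: near_eq_derive (nfg _ Uy).
Qed.

Lemma Ck_on_cst (R : realType) (m k : nat) (U : set 'rV[R]_m) (c : R) :
  Ck_on k U (fun=> c).
Proof.
elim: k c => [|k IH] c /=; split=> //; try by move=> y _; apply: (@cst_continuous _ _ c y).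
move=> i; split=> [y _|]; first exact: derivable_cst.
have -> : (fun y : 'rV[R]_m => 'D_(delta_mx 0 i) (fun=> c) y) = (fun=> 0 : R); last exact: IH.
by apply/funext => y; rewrite derive_cst.
Qed.

Lemma chart_image_open_in (R : realType) (m : nat) (M : manifold R m)
    (U : set M) i : open U -> open (chart M i @` (chart_dom M i `&` U)).
Proof.
move=> oU; rewrite openE => _ [x [dx Ux] <-] /=.
have im : (chart M i @` chart_dom M i) (chart M i x) by exists x.
have n1 : nbhs (chart M i x) (chart M i @` chart_dom M i).
  by apply: open_nbhs_nbhs; split=> //; apply: chart_image_open.
have n2 : nbhs (chart M i x) (chart_inv M i @^-1` U).
  apply: (chart_inv_continuous im); rewrite chartK //.
  by apply: open_nbhs_nbhs.
rewrite /interior; apply: filterS (filterI n1 n2) => _ [[z dz <-]] /=.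
by rewrite chartK // => Uz; exists z.
Qed.

Lemma smooth_in_sub (R : realType) (m : nat) (M : manifold R m)
    (U V : set M) f : U `<=` V -> smooth_in V f -> smooth_in U f.
Proof.
move=> UV sf i k; apply: Ck_on_sub (sf i k).
by apply: image_subset => x [dx /UV].
Qed.

Lemma smooth_in_ext (R : realType) (m : nat) (M : manifold R m)
    (U : set M) f g : open U -> (forall x, U x -> f x = g x) ->
  smooth_in U f -> smooth_in U g.
Proof.
move=> oU fg sf i k; apply: Ck_on_ext (sf i k).
  exact: chart_image_open_in.
by move=> _ [x [dx Ux] <-] /=; rewrite chartK // fg.
Qed.

Lemma smooth_in_cst (R : realType) (m : nat) (M : manifold R m)
    (U : set M) (c : R) : smooth_in U (fun=> c).
Proof. by move=> i k; apply: Ck_on_cst. Qed.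

(** ** Dual bundle and direct sum *)

Definition dual_basis (K : fieldType) (V : vectType K) n (X : n.-tuple V) :
    n.-tuple 'Hom(V, K^o) :=
  [tuple linfun (coord X i : V -> K^o) | i < n].

Definition sum_basis (K : fieldType) (V W : vectType K) n p
    (X : n.-tuple V) (Y : p.-tuple W) : (n + p).-tuple (V * W)%type :=
  [tuple match fintype.split i with
         | inl j => (tnth X j, 0)
         | inr j => (0, tnth Y j)
         end | i < n + p].

Lemma basis_of_coords (K : fieldType) (V : vectType K) n (X : n.-tuple V) (phi : 'I_n -> {linear V -> K^o}) :
  (forall i j, phi i (tnth X j) = (j == i)%:R) ->
  (forall v, v = \sum_i phi i v *: tnth X i) ->
  basis_of fullv X /\ forall i v, coord X i v = phi i v.
Proof.
move=> phiX genX.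
have freeX : free X.
  apply/freeP => k k0 i; have := congr1 (phi i) k0.
  rewrite linear_sum linear0 (bigD1 i) //= big1 ?addr0 => [|j /negPf ji].
    by rewrite linearZ /= -tnth_nth phiX eqxx /= => <-; rewrite [RHS]mulr1.
  by rewrite linearZ /= -tnth_nth phiX ji; apply: mulr0.
have spanX : (fullv <= <<X>>)%VS.
  apply/subvP => v _; rewrite (genX v); apply: memv_suml => i _.
  by apply: memvZ; apply: memv_span; apply: mem_tnth.
split; first by rewrite /basis_of freeX andbT eqEsubv subvf.
move=> i v; rewrite {1}(genX v) -[RHS](@coord_sum_free K V n X (fun i => phi i v) i freeX).
by congr (coord X i _); apply: eq_bigr => j _; rewrite -tnth_nth.
Qed.

Lemma dual_basisP (K : fieldType) (V : vectType K) n (X : n.-tuple V) : basis_of fullv X ->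
  basis_of fullv (dual_basis X) /\
  forall i (nu : 'Hom(V, K^o)), coord (dual_basis X) i nu = nu (tnth X i).
Proof.
move=> bX.
have evL i : linear (fun nu : 'Hom(V, K^o) => nu (tnth X i)).
  by move=> c f g; rewrite !lfunE /= lfunE.
pose ev i : {linear 'Hom(V, K^o) -> K^o} := HB.pack
  (fun nu : 'Hom(V, K^o) => nu (tnth X i))
  (GRing.isLinear.Build _ _ _ _ _ (evL i)).
apply: (@basis_of_coords _ _ n (dual_basis X) ev) => [i j|nu].
  rewrite /ev /= tnth_mktuple lfunE /= (tnth_nth 0) coord_free ?(basis_free bX) //.
  by rewrite eq_sym.
apply/lfunP => v; rewrite sum_lfunE [in LHS](coord_basis bX (memvf v)).
rewrite linear_sum; apply: eq_bigr => i _.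
by rewrite linearZ /= lfunE /= tnth_mktuple lfunE /= -tnth_nth; apply: mulrC.
Qed.

Lemma sum_basisP (K : fieldType) (V W : vectType K) n p
    (X : n.-tuple V) (Y : p.-tuple W) :
  basis_of fullv X -> basis_of fullv Y ->
  basis_of fullv (sum_basis X Y) /\
  forall i (u : V * W), coord (sum_basis X Y) i u =
    match fintype.split i with
    | inl j => coord X j u.1
    | inr j => coord Y j u.2
    end.
Proof.
move=> bX bY.
have phL i : linear (fun u : V * W => match fintype.split i with
    | inl j => coord X j u.1 | inr j => coord Y j u.2 end : K^o).
  by move=> c u v; case: fintype.split => j; rewrite linearP.
pose phi i : {linear (V * W)%type -> K^o} := HB.pack
  (fun u : V * W => match fintype.split i with
    | inl j => coord X j u.1 | inr j => coord Y j u.2 end : K^o)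
  (GRing.isLinear.Build _ _ _ _ _ (phL i)).
apply: (@basis_of_coords _ _ _ (sum_basis X Y) phi) => [i j|[v w]].
  rewrite /phi /= tnth_mktuple -(can_eq (@splitK n p)).
  case: (fintype.split i) (fintype.split j) => [i'|i'] [j'|j'] /=;
    rewrite ?linear0 ?(tnth_nth 0) ?coord_free ?(basis_free bX) ?(basis_free bY) //.
rewrite big_split_ord /=.
under eq_bigr do rewrite tnth_mktuple (unsplitK (inl _)) /=.
under [X in _ = _ + X]eq_bigr do rewrite tnth_mktuple (unsplitK (inr _)) /=.
apply/eqP; rewrite -[_ == _]/((_ == _) && (_ == _)) /=.
rewrite !(raddf_sum (@fst V W)) !(raddf_sum (@snd V W)) /=.
rewrite [X in _ == _ + X]big1 ?addr0 => [|i _]; last exact: scaler0.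
rewrite [X in _ && (_ == X + _)]big1 ?add0r => [|i _]; last exact: scaler0.
apply/andP; split; apply/eqP.
  by rewrite {1}(coord_basis bX (memvf v)); apply: eq_bigr => i _; rewrite -tnth_nth.
by rewrite {1}(coord_basis bY (memvf w)); apply: eq_bigr => i _; rewrite -tnth_nth.
Qed.

Lemma dual_frame_smooth (R : realType) (m : nat) (M : manifold R m)
    (E : vbundle M) j k (p q : 'I_(rank E)) :
  smooth_in (triv_dom E j `&` triv_dom E k)
    (fun x => coord (dual_basis (frame E j x)) p
                    (tnth (dual_basis (frame E k x)) q)).
Proof.
have oU := openI (triv_dom_open (v := E) j) (triv_dom_open (v := E) k).
apply: (smooth_in_ext (f := fun x => coord (frame E k x) q (tnth (frame E j x) p))
  oU) => [x [jx kx]|]; last by rewrite setIC; apply: frame_smooth.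
have [_ ->] := dual_basisP (frame_basis jx).
by rewrite tnth_mktuple lfunE.
Qed.

Definition dual_bundle (R : realType) (m : nat) (M : manifold R m)
    (E : vbundle M) : vbundle M :=
  @VBundle R m M (fun x => 'Hom(E x, R^o)) (rank E) _ (triv_dom E)
    (fun j x => dual_basis (frame E j x))
    (@triv_dom_open _ _ _ E) (@triv_dom_cover _ _ _ E)
    (fun j x jx => (dual_basisP (frame_basis jx)).1)
    (@dual_frame_smooth R m M E).

Definition sum_dom (R : realType) (m : nat) (M : manifold R m)
    (E F : vbundle M) (j : triv_idx E * triv_idx F) : set M :=
  triv_dom E j.1 `&` triv_dom F j.2.

Lemma sum_dom_cover (R : realType) (m : nat) (M : manifold R m)
    (E F : vbundle M) x : exists j, sum_dom (E := E) (F := F) j x.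
Proof.
have [j jx] := triv_dom_cover E x; have [k kx] := triv_dom_cover F x.
by exists (j, k).
Qed.

Lemma sum_frame_smooth (R : realType) (m : nat) (M : manifold R m)
    (E F : vbundle M) (j k : triv_idx E * triv_idx F)
    (p q : 'I_(rank E + rank F)) :
  smooth_in (sum_dom j `&` sum_dom k)
    (fun x => coord (sum_basis (frame E j.1 x) (frame F j.2 x)) p
                    (tnth (sum_basis (frame E k.1 x) (frame F k.2 x)) q)).
Proof.
have oD l : open (sum_dom (E := E) (F := F) l).
  by apply: openI; apply: triv_dom_open.
have oU := openI (oD j) (oD k).
pose f x := match fintype.split p, fintype.split q with
  | inl p', inl q' => coord (frame E j.1 x) p' (tnth (frame E k.1 x) q')
  | inr p', inr q' => coord (frame F j.2 x) p' (tnth (frame F k.2 x) q')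
  | _, _ => 0
  end.
apply: (smooth_in_ext (f := f) oU) => [x [[jx jx'] [kx kx']]|].
  have [_ ->] := sum_basisP (frame_basis jx) (frame_basis jx').
  rewrite tnth_mktuple /f.
  by case: (fintype.split p) => p'; case: (fintype.split q) => q' //=;
    rewrite linear0.
rewrite /f; case: (fintype.split p) => p'; case: (fintype.split q) => q';
  try exact: smooth_in_cst.
- apply: smooth_in_sub (@frame_smooth _ _ _ E j.1 k.1 p' q').
  by move=> x [[jx _] [kx _]].
- apply: smooth_in_sub (@frame_smooth _ _ _ F j.2 k.2 p' q').
  by move=> x [[_ jx] [_ kx]].
Qed.

Definition sum_bundle (R : realType) (m : nat) (M : manifold R m)
    (E F : vbundle M) : vbundle M :=
  @VBundle R m M (fun x => (E x * F x)%type) (rank E + rank F) _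
    (@sum_dom R m M E F)
    (fun j x => sum_basis (frame E j.1 x) (frame F j.2 x))
    (fun j => openI (triv_dom_open (v := E) j.1) (triv_dom_open (v := F) j.2))
    (@sum_dom_cover R m M E F)
    (fun j x jx =>
       (sum_basisP (frame_basis jx.1) (frame_basis jx.2)).1)
    (@sum_frame_smooth R m M E F).

(** * Lie algebroids *)

(* The bracket acts on Gamma(A): it is only constrained on smooth sections. *)
Record lie_algebroid (R : realType) (m : nat) (M : manifold R m) :=
  LieAlgebroid {
  la_bundle :> vbundle M;
  anchor : forall x, la_bundle x -> tvec M;
  bracket : section la_bundle -> section la_bundle -> section la_bundle;
  anchor_tvec : forall x (v : la_bundle x), is_tvec x (anchor v);
  anchor_linear : forall x (c : R) (u v : la_bundle x) f, smooth f ->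
    anchor (c *: u + v) f = c * anchor u f + anchor v f;
  anchor_smooth : forall (a : section la_bundle) f,
    is_section a -> smooth f -> smooth (fun x => anchor (a x) f);
  bracket_smooth : forall a b,
    is_section a -> is_section b -> is_section (bracket a b);
  bracketDr : forall a b c, is_section a -> is_section b -> is_section c ->
    forall x, bracket a (sec_add b c) x = bracket a b x + bracket a c x;
  bracket_anti : forall a b, is_section a -> is_section b ->
    forall x, bracket a b x = - bracket b a x;
  bracket_jacobi : forall a b c, is_section a -> is_section b -> is_section c ->
    forall x, bracket a (bracket b c) x + bracket b (bracket c a) x
              + bracket c (bracket a b) x = 0;
  (* for constant [f] this gives the homogeneity of the bracket *)
  bracket_leibniz : forall a b f, is_section a -> is_section b -> smooth f ->
    forall x, bracket a (sec_scale f b) x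
              = f x *: bracket a b x + anchor (a x) f *: b x;
  anchor_bracket : forall a b f, is_section a -> is_section b -> smooth f ->
    forall x, anchor (bracket a b x) f
              = vf_bracket (fun z => anchor (a z)) (fun z => anchor (b z)) x f
}.
Arguments anchor {R m M} A {x} v f : rename.
Arguments bracket {R m M} A a b x : rename.

(* The vector field [sharp_A a]. *)
Definition sharp (R : realType) (m : nat) (M : manifold R m)
  (A : lie_algebroid M) (a : section A) : vfield M := fun x => anchor A (a x).

(** ** Base-preserving morphisms *)

Definition push (R : realType) (m : nat) (M : manifold R m)
    (E F : vbundle M) (phi : forall x, 'Hom(E x, F x)) (s : section E) :
  section F := fun x => phi x (s x).

Record la_morphism (R : realType) (m : nat) (M : manifold R m)
    (A A' : lie_algebroid M) := LaMorphism {
  la_map :> forall x, 'Hom(A x, A' x);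
  la_map_smooth : forall a : section A, is_section a -> is_section (push la_map a);
  la_map_anchor : forall x (v : A x) f, smooth f ->
    anchor A' (la_map x v) f = anchor A v f;
  la_map_bracket : forall a b : section A, is_section a -> is_section b ->
    forall x, push la_map (bracket A a b) x
              = bracket A' (push la_map a) (push la_map b) x
}.

(** ** The cohomology space H^1(A) *)

Definition form1 (R : realType) (m : nat) (M : manifold R m)
  (A : lie_algebroid M) := section (dual_bundle A).

Definition form1_app (R : realType) (m : nat) (M : manifold R m)
    (A : lie_algebroid M) (w : form1 A) (a : section A) : M -> R :=
  fun x => (w x : 'Hom(A x, R^o)) (a x).

(* [w] belongs to Omega^1(A) and [d_A w = 0]. *)
Definition closed_form1 (R : realType) (m : nat) (M : manifold R m)
    (A : lie_algebroid M) (w : form1 A) : Prop :=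
  is_section w /\
  forall a b : section A, is_section a -> is_section b -> forall x,
    sharp a x (form1_app w b) - sharp b x (form1_app w a)
    - form1_app w (bracket A a b) x = 0.

Definition cohomologous (R : realType) (m : nat) (M : manifold R m)
    (A : lie_algebroid M) (w w' : form1 A) : Prop :=
  exists2 f : M -> R, smooth f &
    forall x (v : A x), (w x - w' x : 'Hom(A x, R^o)) v = anchor A v f.

(* Elements of H^1(A) are the cosets [coh_class w], [w] closed. *)
Definition coh_class (R : realType) (m : nat) (M : manifold R m)
    (A : lie_algebroid M) (w : form1 A) : set (form1 A) :=
  [set w' | closed_form1 w' /\ cohomologous w' w].

Definition coh_sub (R : realType) (m : nat) (M : manifold R m)
    (A : lie_algebroid M) (c c' : set (form1 A)) : set (form1 A) :=
  [set w | exists u v, [/\ c u, c' v &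
     coh_class (fun x => u x - v x : 'Hom(A x, R^o)) w]].

Definition pull_form1 (R : realType) (m : nat) (M : manifold R m)
    (A A' : lie_algebroid M) (phi : la_morphism A A') (w : form1 A') : form1 A :=
  fun x => ((w x : 'Hom(A' x, R^o)) \o phi x)%VF.

Definition coh_pull (R : realType) (m : nat) (M : manifold R m)
    (A A' : lie_algebroid M) (phi : la_morphism A A') (c : set (form1 A')) :
    set (form1 A) :=
  [set w | exists2 u, c u & coh_class (pull_form1 phi u) w].

(** * A-connections *)

Definition conn_op (R : realType) (m : nat) (M : manifold R m)
    (A : lie_algebroid M) (V : vbundle M) :=
  section A -> section V -> section V.

Definition is_connection (R : realType) (m : nat) (M : manifold R m)
    (A : lie_algebroid M) (V : vbundle M) (D : conn_op A V) : Prop :=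
  [/\ forall a v, is_section a -> is_section v -> is_section (D a v),
      forall a b v, is_section a -> is_section b -> is_section v ->
        forall x, D (sec_add a b) v x = D a v x + D b v x,
      forall a v w, is_section a -> is_section v -> is_section w ->
        forall x, D a (sec_add v w) x = D a v x + D a w x,
      forall f a v, smooth f -> is_section a -> is_section v ->
        forall x, D (sec_scale f a) v x = f x *: D a v x &
      forall f a v, smooth f -> is_section a -> is_section v ->
        forall x, D a (sec_scale f v) x
                  = f x *: D a v x + anchor A (a x) f *: v x].

Definition pairing (R : realType) (m : nat) (M : manifold R m)
    (V : vbundle M) (nu : section (dual_bundle V)) (v : section V) : M -> R :=
  fun x => (nu x : 'Hom(V x, R^o)) (v x).

(* [D'] is the dual connection of [D]; this determines it on smooth sections. *)
Definition is_dual_connection (R : realType) (m : nat) (M : manifold R m)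
    (A : lie_algebroid M) (V : vbundle M) (D : conn_op A V)
    (D' : conn_op A (dual_bundle V)) : Prop :=
  is_connection D' /\
  forall a nu v, is_section a -> is_section nu -> is_section v ->
    forall x, pairing (D' a nu) v x
              = sharp a x (pairing nu v) - pairing nu (D a v) x.

Definition sum_connection (R : realType) (m : nat) (M : manifold R m)
    (A : lie_algebroid M) (V W : vbundle M) (D : conn_op A V)
    (D' : conn_op A W) : conn_op A (sum_bundle V W) :=
  fun a s x => (D a (fun z => (s z).1) x, D' a (fun z => (s z).2) x).

Definition is_metric (R : realType) (m : nat) (M : manifold R m)
    (V : vbundle M) (g : forall x, V x -> V x -> R) : Prop :=
  [/\ forall x (c : R) (u v w : V x), g x (c *: u + v) w = c * g x u w + g x v w,
      forall x (u v : V x), g x u v = g x v u,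
      forall x (u : V x), u != 0 -> 0 < g x u u &
      forall u v : section V, is_section u -> is_section v ->
        smooth (fun x => g x (u x) (v x))].

Definition is_orthogonal (R : realType) (m : nat) (M : manifold R m)
    (A : lie_algebroid M) (V : vbundle M) (g : forall x, V x -> V x -> R)
    (D : conn_op A V) : Prop :=
  is_connection D /\
  forall a u v, is_section a -> is_section u -> is_section v ->
    forall x, sharp a x (fun z => g z (u z) (v z))
              = g x (D a u x) (v x) + g x (u x) (D a v x).

(** * Distinguished pairs and the class mu_1 *)

Definition distinguished_pair (R : realType) (m : nat) (M : manifold R m)
    (A A' : lie_algebroid M) (phi : la_morphism A A')
    (D : conn_op A A) (D' : conn_op A A') : Prop :=
  [/\ is_connection D, is_connection D',
      forall a b, is_section a -> is_section b ->
        forall x, D' a (push phi b) x = phi x (D a b x),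
      forall a k, is_section a -> is_section k -> (forall x, phi x (k x) = 0) ->
        forall x, D a k x = bracket A a k x &
      forall a a', is_section a -> is_section a' ->
        forall x, exists v : A x,
          D' a a' x = bracket A' (push phi a) a' x + phi x v].

Definition lfun_trace (K : fieldType) (V : vectType K) (f : 'End(V)) : K :=
  \tr (passmx.mxof (vbasis fullv) (vbasis fullv) f).

(* [w] is the 1-form [Delta(D0, D1) c_1 : a |-> tr (D1_a - D0_a)]; the
   difference of two connections is tensorial, so that it is given by
   endomorphisms of the fibres. *)
Definition is_delta_c1 (R : realType) (m : nat) (M : manifold R m)
    (A : lie_algebroid M) (S : vbundle M) (D0 D1 : conn_op A S)
    (w : form1 A) : Prop :=
  forall a, is_section a -> forall x, exists2 T : 'End(S x),
    (forall s, is_section s -> T (s x) = D1 a s x - D0 a s x) &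
    form1_app w a x = lfun_trace T.

Definition is_mu1 (R : realType) (m : nat) (M : manifold R m)
    (A A' : lie_algebroid M) (phi : la_morphism A A') (c : set (form1 A)) :
    Prop :=
  exists (D : conn_op A A) (D' : conn_op A A')
         (D'd : conn_op A (dual_bundle A'))
         (g : forall x, A x -> A x -> R) (g' : forall x, A' x -> A' x -> R)
         (Dg : conn_op A A) (Dg' : conn_op A A')
         (Dg'd : conn_op A (dual_bundle A')) (w : form1 A),
    [/\ distinguished_pair phi D D' /\ is_dual_connection D' D'd,
        is_metric g /\ is_orthogonal g Dg,
        [/\ is_metric g', is_orthogonal g' Dg' & is_dual_connection Dg' Dg'd],
        closed_form1 w /\
        is_delta_c1 (sum_connection Dg Dg'd) (sum_connection D D'd) w &
        c = coh_class w].

(** * The modular class *)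

(** ** Elements of [Lambda^s A (x) Lambda^m T^*M]

   With [s = rank A] and [m = dim M], such an element at [x] is encoded as the
   corresponding function, alternating and multilinear in each group of
   variables, of [s] elements of [A_x^*] and [m] tangent vectors at [x]. *)

Definition lfiber (R : realType) (m : nat) (M : manifold R m)
    (A : lie_algebroid M) (x : M) :=
  ('I_(rank A) -> 'Hom(A x, R^o)) -> ('I_m -> tvec M) -> R.

(* [b_1 /\ ... /\ b_s] *)
Definition wedge_sec (R : realType) (m : nat) (M : manifold R m)
    (A : lie_algebroid M) (b : 'I_(rank A) -> section A) (x : M)
    (nu : 'I_(rank A) -> 'Hom(A x, R^o)) : R :=
  \det (\matrix_(i, j) (nu i (b j x) : R)).

Definition mform (R : realType) (m : nat) (M : manifold R m) :=
  M -> ('I_m -> tvec M) -> R.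

(* [d xi^1 /\ ... /\ d xi^m] *)
Definition wedge_d (R : realType) (m : nat) (M : manifold R m)
    (xi : 'I_m -> M -> R) : mform M :=
  fun x Y => \det (\matrix_(h, k) Y k (xi h)).

(* The Lie derivative [L_X w], evaluated on vector fields [Y_1, ..., Y_m]. *)
Definition lie_derivative (R : realType) (m : nat) (M : manifold R m)
    (X : vfield M) (w : mform M) (Y : 'I_m -> vfield M) (x : M) : R :=
  X x (fun z => w z (fun k => Y k z))
  - \sum_h w x (fun k => (if k == h then vf_bracket X (Y h) else Y k) x).

Definition lgen (R : realType) (m : nat) (M : manifold R m)
    (A : lie_algebroid M) (b : 'I_(rank A) -> section A)
    (xi : 'I_m -> M -> R) (x : M) : lfiber A x :=
  fun nu Y => wedge_sec b nu * wedge_d xi x Y.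

(* [nabla_{b_i} ((/\_j b_j) (x) (/\_h d xi^h))], evaluated on covector fields
   [nu_1, ..., nu_s] and vector fields [Y_1, ..., Y_m]. *)
Definition lconn_gen (R : realType) (m : nat) (M : manifold R m)
    (A : lie_algebroid M) (b : 'I_(rank A) -> section A)
    (xi : 'I_m -> M -> R) (i : 'I_(rank A))
    (nu : 'I_(rank A) -> section (dual_bundle A)) (Y : 'I_m -> vfield M)
    (x : M) : R :=
  (\sum_j wedge_sec (fun k => if k == j then bracket A (b i) (b j) else b k)
            (fun l => nu l x)) * wedge_d xi x (fun k => Y k x)
  + wedge_sec b (fun l => nu l x) * lie_derivative (sharp (b i)) (wedge_d xi) Y x.

(* [nabla_a (f (/\_j b_j) (x) (/\_h d xi^h))], for [a = \sum_i a^i b_i], by the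
   rules of an A-connection. *)
Definition lconn (R : realType) (m : nat) (M : manifold R m)
    (A : lie_algebroid M) (b : 'I_(rank A) -> section A)
    (xi : 'I_m -> M -> R) (a : section A) (f : M -> R)
    (nu : 'I_(rank A) -> section (dual_bundle A)) (Y : 'I_m -> vfield M)
    (x : M) : R :=
  f x * (\sum_i coord [tuple b j x | j < rank A] i (a x)
                * lconn_gen b xi i nu Y x)
  + sharp a x f * lgen b xi (fun l => nu l x) (fun k => Y k x).

(* Local bases, coordinates and functions on an open set [W] are given by
   global sections and functions; only their restrictions to [W] matter. Any
   local object is of this form in a neighbourhood of each point. *)
Definition local_basis (R : realType) (m : nat) (M : manifold R m)
    (A : lie_algebroid M) (W : set M) (b : 'I_(rank A) -> section A) : Prop :=
  (forall j, is_section (b j)) /\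
  (forall x, W x -> basis_of fullv [tuple b j x | j < rank A]).

Definition local_coordinates (R : realType) (m : nat) (M : manifold R m)
    (W : set M) (xi : 'I_m -> M -> R) : Prop :=
  (forall h, smooth (xi h)) /\
  exists2 i, W `<=` chart_dom M i &
    forall x, W x -> forall h, xi h x = chart M i x 0 h.

(* [sigma] is a smooth nowhere vanishing section, defined up to sign, of
   [Lambda^s A (x) Lambda^m T^*M], and [nabla_a sigma = lambda(a) sigma]:
   locally [sigma = +- f (/\_j b_j) (x) (/\_h d xi^h)], with [f] smooth and
   non-zero. *)
Definition is_modular_form (R : realType) (m : nat) (M : manifold R m)
    (A : lie_algebroid M) (sigma : forall x, lfiber A x) (lambda : form1 A) :
    Prop :=
  forall (W : set M) b xi, open W -> local_basis W b -> local_coordinates W xi ->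
  forall x0, W x0 ->
  exists (U : set M) (f : M -> R),
    [/\ open U, U x0, U `<=` W, smooth f &
      forall x, U x ->
      [/\ f x != 0,
          exists e : bool, forall nu Y, (forall k, is_tvec x (Y k)) ->
            sigma x nu Y = (-1) ^+ e * (f x * lgen b xi nu Y) &
          forall a nu Y, is_section a -> (forall l, is_section (nu l)) ->
            (forall k, is_vfield (Y k)) ->
            lconn b xi a f nu Y x
            = form1_app lambda a x
              * (f x * lgen b xi (fun l => nu l x) (fun k => Y k x))]].

Definition is_modular_class (R : realType) (m : nat) (M : manifold R m)
    (A : lie_algebroid M) (c : set (form1 A)) : Prop :=
  exists (sigma : forall x, lfiber A x) (lambda : form1 A),
    [/\ is_modular_form sigma lambda, closed_form1 lambda & c = coh_class lambda].

(* Main.v *)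
Require Import Defs.
From mathcomp Require Import all_boot all_order all_algebra.
From mathcomp Require Import all_classical all_reals all_analysis.
From mathcomp Require Import perm ring lra.
Import Order.TTheory GRing.Theory Num.Theory.
Import numFieldNormedType.Exports.

Set Implicit Arguments.
Unset Strict Implicit.
Unset Printing Implicit Defensive.

Local Open Scope classical_set_scope.
Local Open Scope ring_scope.

(** Both classes are computed in local data: a frame [b] of [A] and a frame
    [b'] of [A'] with their dual coframes, and coordinates [xi] with dual vector
    fields [Y]. Evaluating the modular form [f (/\ b) (x) (/\ d xi)] of [A] on
    the dual data gives

      [lambda(a) = tr (ad a) + div (sharp a) + a(f) / f],

    where [tr (ad a)] is taken in the frame [b] and [div] in the coordinates
    ([modular_form_local]). For [lambda'(phi a)] the divergence is the same,
    because [a] and [phi a] have the same anchor, so it cancels in the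
    difference. On the other side, with [tr] the trace of the connection matrix
    in the frames,

      [w(a) = (tr D_a - tr D'_a) - (tr Dg_a - tr Dg'_a)]

    ([delta_c1_frames]). The differences [D_a - ad a] and
    [D'_a - ad (phi a)] are tensors, and the axioms of a distinguished pair make
    their traces equal ([distinguished_trace]): [phi] intertwines them, the first
    kills the kernel of [phi], the second has its image in that of [phi]. The
    kernel condition concerns sections only, hence is available at the points
    where the rank of [phi] is locally maximal; these are dense and the traces
    are continuous. An orthogonal connection has trace [a(log det G) / 2], with
    [G] the Gram matrix of the frame ([orthogonal_trace], by Jacobi's formula).
    Altogether [w(a) - (lambda(a) - lambda'(phi a))] is the derivative along [a] of

      [h = log |f'| + log (det G') / 2 - log |f| - log (det G) / 2].

    This is the logarithm of a ratio of norms of the two modular forms, hence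
    does not depend on the local data and is a global function
    ([modular_potential]).

    Tangent vectors are derivations of the algebra of smooth functions, so the
    argument rests on two facts of analysis: bump functions ([exists_cutoff]),
    which make everything local and extend local frames and coordinates, and
    Hadamard's lemma ([Hadamard]), by which a derivation at a point is determined
    by its values on coordinates ([tvec_coordE]); the latter gives the chain rule
    for derivations and makes the sum [tr (ad a) + div (sharp a)] tensorial
    ([adjoint_trace_divergence]). *)

(** * Functions of class C^k on open subsets of R^m *)

Section Ck.
Context {R : realType} {m : nat}.
Implicit Types (U V : set 'rV[R]_m) (f g : 'rV[R]_m -> R).

Lemma Ck_on_continuous k U f y : Ck_on k U f -> U y -> {for y, continuous f}.
Proof. by case: k => [|k] [cf _]; apply: cf. Qed.

Lemma Ck_on_derive k U f i : Ck_on k.+1 U f ->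
  Ck_on k U (fun y => 'D_(delta_mx 0 i) f y).
Proof. by move=> [_ /(_ i)[]]. Qed.

Lemma Ck_on_is_derive k U f i y : Ck_on k.+1 U f -> U y ->
  is_derive y (delta_mx 0 i) f ('D_(delta_mx 0 i) f y).
Proof. by move=> [_ /(_ i)[df _]] Uy; apply: derivableP; apply: df. Qed.

Lemma Ck_onW k U f : Ck_on k.+1 U f -> Ck_on k U f.
Proof.
elim: k f => [|k IH] f [cf df]; split=> // i.
by have [di ci] := df i; split=> //; apply: IH.
Qed.

Lemma Ck_on_local k U f :
  (forall y, U y -> exists2 V, V y & Ck_on k V f) -> Ck_on k U f.
Proof.
elim: k f => [|k IH] f loc; (split; last first) => //.
- by move=> y /loc[V Vy [cf _]]; apply: cf.
- move=> i; split=> [y /loc[V Vy [_ /(_ i)[df _]]]|]; first exact: df.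
  by apply: IH => y /loc[V Vy [_ /(_ i)[_ cf]]]; exists V.
- by move=> y /loc[V Vy [cf _]]; apply: cf.
Qed.

(** Membership in [Ck_on] is checked with explicit candidates for the partial
    derivatives, so that closure properties follow by induction on the order. *)
Lemma Ck_onS k U f (df : 'I_m -> 'rV[R]_m -> R) : open U ->
  (forall y, U y -> {for y, continuous f}) ->
  (forall i y, U y -> is_derive y (delta_mx 0 i) f (df i y)) ->
  (forall i, Ck_on k U (df i)) -> Ck_on k.+1 U f.
Proof.
move=> oU cf dfE cdf; split=> // i; split=> [y Uy|].
  by have := dfE i y Uy => -[].
apply: Ck_on_ext (cdf i) => // y Uy; have := dfE i y Uy => d.
by rewrite derive_val.
Qed.

Lemma Ck_onD k U f g : open U -> Ck_on k U f -> Ck_on k U g ->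
  Ck_on k U (fun y => f y + g y).
Proof.
move=> oU; elim: k f g => [|k IH] f g sf sg.
  by split=> // y Uy; apply: (@continuousD _ _ _ f g);
    [apply: Ck_on_continuous sf Uy|apply: Ck_on_continuous sg Uy].
apply: (@Ck_onS _ _ _ (fun i y => 'D_(delta_mx 0 i) f y + 'D_(delta_mx 0 i) g y)) => //.
- by move=> y Uy; apply: (@continuousD _ _ _ f g);
    [apply: Ck_on_continuous sf Uy|apply: Ck_on_continuous sg Uy].
- move=> i y Uy; have := Ck_on_is_derive i sf Uy; have := Ck_on_is_derive i sg Uy.
  by move=> *; apply: is_deriveD.
- by move=> i; apply: IH; apply: Ck_on_derive.
Qed.

Lemma Ck_onM k U f g : open U -> Ck_on k U f -> Ck_on k U g ->
  Ck_on k U (fun y => f y * g y).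
Proof.
move=> oU; elim: k f g => [|k IH] f g sf sg.
  by split=> // y Uy; apply: (@continuousM _ _ f g);
    [apply: Ck_on_continuous sf Uy|apply: Ck_on_continuous sg Uy].
apply: (@Ck_onS _ _ _ (fun i y =>
  f y * 'D_(delta_mx 0 i) g y + g y * 'D_(delta_mx 0 i) f y)) => //.
- by move=> y Uy; apply: (@continuousM _ _ f g);
    [apply: Ck_on_continuous sf Uy|apply: Ck_on_continuous sg Uy].
- move=> i y Uy; have := Ck_on_is_derive i sf Uy; have := Ck_on_is_derive i sg Uy.
  by move=> *; apply: is_deriveM.
- by move=> i; apply: Ck_onD => //; apply: IH => //;
    [apply: Ck_onW|apply: Ck_on_derive|apply: Ck_onW|apply: Ck_on_derive].
Qed.

Lemma Ck_on_sum k U (I : Type) (r : seq I) (P : pred I) (F : I -> 'rV[R]_m -> R) :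
  open U -> (forall i, Ck_on k U (F i)) ->
  Ck_on k U (fun y => \sum_(i <- r | P i) F i y).
Proof.
move=> oU cF; elim: r => [|i r IH].
  by apply: Ck_on_ext (Ck_on_cst k U 0) => // y _; rewrite big_nil.
apply: (@Ck_on_ext _ _ _ _ (fun y => (if P i then F i y else 0) + \sum_(i <- r | P i) F i y)) => //.
  by move=> y _; rewrite big_cons; case: (P i); rewrite ?add0r.
apply: Ck_onD => //; case: (P i) => //; exact: Ck_on_cst.
Qed.

Lemma Ck_on_coord k U i : open U -> Ck_on k U (fun y => y 0 i).
Proof.
move=> oU; have c y : U y -> {for y, continuous (fun y : 'rV[R]_m => y 0 i)}.
  by move=> _; apply: coord_continuous.
case: k => [|k]; first by split.
apply: (@Ck_onS _ _ _ (fun j _ => ((i == j)%:R : R))) => //; last first.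
  by move=> j; apply: Ck_on_cst.
move=> j y Uy; have did := @is_derive_id R 'rV[R]_m y (delta_mx 0 j).
have dy : derivable (@id 'rV[R]_m) y (delta_mx 0 j) by [].
have := (derivable_mxP _ _ _).1 dy 0 i => /derivableP.
by have := derive_mx dy; rewrite derive_id => /matrixP/(_ 0 i); rewrite !mxE eqxx /= => <-.
Qed.

Lemma is_derive1P f (x v : 'rV[R]_m) d :
  is_derive x v f d <-> is_derive (0 : R) 1 (fun h : R => f (h *: v + x)) d.
Proof.
have E : 'D_v f x = 'D_1 (fun h : R => f (h *: v + x)) 0.
  rewrite /derive; set g1 := fun h => h^-1 *: _; set g2 := fun h => h^-1 *: _.
  suff -> : g1 = g2 by [].
  by rewrite funeqE /g1 /g2 => h /=; rewrite addr0 scale0r add0r [_%:A]mulr1.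
split=> -[D V].
  apply: DeriveDef; last by rewrite -E.
  exact: (derivable1P f x v).1.
apply: DeriveDef; last by rewrite E.
exact: (derivable1P f x v).2.
Qed.

Lemma is_derive_comp1 (u : R -> R) du f df y (e : 'rV[R]_m) :
  is_derive (f y) 1 u du -> is_derive y e f df ->
  is_derive y e (u \o f) (du * df).
Proof.
move=> hu /is_derive1P hf; apply/is_derive1P.
have hu' : is_derive ((fun h : R => f (h *: e + y)) 0) 1 u du.
  by rewrite scale0r add0r.
exact: is_derive1_comp.
Qed.

(** Induction on the order closes only for a whole family of functions [u t]
    that is stable under differentiation, such as the logarithm together with
    the inverse. *)
Lemma Ck_on_comp1 (T : Type) (O : set R) (u v : T -> R -> R) :
  (forall t s, O s -> is_derive s 1 (u t) (v t s)) ->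
  (forall k U f t, open U -> (forall t', Ck_on k U (u t' \o f)) ->
     Ck_on k U (v t \o f)) ->
  forall k U f t, open U -> (forall y, U y -> O (f y)) -> Ck_on k U f ->
  Ck_on k U (u t \o f).
Proof.
move=> du cv k U f t oU Of; elim: k t => [|k IH] t cf.
  split=> // y Uy; apply: continuous_comp; first exact: Ck_on_continuous cf Uy.
  have [D _] := du t _ (Of _ Uy).
  by apply/differentiable_continuous/derivable1_diffP.
apply: (@Ck_onS _ _ _ (fun i y => (v t \o f) y * 'D_(delta_mx 0 i) f y)) => //.
- move=> y Uy; apply: continuous_comp; first exact: Ck_on_continuous cf Uy.
  have [D _] := du t _ (Of _ Uy).
  by apply/differentiable_continuous/derivable1_diffP.
- move=> i y Uy; apply: is_derive_comp1; first exact: du (Of _ Uy).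
  exact: Ck_on_is_derive cf Uy.
- move=> i; apply: Ck_onM => //; last exact: Ck_on_derive.
  by apply: cv => // t'; apply: IH; apply: Ck_onW.
Qed.

Lemma Ck_on_expR k U f : open U -> Ck_on k U f -> Ck_on k U (fun y => expR (f y)).
Proof.
move=> oU cf; apply: (@Ck_on_comp1 unit setT (fun=> expR) (fun=> expR)) => //.
by move=> k' U' f' _ _ /(_ tt).
Qed.

Lemma Ck_onV k U f : open U -> (forall y, U y -> f y != 0) -> Ck_on k U f ->
  Ck_on k U (fun y => (f y)^-1).
Proof.
move=> oU f0 cf.
apply: (@Ck_on_comp1 unit [set s | s != 0] (fun _ s => s^-1)
  (fun _ s => -1 * (s^-1 * s^-1))) => //.
- move=> _ s s0; have := @is_deriveV R id s 1 1 s0 (is_derive_id _ _).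
  move=> h; apply: is_derive_eq h _.
  by rewrite -[_ *: _]/(_ * _) mulr1 -exprVn expr2 mulN1r.
- move=> k' U' f' _ oU' /(_ tt) c; apply: Ck_onM => //; first exact: Ck_on_cst.
  exact: Ck_onM.
Qed.

Lemma Ck_on_ln k U f : open U -> (forall y, U y -> 0 < f y) -> Ck_on k U f ->
  Ck_on k U (fun y => ln (f y)).
Proof.
move=> oU f0 cf.
pose v (b : bool) (s : R) := if b then s^-1 else -1 * (s^-1 * s^-1).
pose u (b : bool) (s : R) := if b then ln s else s^-1.
apply: (@Ck_on_comp1 bool [set s | 0 < s] u v _ _ k U f true) => //.
- move=> [] s s0 /=; first exact: is_derive1_ln.
  have := @is_deriveV R id s 1 1 (lt0r_neq0 s0) (is_derive_id _ _).
  move=> h; apply: is_derive_eq h _.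
  by rewrite -[_ *: _]/(_ * _) mulr1 -exprVn expr2 mulN1r.
- move=> k' U' f' [] oU' c; first exact: (c false).
  apply: Ck_onM => //; first exact: Ck_on_cst.
  by apply: Ck_onM => //; exact: (c false).
Qed.

End Ck.

(** * Mean value estimates and the chain rule *)

Lemma is_derive0P (R : realType) (g : R -> R) d :
  is_derive (0 : R) 1 g d <-> h^-1 * (g h - g 0) @[h --> 0^'] --> d.
Proof.
have E : (fun h : R => h^-1 *: ((g \o shift 0) (h *: (1 : R)) - g 0)) =
         (fun h => h^-1 * (g h - g 0)).
  by apply/funext => h /=; rewrite addr0 [_%:A]mulr1.
split=> [[D V]|L].
  by move: D; rewrite /derivable E; move: V; rewrite /derive E => <-.
have L' : h^-1 *: ((g \o shift 0) (h *: (1 : R)) - g 0) @[h --> 0^'] --> d.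
  by rewrite E.
apply: DeriveDef; last exact: cvg_lim L'.
by apply/cvg_ex; exists d.
Qed.

Section MeanValue.
Context {R : realType} {m : nat}.
Implicit Types (f : 'rV[R]_m -> R) (p e : 'rV[R]_m) (r t d : R).

Lemma convex_lt t (a b c : R) :
  0 <= t -> t <= 1 -> a < c -> b < c -> (1 - t) * a + t * b < c.
Proof.
move=> t0 t1 ac bc; rewrite -subr_gt0.
have -> : c - ((1 - t) * a + t * b) = (1 - t) * (c - a) + t * (c - b) by ring.
case: (ltgtP t 0) t0 => // [tp _|-> _].
  by rewrite ltr_wpDl ?mulr_gt0 ?subr_gt0 // mulr_ge0 ?subr_ge0 // ltW.
by rewrite mul0r addr0 subr0 mul1r subr_gt0.
Qed.

Lemma is_derive_line f p e r t d : is_derive (p + (t * r) *: e) e f d ->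
  is_derive t 1 (fun s : R => f (p + (s * r) *: e)) (d * r).
Proof.
move=> /is_derive1P df.
pose a (s : R) : R := (s - t) * r.
have da : is_derive t 1 a r.
  have h : is_derive t 1 ((fun s : R => s - t) * cst r) ((t - t) *: 0 + r *: (1 - 0)).
    exact: is_deriveM.
  by apply: is_derive_eq h _; rewrite scaler0 add0r subr0 [_%:A]mulr1.
have a0 : a t = 0 by rewrite /a subrr mul0r.
rewrite -a0 in df.
have := is_derive1_comp df da; congr is_derive; apply/funext => s /=.
congr f; rewrite /a addrCA -scalerDl; congr (_ + _ *: _); ring.
Qed.

Lemma mvt_direction f p e r :
  (forall t, 0 <= t <= 1 -> derivable f (p + (t * r) *: e) e) ->
  exists2 t, 0 <= t <= 1 & f (p + r *: e) - f p = 'D_e f (p + (t * r) *: e) * r.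
Proof.
move=> df.
have dg t : 0 <= t <= 1 -> is_derive t 1 (fun s : R => f (p + (s * r) *: e))
     ('D_e f (p + (t * r) *: e) * r).
  by move=> t01; apply: is_derive_line; apply: derivableP; apply: df.
have [||t t01] := @MVT_segment R (fun s : R => f (p + (s * r) *: e)) (fun t => 'D_e f (p + (t * r) *: e) * r) 0 1 ler01.
- by move=> t; rewrite in_itv /= => /andP[t0 t1]; apply: dg; rewrite !ltW.
- apply: derivable_within_continuous => t; rewrite in_itv /= => t01.
  by have [] := dg t t01.
rewrite mul1r mul0r scale0r addr0 subr0 mulr1 => E.
by exists t => //; move: t01; rewrite in_itv.
Qed.

(** Going from [u] to [v] along the coordinate axes stays within the ball of
    the sup norm, so bounds on the partial derivatives control the increment. *)
Lemma mean_value_bound f y rho (c : 'I_m -> R) eps :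
  (forall z i, ball y rho z -> derivable f z (delta_mx 0 i) /\
     `|'D_(delta_mx 0 i) f z - c i| <= eps) ->
  forall u v, ball y rho u -> ball y rho v ->
  `|f v - f u - \sum_i c i * (v 0 i - u 0 i)| <= m%:R * eps * `|v - u|.
Proof.
move=> H u v [r0 Bu] [_ Bv].
pose P k : 'rV[R]_m := \row_(j < m) (if (j < k)%N then v 0 j else u 0 j).
have P0 : P 0%N = u by apply/rowP => j; rewrite mxE.
have Pm : P m = v by apply/rowP => j; rewrite mxE ltn_ord.
have -> : f v - f u = \sum_(i < m) (f (P i.+1) - f (P i)).
  rewrite -{1}Pm -{1}P0 -(big_mkord xpredT (fun i => f (P i.+1) - f (P i))).
  by rewrite telescope_sumr.
rewrite -sumrB; apply: le_trans (ler_norm_sum _ _ _) _.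
rewrite -mulrA mulr_natl -[X in _ *+ X]card_ord -sumr_const; apply: ler_sum => i _.
set r := v 0 i - u 0 i.
have line t : P i + (t * r) *: delta_mx 0 i =
    \row_j (if (j < i)%N then v 0 j else if j == i then u 0 i + t * r else u 0 j).
  apply/rowP => j; rewrite !mxE eqxx /=.
  by case: (ltngtP j i) => [ji|ji|/val_inj ->];
    rewrite ?eqxx ?mulr1 // -val_eqE /= ?(ltn_eqF ji) ?(gtn_eqF ji) mulr0 addr0.
have inB t : 0 <= t <= 1 -> ball y rho (P i + (t * r) *: delta_mx 0 i).
  move=> /andP[t0 t1]; rewrite line; split=> // a j; rewrite [a]ord1 mxE.
  case: ifP => _; first exact: Bv.
  case: eqP => [->|_]; last exact: Bu.
  have := Bu 0 i; have := Bv 0 i; rewrite /ball /= /r.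
  rewrite !ltr_norml => /andP[v1 v2] /andP[u1 u2].
  have -> : y 0 i - (u 0 i + t * (v 0 i - u 0 i)) =
    (1 - t) * (y 0 i - u 0 i) + t * (y 0 i - v 0 i) by ring.
  rewrite (convex_lt t0 t1 u2 v2) andbT ltrNl opprD -!mulrN.
  by apply: convex_lt => //; rewrite ltrNl.
have [|t t01] := @mvt_direction f (P i) (delta_mx 0 i) r.
  by move=> t t01; have [] := H _ i (inB t t01).
have -> : P i + r *: delta_mx 0 i = P i.+1.
  rewrite -[r]mul1r line; apply/rowP => j; rewrite !mxE ltnS [(j <= i)%N]leq_eqVlt.
  rewrite -val_eqE /=; case: (ltngtP j i) => //= /val_inj ->.
  by rewrite mul1r /r addrC subrK.
move=> ->; rewrite -mulrBl normrM.
have [_ bd] := H _ i (inB t t01).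
apply: ler_pM => //.
rewrite [X in _ <= X]/Num.norm /= mx_normrE.
apply: le_trans (le_bigmax _ _ (0, i)) => /=.
by rewrite !mxE.
Qed.

(** Near [c 0] the partial derivatives are close to their values there, so
    [mean_value_bound] compares the increment of [f] along the curve with its
    linear part. *)
Lemma is_derive_curve f (c : R -> 'rV[R]_m) (dc : 'I_m -> R) (V : set 'rV[R]_m) :
  open V -> V (c 0) ->
  (forall z i, V z -> derivable f z (delta_mx 0 i)) ->
  (forall i, {for c 0, continuous (fun z => 'D_(delta_mx 0 i) f z)}) ->
  (forall l, is_derive (0 : R) 1 (fun h => c h 0 l) (dc l)) ->
  is_derive (0 : R) 1 (f \o c) (\sum_l 'D_(delta_mx 0 l) f (c 0) * dc l).
Proof.
move=> oV Vc df cdf dcE; apply/is_derive0P.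
have cq l : h^-1 * (c h 0 l - c 0 0 l) @[h --> 0^'] --> dc l.
  by apply/is_derive0P.
pose D l := 'D_(delta_mx 0 l) f (c 0).
have S : \sum_l D l * (h^-1 * (c h 0 l - c 0 0 l)) @[h --> 0^'] -->
         \sum_l D l * dc l.
  apply: cvg_big => [|l _]; first exact: add_continuous.
  apply: cvgM; [exact: cvg_cst|exact: cq].
have cc : {for (0 : R), continuous c}.
  have : derivable c (0 : R) 1.
    by apply/derivable_mxP => i j; rewrite [i]ord1; have [] := dcE j.
  by move=> /derivable1_diffP/differentiable_continuous.
pose L := 1 + \sum_l `|dc l|.
have L0 : 0 < L by rewrite ltr_pwDl ?ltr01 // sumr_ge0.
suff Z : h^-1 * ((f \o c) h - (f \o c) 0) -
     \sum_l D l * (h^-1 * (c h 0 l - c 0 0 l)) @[h --> 0^'] --> 0.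
  have Fd : Filter (0 : R)^' by exact: dnbhs_filter.
  have := cvgD Z S; rewrite add0r => /(_ Fd).
  apply: cvg_trans; apply: near_eq_cvg; apply: nearW => h.
  by rewrite [LHS]subrK.
apply/cvgrPdist_le => e e0.
pose eps := e / (m.+1%:R * L).
have eps0 : 0 < eps by rewrite divr_gt0 // mulr_gt0 // ltr0n.
have n1 : \forall z \near c 0, V z by apply: open_nbhs_nbhs.
have n2 : \forall z \near c 0, forall l, `|D l - 'D_(delta_mx 0 l) f z| <= eps.
  apply: (@filter_forall _ _ (fun l z => `|D l - 'D_(delta_mx 0 l) f z| <= eps) (nbhs (c 0))) => l.
  by move/cvgrPdist_le: (cdf l) => /(_ _ eps0).
have [rho /= rho0 Brho] := (nbhs_ballP _ _).1 (filterI n1 n2).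
have n3 : \forall h \near (0 : R)^', ball (c 0) rho (c h).
  have : \forall h \near (0 : R), ball (c 0) rho (c h).
    by apply: cc; apply: nbhsx_ballx.
  exact: nbhs_dnbhs.
have n4 : \forall h \near (0 : R)^', forall l, `|h^-1 * (c h 0 l - c 0 0 l)| <= L.
  apply: filter_forall => l.
  move/cvgrPdist_le: (cq l) => /(_ 1 ltr01); apply: filterS => h hl.
  rewrite -[X in `|X|](subKr (dc l)); apply: le_trans (ler_normB _ _) _.
  rewrite /L addrC lerD // (bigD1 l) //= lerDl sumr_ge0 //.
near=> h; rewrite sub0r normrN /=.
have Bh : ball (c 0) rho (c h) by near: h.
have bnd : forall l, `|h^-1 * (c h 0 l - c 0 0 l)| <= L by near: h.
have h0 : h != 0 by near: h; apply: nbhs_dnbhs_neq.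
have Dz z i : ball (c 0) rho z -> derivable f z (delta_mx 0 i) /\
    `|'D_(delta_mx 0 i) f z - D i| <= eps.
  by move=> /Brho[Vz /(_ i)]; rewrite distrC => ?; split=> //; exact: df.
have MV := mean_value_bound Dz (ballxx _ rho0) Bh.
have -> : h^-1 * (f (c h) - f (c 0)) - \sum_l D l * (h^-1 * (c h 0 l - c 0 0 l)) =
   h^-1 * (f (c h) - f (c 0) - \sum_l D l * (c h 0 l - c 0 0 l)).
  rewrite [RHS]mulrBr mulr_sumr; congr (_ - _); apply: eq_bigr => l _; ring.
rewrite normrM.
have nch : `|c h - c 0| <= `|h| * L.
  rewrite [X in X <= _]/Num.norm /= mx_normrE; apply: bigmax_le => [|[i j] _] /=.
    by rewrite mulr_ge0 // ltW.
  rewrite [i]ord1 !mxE -[X in `|X|](mulVKf h0) normrM ler_wpM2l //.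
apply: le_trans (ler_wpM2l (normr_ge0 _) MV) _.
apply: le_trans (ler_wpM2l (normr_ge0 _) (ler_wpM2l _ nch)) _.
  by rewrite mulr_ge0 // ltW.
rewrite normfV.
have -> : `|h|^-1 * (m%:R * eps * (`|h| * L)) = m%:R * eps * L.
  by field; rewrite normr_eq0.
rewrite /eps.
have -> : m%:R * (e / (m.+1%:R * L)) * L = e * (m%:R / m.+1%:R).
  have := lt0r_neq0 L0; have : m.+1%:R != 0 :> R by rewrite pnatr_eq0.
  by move: (m.+1%:R : R) (m%:R : R) => a b a0 L0'; field; rewrite a0 L0'.
rewrite ler_piMr ?(ltW e0) // ler_pdivrMr ?ltr0n // mul1r ler_nat //.
Unshelve. all: by end_near.
Qed.

End MeanValue.

Lemma rV_continuous (R : realType) (m n : nat) (Phi : 'rV[R]_m -> 'rV[R]_n) y :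
  (forall l, {for y, continuous (fun z => Phi z 0 l)}) -> {for y, continuous Phi}.
Proof.
move=> cPhi A /(nbhs_ballP _ _).1 [e /= e0 BA].
have : \forall z \near y, forall j, ball (Phi y 0 j) e (Phi z 0 j).
  apply: (@filter_forall _ _ (fun j z => ball (Phi y 0 j) e (Phi z 0 j)) (nbhs y) (nbhs_filter y)) => j.
  by apply: (cPhi j); apply: nbhsx_ballx.
by apply: filterS => z Bz; apply: BA; split=> // i j; rewrite [i]ord1.
Qed.

(** A function with continuous partial derivatives is differentiable, so the
    usual chain rule expresses the partial derivatives of a composite. *)
Lemma Ck_on_comp (R : realType) (m n k : nat) (U : set 'rV[R]_m)
    (V : set 'rV[R]_n) (F : 'rV[R]_n -> R) (Phi : 'rV[R]_m -> 'rV[R]_n) :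
  open U -> open V -> (forall y, U y -> V (Phi y)) ->
  (forall l, Ck_on k U (fun y => Phi y 0 l)) -> Ck_on k V F ->
  Ck_on k U (F \o Phi).
Proof.
move=> oU oV UV; elim: k F => [|k IH] F cPhi cF.
  split=> // y Uy; apply: continuous_comp.
    by apply: rV_continuous => l; apply: Ck_on_continuous (cPhi l) Uy.
  by apply: Ck_on_continuous cF _; apply: UV.
apply: (@Ck_onS _ _ _ _ _ (fun i y => \sum_l 'D_(delta_mx 0 l) F (Phi y) *
   'D_(delta_mx 0 i) (fun z => Phi z 0 l) y)) => //.
- move=> y Uy; apply: continuous_comp.
    by apply: rV_continuous => l; apply: Ck_on_continuous (cPhi l) Uy.
  by apply: Ck_on_continuous cF _; apply: UV.
- move=> i y Uy; apply/is_derive1P.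
  pose c h := Phi (h *: delta_mx 0 i + y).
  have c0 : c 0 = Phi y by rewrite /c scale0r add0r.
  rewrite -c0; apply: (@is_derive_curve _ _ F c _ V) => //.
  + by rewrite c0; apply: UV.
  + by move=> z j Vz; have [] := Ck_on_is_derive j cF Vz.
  + by move=> j; rewrite c0; apply: Ck_on_continuous (Ck_on_derive j cF) (UV _ Uy).
  + move=> l; have /is_derive1P := Ck_on_is_derive i (cPhi l) Uy.
    exact.
- move=> i; apply: Ck_on_sum => // l; apply: Ck_onM => //.
    by apply: (IH (fun z => 'D_(delta_mx 0 l) F z)) => [l'|];
      [apply: Ck_onW|apply: Ck_on_derive].
  exact: Ck_on_derive.
Qed.

(** * Hadamard's lemma *)

Lemma norm_ball_compact (R : realType) (m : nat) (y0 : 'rV[R]_m) r :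
  compact [set z : 'rV[R]_m | `|z - y0| <= r].
Proof.
have cd : continuous (fun z : 'rV[R]_m => `|z - y0|).
  move=> z; apply: (@continuous_comp _ _ _ (fun z : 'rV[R]_m => z - y0) (fun z : 'rV[R]_m => `|z|)).
    by apply: continuousB; [exact: cvg_id|exact: cst_continuous].
  exact: norm_continuous.
apply: bounded_closed_compact.
  exists (r + `|y0|); split; first exact: num_real.
  move=> x xr z Kz; apply: le_trans (ltW xr).
  by rewrite -[z](subrK y0); apply: le_trans (ler_normD _ _) _; rewrite lerD2r.
rewrite -[X in closed X]/((fun z : 'rV[R]_m => `|z - y0|) @^-1` [set x : R | x <= r]).
by apply: preimage_closed; [move=> z _; apply: cd|apply: closed_le].
Qed.

Section Hadamard.
Context {R : realType} {m : nat}.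
Variables (y0 : 'rV[R]_m) (rho : R).
Implicit Types (H : 'rV[R]_m -> R) (y z : 'rV[R]_m) (t r C s : R).
Let B := ball y0 rho.
Let mu := @lebesgue_measure R.

Let inB z : B z <-> `|z - y0| < rho.
Proof. by rewrite /B -ball_normE /ball_ /= distrC. Qed.

Let segB y t : B y -> 0 <= t <= 1 -> B (y0 + t *: (y - y0)).
Proof.
move=> /inB By /andP[t0 t1]; apply/inB; rewrite addrAC subrr add0r normrZ.
by rewrite ger0_norm //; apply: le_lt_trans By; rewrite ler_piMl.
Qed.

Let oB : open B. Proof. exact: ball_open. Qed.

(** Hadamard's quotients are the case [p = 0]; each differentiation under the
    integral sign raises the weight [t ^+ p] by one. *)
Definition radial_mean (p : nat) (H : 'rV[R]_m -> R) (y : 'rV[R]_m) : R :=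
  (\int[mu]_(t in `[0%R, 1%R]) (t ^+ p * H (y0 + t *: (y - y0))))%R.

Let cont_radial p H y t : (forall z, B z -> {for z, continuous H}) -> B y ->
  0 <= t <= 1 -> {for t, continuous (fun t : R => t ^+ p * H (y0 + t *: (y - y0)))}.
Proof.
move=> cH By t01; apply: (@continuousM _ _ (fun t : R => t ^+ p) (fun t => H (y0 + t *: (y - y0)))).
  exact: exprn_continuous.
apply: (@continuous_comp _ _ _ (fun t : R => y0 + t *: (y - y0)) H); last first.
  by apply: cH; apply: segB.
apply: (@continuousD _ _ _ (cst y0) (fun t : R => t *: (y - y0))); first exact: cst_continuous.
exact: scalel_continuous.
Qed.

Let int_radial p H y : (forall z, B z -> {for z, continuous H}) -> B y ->
  mu.-integrable `[0, 1]%classic (EFin \o (fun t : R => t ^+ p * H (y0 + t *: (y - y0)))).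
Proof.
move=> cH By; apply: continuous_compact_integrable; first exact: segment_compact.
apply: continuous_in_subspaceT => t; rewrite inE /= in_itv /= => t01.
exact: cont_radial.
Qed.

Let mu01 : mu `[0, 1]%classic = 1%E.
Proof. by rewrite /mu lebesgue_measure_itv /= lte_fin ltr01 oppr0 adde0. Qed.

Let radial_bound p H r C y : r < rho -> (forall z, B z -> {for z, continuous H}) ->
  (forall z, `|z - y0| <= r -> `|H z| <= C) -> `|y - y0| <= r ->
  `|radial_mean p H y| <= C.
Proof.
move=> r1 cH HC yr.
have By : B y by apply/inB; apply: le_lt_trans r1.
apply: le_trans; first apply: le_normr_Rintegral => //; first exact: int_radial.
have -> : C = (\int[mu]_(_ in `[0%R, 1%R]) C)%R.
  by rewrite Rintegral_cst //= [X in fine X]mu01 mulr1.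
apply: le_Rintegral => //.
- apply: (@integrable_norm _ _ _ mu) => //; exact: int_radial.
- apply: continuous_compact_integrable; first exact: segment_compact.
  by apply: continuous_subspaceT => ?; apply: cst_continuous.
- move=> t; rewrite /= in_itv /= => /andP[t0 t1].
  rewrite normrM -[X in _ <= X]mul1r; apply: ler_pM => //.
    by rewrite ger0_norm ?exprn_ge0 // exprn_ile1.
  apply: HC; rewrite addrAC subrr add0r normrZ ger0_norm //.
  by apply: le_trans yr; rewrite ler_piMl.
Qed.

Let bound_closed H r : r < rho -> (forall z, B z -> {for z, continuous H}) ->
  exists2 C, 0 <= C & forall z, `|z - y0| <= r -> `|H z| <= C.
Proof.
move=> r1 cH; have [r0|r0] := ltP r 0.
  exists 0 => // z zr; have := normr_ge0 (z - y0); rewrite leNgt.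
  by rewrite (le_lt_trans zr r0).
pose K := [set z : 'rV[R]_m | `|z - y0| <= r].
have cK : compact K by exact: norm_ball_compact.
have K0 : K !=set0 by exists y0; rewrite /K /= subrr normr0.
have cHK : {within K, continuous (fun z => `|H z|)}.
  apply: continuous_in_subspaceT => z; rewrite inE /K /= => zr.
  apply: continuous_comp; last exact: norm_continuous.
  by apply: cH; apply/inB; apply: le_lt_trans r1.
have [c _ Hc] := EVT_max_rV K0 cK cHK.
exists `|H c| => // z zr; apply: Hc.
by rewrite inE.
Qed.

(** Differentiation under the integral sign: the derivative of the integrand is
    dominated by the maximum of ['D_i H] on a compact ball around [y0]. *)
Lemma is_derive_radial_mean p H i y : B y ->
  (forall z, B z -> {for z, continuous H}) ->
  (forall z, B z -> derivable H z (delta_mx 0 i)) ->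
  (forall z, B z -> {for z, continuous (fun z => 'D_(delta_mx 0 i) H z)}) ->
  is_derive y (delta_mx 0 i) (radial_mean p H)
    (radial_mean p.+1 (fun z => 'D_(delta_mx 0 i) H z) y).
Proof.
move=> By cH dH cdH; apply/is_derive1P.
pose e : 'rV[R]_m := delta_mx 0 i.
pose f (s t : R) : R := t ^+ p * H (y0 + t *: (s *: e + y - y0)).
have ne : `|e| <= 1.
  rewrite [X in X <= _]/Num.norm /= mx_normrE; apply: bigmax_le => // -[a b] _ /=.
  by rewrite mxE; case: (_ && _); rewrite ?normr1 ?normr0.
have /inB By' := By.
pose d := (rho - `|y - y0|) / 2.
have d0 : 0 < d by rewrite divr_gt0 // subr_gt0.
pose r := `|y - y0| + d.
have r1 : r < rho by rewrite /r /d; lra.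
have near_y s : s \in `]-d, d[ -> `|s *: e + y - y0| <= r.
  rewrite in_itv /= => sd; rewrite -addrA addrC; apply: le_trans (ler_normD _ _) _.
  rewrite /r lerD2l normrZ; apply: le_trans (ler_piMr (normr_ge0 _) ne) _.
  by rewrite ler_norml; case/andP: sd => s1 s2; rewrite !ltW.
have near_B s : s \in `]-d, d[ -> B (s *: e + y).
  by move=> /near_y h; apply/inB; apply: le_lt_trans r1.
have [C C0 HC] := bound_closed r1 cdH.
have dfE s t : s \in `]-d, d[ -> t \in `[0, 1] ->
    is_derive s 1 (f ^~ t) (t ^+ p.+1 * 'D_e H (y0 + t *: (s *: e + y - y0))).
  move=> sd; rewrite in_itv /= => t01.
  have Bz := segB (near_B s sd) t01.
  have E : y0 + t *: (s *: e + y - y0) = (y0 + t *: (y - y0)) + (s * t) *: e.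
    by rewrite -[s *: e + y - y0]addrA scalerDr scalerA [t * s]mulrC -addrA [X in _ + X]addrC.
  have D : is_derive (y0 + t *: (y - y0) + (s * t) *: e) e H
      ('D_e H (y0 + t *: (s *: e + y - y0))).
    by rewrite -E; apply: derivableP; apply: dH.
  have D2 := is_derive_line D.
  have D3 := @is_deriveZ _ _ _ _ (t ^+ p) _ _ _ D2.
  have -> : f ^~ t = t ^+ p *: (fun s : R => H (y0 + t *: (y - y0) + (s * t) *: e)).
    apply/funext => s'; rewrite /f -[RHS]/(_ * _); congr (_ * H _).
    by rewrite -[s' *: e + y - y0]addrA scalerDr scalerA [t * s']mulrC -addrA [X in _ + X]addrC.
  apply: is_derive_eq D3 _; rewrite -[LHS]/(_ * _) exprS; ring.
have a0 : `]-d, d[%classic (0 : R) by rewrite /= in_itv /= oppr_lt0 d0.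
have intf s : `]-d, d[%classic s -> mu.-integrable `[0, 1]%classic (EFin \o f s).
  by move=> sd; apply: int_radial => //; apply: near_B.
have derf s t : `]-d, d[%classic s -> `[0, 1]%classic t -> derivable (f ^~ t) s 1.
  by move=> sd t01; have [] := dfE s t sd t01.
have dfub s t : `]-d, d[%classic s -> `[0, 1]%classic t ->
    `|partial1of2 f s t| <= cst C t.
  move=> sd t01; rewrite partial1of2E; have D := dfE s t sd t01.
  rewrite derive_val; move: t01; rewrite /= in_itv /= => /andP[t0 t1].
  rewrite normrM -[X in _ <= X]mul1r; apply: ler_pM => //.
    by rewrite ger0_norm ?exprn_ge0 // exprn_ile1.
  apply: HC; rewrite addrAC subrr add0r normrZ ger0_norm //.
  by apply: le_trans (near_y s sd); rewrite ler_piMl.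
have intC : mu.-integrable `[0, 1]%classic (EFin \o cst C).
  apply: continuous_compact_integrable; first exact: segment_compact.
  by apply: continuous_subspaceT => ?; apply: cst_continuous.
have mI : measurable (`[0, 1]%classic : set (measurableTypeR R)).
  exact: measurable_itv.
have G0 : forall t : R, 0 <= cst C t by [].
apply: DeriveDef.
  exact: (derivable_under_integral mI a0 intf derf G0 intC dfub).
have := differentiation_under_integral mI a0 intf derf G0 intC dfub.
rewrite derive1E => ->; apply: eq_Rintegral => t; rewrite inE /= => t01.
have := dfE 0 t a0 t01; rewrite partial1of2E => D.
by rewrite derive_val scale0r add0r.
Qed.

(** The radial means of a smooth function are smooth: the partial derivatives
    are radial means again, and their local boundedness gives continuity. *)
Lemma smooth_radial_mean p H : smooth_on B H -> smooth_on B (radial_mean p H).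
Proof.
move=> sH k; elim: k p H sH => [|k IH] p H sH.
  split=> // y By.
  have cH z : B z -> {for z, continuous H}.
    by move=> Bz; apply: Ck_on_continuous (sH 0%N) Bz.
  have dH i z : B z -> derivable H z (delta_mx 0 i).
    by move=> Bz; have [] := Ck_on_is_derive i (sH 1%N) Bz.
  have cdH i z : B z -> {for z, continuous (fun z => 'D_(delta_mx 0 i) H z)}.
    by move=> Bz; apply: Ck_on_continuous (Ck_on_derive i (sH 1%N)) Bz.
  have dI i z : B z -> is_derive z (delta_mx 0 i) (radial_mean p H)
      (radial_mean p.+1 (fun z => 'D_(delta_mx 0 i) H z) z).
    by move=> Bz; apply: is_derive_radial_mean => //; [exact: dH|exact: cdH].
  have /inB By' := By.
  (* half the distance from [y] to the boundary of the ball *)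
  pose d := (rho - `|y - y0|) / 2.
  have d0 : 0 < d by rewrite divr_gt0 // subr_gt0.
  have r1 : `|y - y0| + d < rho by rewrite /d; lra.
  have near_r z : ball y d z -> `|z - y0| <= `|y - y0| + d.
    rewrite -ball_normE /ball_ /= distrC => zd.
    rewrite -[z](subrK y) -addrA addrC; apply: le_trans (ler_normD _ _) _.
    by rewrite lerD2l ltW.
  have [C CP] := choice (fun i => let: ex_intro2 C C0 HC := bound_closed r1 (cdH i) in
     ex_intro (fun C => 0 <= C /\ forall z, `|z - y0| <= `|y - y0| + d ->
       `|'D_(delta_mx 0 i) H z| <= C) C (conj C0 HC)).
  pose S := \sum_i C i.
  have CS i : C i <= S.
    by rewrite /S (bigD1 i) //= lerDl sumr_ge0 // => j _; have [] := CP j.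
  have bnd z i : ball y d z -> derivable (radial_mean p H) z (delta_mx 0 i) /\
     `|'D_(delta_mx 0 i) (radial_mean p H) z - 0| <= S.
    move=> /near_r zr.
    have Bz : B z by apply/inB; apply: le_lt_trans r1.
    have D := dI i z Bz; split; first by case: D.
    rewrite subr0 derive_val; apply: le_trans (CS i).
    by apply: radial_bound zr => //; [exact: cdH|have [] := CP i].
  have MV := mean_value_bound bnd (ballxx y d0).
  have S0 : 0 <= S by apply: sumr_ge0 => i _; have [] := CP i.
  pose L := m%:R * S + 1.
  have L0 : 0 < L by rewrite ltr_wpDl // mulr_ge0.
  move=> A /(nbhs_ballP _ _).1 [e /= e0 BA]; apply/nbhs_ballP.
  exists (Num.min d (e / L)); first by rewrite /= lt_min d0 divr_gt0.
  move=> z; rewrite -ball_normE /ball_ /= lt_min => /andP[zd ze]; apply: BA.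
  have Bz : ball y d z by rewrite -ball_normE.
  have := MV z Bz; rewrite big1 ?subr0 => [|i _]; last by rewrite mul0r.
  rewrite distrC [`|z - y|]distrC => h.
  rewrite -ball_normE /ball_ /=; apply: le_lt_trans h _.
  apply: (@le_lt_trans _ _ (L * `|y - z|)); first by rewrite ler_wpM2r // /L lerDl.
  by rewrite mulrC -ltr_pdivlMr.
have cH z : B z -> {for z, continuous H}.
  by move=> Bz; apply: Ck_on_continuous (sH 0%N) Bz.
have sdH i : smooth_on B (fun z => 'D_(delta_mx 0 i) H z).
  by move=> k'; apply: Ck_on_derive (sH k'.+1).
apply: (@Ck_onS _ _ _ _ _ (fun i => radial_mean p.+1 (fun z => 'D_(delta_mx 0 i) H z))) => //.
- by move=> y By; apply: Ck_on_continuous (IH p H sH) By.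
- move=> i y By; apply: is_derive_radial_mean => //.
    by move=> z Bz; have [] := Ck_on_is_derive i (sH 1%N) Bz.
  by move=> z Bz; apply: Ck_on_continuous (sdH i 0%N) Bz.
- by move=> i; apply: IH.
Qed.

Let within01 (g : R -> R) : (forall t, 0 <= t <= 1 -> {for t, continuous g}) ->
  {within `[0, 1], continuous g}.
Proof.
move=> cg; apply: continuous_in_subspaceT => t; rewrite inE /= in_itv /=.
exact: cg.
Qed.

Let lincomb_continuous (r : seq 'I_m) (c : 'I_m -> R) (f : 'I_m -> R -> R) t :
  (forall l, {for t, continuous (f l)}) ->
  {for t, continuous (fun t => \sum_(l <- r) c l * f l t)}.
Proof.
move=> cf; rewrite /prop_for /continuous_at.
apply: cvg_big => [|l _]; first exact: add_continuous.
by apply: (@continuousM _ _ (cst (c l)) (f l)); [exact: cst_continuous|exact: cf].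
Qed.

Let Rintegral_lincomb (r : seq 'I_m) (c : 'I_m -> R) (f : 'I_m -> R -> R) :
  (forall l t, 0 <= t <= 1 -> {for t, continuous (f l)}) ->
  (\int[mu]_(t in `[0%R, 1%R]) \sum_(l <- r) c l * f l t)%R =
  \sum_(l <- r) c l * (\int[mu]_(t in `[0%R, 1%R]) f l t)%R.
Proof.
move=> cf.
have intc (g : R -> R) : (forall t, 0 <= t <= 1 -> {for t, continuous g}) ->
    mu.-integrable `[0, 1]%classic (EFin \o g).
  move=> cg; apply: continuous_compact_integrable; first exact: segment_compact.
  exact: within01.
have mI : measurable (`[0, 1]%classic : set (measurableTypeR R)).
  exact: measurable_itv.
have cc l t : 0 <= t <= 1 -> {for t, continuous (fun t => c l * f l t)}.
  by move=> t01; apply: (@continuousM _ _ (cst (c l)) (f l)); [exact: cst_continuous|exact: cf].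
elim: r => [|l r IH].
  by under eq_Rintegral do rewrite big_nil; rewrite Rintegral_cst // mul0r big_nil.
under eq_Rintegral do rewrite big_cons.
have cs t : 0 <= t <= 1 -> {for t, continuous (fun t => \sum_(l <- r) c l * f l t)}.
  by move=> t01; apply: lincomb_continuous => i; apply: cf.
rewrite (RintegralD mI (intc _ (cc l)) (intc _ cs)).
rewrite big_cons IH; congr (_ + _).
by rewrite (RintegralZl _ mI (intc _ (cf l))).
Qed.

(** The fundamental theorem of calculus along the segment from [y0] to [y]. *)
Lemma Hadamard (F : 'rV[R]_m -> R) y : smooth_on B F -> B y ->
  F y = F y0 + \sum_l (y 0 l - y0 0 l) *
                radial_mean 0 (fun z => 'D_(delta_mx 0 l) F z) y.
Proof.
move=> sF By.
pose g t := F (y0 + t *: (y - y0)).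
pose dg t := \sum_l (y 0 l - y0 0 l) * 'D_(delta_mx 0 l) F (y0 + t *: (y - y0)).
have cdF i z : B z -> {for z, continuous (fun z => 'D_(delta_mx 0 i) F z)}.
  by move=> Bz; apply: Ck_on_continuous (Ck_on_derive i (sF 1%N)) Bz.
have gE t : 0 <= t <= 1 -> is_derive t 1 g (dg t).
  move=> t01.
  pose c h : 'rV[R]_m := y0 + (h + t) *: (y - y0).
  have c0 : c 0 = y0 + t *: (y - y0) by rewrite /c add0r.
  have Bc : B (c 0) by rewrite c0; apply: segB.
  have dc l : is_derive (0 : R) 1 (fun h => c h 0 l) (y 0 l - y0 0 l).
    have := @is_deriveD _ _ _ (cst (y0 0 l + t * (y 0 l - y0 0 l)))
       ((y 0 l - y0 0 l) *: @id R) 0 1 _ _ (is_derive_cst _ _ _)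
       (is_deriveZ _ (is_derive_id _ _)).
    rewrite add0r [_ *: 1]mulr1; congr is_derive; apply/funext => h.
    rewrite /c !mxE.
    rewrite -[LHS]/((y0 0 l + t * (y 0 l - y0 0 l)) + (y 0 l - y0 0 l) * h); ring.
  have D := @is_derive_curve _ _ F c (fun l => y 0 l - y0 0 l) B oB Bc
    (fun z i Bz => let: DeriveDef d _ := Ck_on_is_derive i (sF 1%N) Bz in d)
    (fun i => cdF i _ Bc) dc.
  have a0 : is_derive t 1 (fun s : R => s - t) 1.
    have := is_deriveB (is_derive_id t 1) (is_derive_cst t t 1).
    by rewrite subr0.
  have E0 : (fun s : R => s - t) t = 0 by rewrite subrr.
  have D' : is_derive ((fun s : R => s - t) t) 1 (F \o c)
      (\sum_l 'D_(delta_mx 0 l) F (c 0) * (y 0 l - y0 0 l)) by rewrite E0.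
  have := @is_derive1_comp _ _ (fun s : R => s - t) _ _ _ D' a0; rewrite mulr1.
  have -> : (F \o c) \o (fun s => s - t) = g.
    by apply/funext => s; rewrite /= /c subrK.
  move=> D2; apply: is_derive_eq D2 _; rewrite c0; apply: eq_bigr => l _; exact: mulrC.
have cfl l t : 0 <= t <= 1 ->
    {for t, continuous (fun t => 'D_(delta_mx 0 l) F (y0 + t *: (y - y0)))}.
  move=> t01.
  apply: (@continuous_comp _ _ _ (fun s : R => y0 + s *: (y - y0)) (fun z => 'D_(delta_mx 0 l) F z)).
    apply: (@continuousD _ _ _ (cst y0) (fun s : R => s *: (y - y0))).
      exact: cst_continuous.
    exact: scalel_continuous.
  by apply: cdF; apply: segB.
have cg t : 0 <= t <= 1 -> {for t, continuous g}.
  by move=> /gE[D _]; apply/differentiable_continuous/derivable1_diffP.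
have LR : derivable_oo_LRcontinuous g 0 1.
  split.
  - move=> t; rewrite in_itv /= => /andP[t0 t1].
    by have [] := gE t _; rewrite ?ltW.
  - by apply: cvg_at_right_filter; apply: cg; rewrite lexx ler01.
  - by apply: cvg_at_left_filter; apply: cg; rewrite lexx ler01.
have cdg : {within `[0, 1], continuous dg}.
  by apply: within01 => t t01; apply: lincomb_continuous => l; apply: cfl.
have g'E : {in `]0, 1[, derive1 g =1 dg}.
  move=> t; rewrite in_itv /= => /andP[t0 t1]; rewrite derive1E.
  by have D := gE t _; rewrite (@derive_val _ _ _ _ _ _ _ (D _)) // !ltW.
have := continuous_FTC2 ltr01 cdg LR g'E.
rewrite -EFinB => /(congr1 fine) /= FTC.
apply/eqP; rewrite addrC -subr_eq; apply/eqP.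
transitivity (g 1 - g 0).
  by rewrite /g scale1r scale0r addr0 [y0 + (y - y0)]addrC subrK.
rewrite -FTC -/(Rintegral _ _ _) Rintegral_lincomb //.
apply: eq_bigr => l _; congr (_ * _); apply: eq_Rintegral => t _.
by rewrite expr0 mul1r.
Qed.

Lemma radial_mean_center H : radial_mean 0 H y0 = H y0.
Proof.
rewrite /radial_mean.
under eq_Rintegral do rewrite subrr scaler0 addr0 expr0 mul1r.
have mI : measurable (`[0, 1]%classic : set (measurableTypeR R)).
  exact: measurable_itv.
by rewrite Rintegral_cst //= [X in fine X]mu01 mulr1.
Qed.

End Hadamard.

(** * Bump functions on R^m *)

Section Bump.
Context {R : realType}.
Implicit Types (t s h : R).

(** The functions [t ^- n * exp (- 1 / t)], cut off at [0]: a family stable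
    under differentiation that contains the classical flat function. *)
Definition flat (n : nat) t : R := if 0 < t then t^-1 ^+ n * expR (- t^-1) else 0.

Definition dflat (n : nat) t : R := (- n%:R) * flat n.+1 t + flat n.+2 t.

Lemma flat_ge0 n t : 0 <= flat n t.
Proof.
rewrite /flat; case: ifP => // t0.
by rewrite mulr_ge0 ?expR_ge0 // exprn_ge0 // invr_ge0 ltW.
Qed.

(** The exponential beats every power; for [n.+1] in place of [n] this is what
    makes [flat n] differentiable at [0]. *)
Lemma flat_le n t : 0 < t -> flat n t <= n.+1`!%:R * t.
Proof.
move=> t0; rewrite /flat t0.
have i0 : 0 < t^-1 by rewrite invr_gt0.
have := expR_ge1Dxn n (ltW i0) => h.
have h' : t^-1 ^+ n.+1 / n.+1`!%:R <= expR t^-1.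
  by apply: le_trans h; rewrite lerDr.
have f0 : 0 < n.+1`!%:R :> R by rewrite ltr0n fact_gt0.
rewrite expRN ler_pdivrMr ?expR_gt0 //.
move: h'; rewrite ler_pdivrMr // => h'.
have -> : t^-1 ^+ n = t * t^-1 ^+ n.+1 by rewrite exprS mulVKf // lt0r_neq0.
rewrite -mulrA [X in _ <= X]mulrCA; apply: ler_wpM2l; first exact: ltW.
by rewrite mulrC.
Qed.

Lemma is_derive_flat n t : is_derive t 1 (flat n) (dflat n t).
Proof.
have [t0|t0|->] := ltgtP t 0.
- have -> : dflat n t = 0 by rewrite /dflat /flat ltNge (ltW t0) /= mulr0 addr0.
  apply: near_eq_is_derive (is_derive_cst 0 t 1).
  apply: filterS (lt_nbhsl t0) => s s0.
  by rewrite /flat ltNge (ltW s0).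
- have tn0 := lt0r_neq0 t0.
  have dV : is_derive t 1 (fun s : R => s^-1) (- (t^-1 ^+ 2)).
    have := @is_deriveV R id t 1 1 tn0 (is_derive_id _ _).
    by move=> h; apply: is_derive_eq h _; rewrite -[LHS]/(_ * _) mulr1 exprVn.
  have dE : is_derive t 1 (fun s => expR (- s^-1)) (expR (- t^-1) * t^-1 ^+ 2).
    have h := is_derive1_comp (is_derive_expR _) (is_deriveN dV).
    by apply: is_derive_eq h _; rewrite opprK.
  have dP : is_derive t 1 (fun s : R => s^-1 ^+ n) (- n%:R * t^-1 ^+ n.+1).
    have dX : is_derive t^-1 1 (fun x : R => x ^+ n) (n%:R * t^-1 ^+ n.-1).
      apply: DeriveDef; first exact: exprn_derivable.
      by rewrite exp_derive [_%:A]mulr1.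
    have h := is_derive1_comp dX dV; apply: is_derive_eq h _.
    by case: (n) => [|k] /=; rewrite ?mul0r ?oppr0 ?mul0r // !exprS; ring.
  have h := is_deriveM dP dE.
  apply: near_eq_is_derive; last first.
    apply: is_derive_eq h _; rewrite /dflat /flat t0 -![_ *: _]/(_ * _) !exprS; ring.
  have t0' : - t < 0 by rewrite oppr_lt0.
  apply: filterS (Nlt_nbhsl t0') => s; rewrite oppr_lt0 => s0.
  by rewrite /flat s0.
- have -> : dflat n 0 = 0 by rewrite /dflat /flat ltxx mulr0 addr0.
  apply/is_derive0P; apply/cvgrPdist_le => e e0.
  pose C : R := n.+2`!%:R.
  have C0 : 0 < C by rewrite ltr0n fact_gt0.
  near=> h; rewrite sub0r normrN /flat ltxx subr0.
  case: ifP => h0; last by rewrite mulr0 normr0 ltW.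
  have -> : h^-1 * (h^-1 ^+ n * expR (- h^-1)) = flat n.+1 h.
    by rewrite /flat h0 exprS mulrA.
  rewrite ger0_norm ?flat_ge0 //; apply: le_trans (flat_le _ h0) _.
  have hC : `|h| <= e / C.
    by near: h; apply: dnbhs0_le; rewrite divr_gt0.
  by rewrite mulrC -ler_pdivlMr // -(ger0_norm (ltW h0)).
Unshelve. all: by end_near.
Qed.

(** A smooth transition from [1] below [1/2] to [0] above [1]. *)
Definition plateau t : R := flat 0 (1 - t) / (flat 0 (1 - t) + flat 0 (t - 2^-1)).

Lemma flat_gt0 t : 0 < t -> 0 < flat 0 t.
Proof. by move=> t0; rewrite /flat t0 mul1r expR_gt0. Qed.

Lemma flat_eq0 t : t <= 0 -> flat 0 t = 0.
Proof. by rewrite leNgt /flat => /negPf ->. Qed.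

Lemma plateau_den t : flat 0 (1 - t) + flat 0 (t - 2^-1) != 0.
Proof.
apply: lt0r_neq0; have [t1|t1] := ltP t 1.
  by rewrite ltr_pwDl ?flat_ge0 // flat_gt0 // subr_gt0.
by rewrite ltr_wpDl ?flat_ge0 // flat_gt0 // subr_gt0; lra.
Qed.

Lemma plateau1 t : t <= 2^-1 -> plateau t = 1.
Proof.
move=> t1; have := plateau_den t; rewrite /plateau [flat 0 (t - _)]flat_eq0 ?subr_le0 //.
by rewrite addr0 => h; rewrite divff.
Qed.

Lemma plateau0 t : 1 <= t -> plateau t = 0.
Proof. by move=> t1; rewrite /plateau flat_eq0 ?mul0r // subr_le0. Qed.

Lemma Ck_on_flat m k (U : set 'rV[R]_m) f : open U -> Ck_on k U f ->
  Ck_on k U (fun y => flat 0 (f y)).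
Proof.
move=> oU cf; apply: (@Ck_on_comp1 _ _ nat setT flat dflat) => //.
  by move=> n t _; apply: is_derive_flat.
move=> k' U' f' n oU' cf'; apply: Ck_onD; [by []| |exact: cf'].
by apply: Ck_onM; [by []|exact: Ck_on_cst|exact: cf'].
Qed.

Lemma bump_rV m (y0 : 'rV[R]_m) r : 0 < r ->
  exists rho : 'rV[R]_m -> R, [/\ smooth_on setT rho,
    \forall y \near y0, rho y = 1 & forall y, rho y != 0 -> `|y - y0| <= r].
Proof.
move=> r0; pose q (y : 'rV[R]_m) := \sum_l ((y 0 l - y0 0 l) / r) * ((y 0 l - y0 0 l) / r).
have oT : open (setT : set 'rV[R]_m) by exact: openT.
have cq k : Ck_on k setT q.
  have cl l : Ck_on k setT (fun y : 'rV[R]_m => (y 0 l - y0 0 l) / r).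
    apply: Ck_onM; [by []| |exact: Ck_on_cst].
    by apply: Ck_onD; [by []|exact: Ck_on_coord|exact: Ck_on_cst].
  by apply: Ck_on_sum => // l; apply: Ck_onM.
exists (fun y => plateau (q y)); split.
- move=> k.
  have c1 : Ck_on k setT (fun y => flat 0 (1 - q y)).
    apply: Ck_on_flat => //; apply: Ck_onD; [by []|exact: Ck_on_cst|].
    apply: (@Ck_on_ext _ _ _ _ (fun y => -1 * q y)) => //; first by move=> y _; rewrite mulN1r.
    by apply: Ck_onM; [by []|exact: Ck_on_cst|exact: cq].
  have c2 : Ck_on k setT (fun y => flat 0 (q y - 2^-1)).
    by apply: Ck_on_flat => //; apply: Ck_onD; [by []|exact: cq|exact: Ck_on_cst].
  apply: Ck_onM => //; apply: Ck_onV => //; last exact: Ck_onD.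
  by move=> y _; apply: plateau_den.
- have q0 : q y0 = 0 by rewrite /q big1 // => l _; rewrite subrr !mul0r.
  have : \forall y \near y0, q y < 2^-1.
    have cc : {for y0, continuous q} by apply: Ck_on_continuous (cq 0%N) _.
    have lt2 : \forall z \near q y0, z < 2^-1.
      by apply: lt_nbhsl; rewrite q0 invr_gt0 ltr0n.
    exact: (cc _ lt2).
  by apply: filterS => y /ltW; apply: plateau1.
- move=> y; have [q1|q1 _] := leP 1 (q y); first by rewrite plateau0 ?eqxx.
  rewrite [X in X <= _]/Num.norm /= mx_normrE; apply: bigmax_le => [|[i l] _ /=]; first exact: ltW.
  rewrite !mxE [i]ord1.
  have : ((y 0 l - y0 0 l) / r) ^+ 2 < 1.
    apply: le_lt_trans q1; rewrite /q (bigD1 l) //= expr2 lerDl.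
    by apply: sumr_ge0 => j _; rewrite -expr2 sqr_ge0.
  rewrite -[X in X < 1]ger0_norm ?sqr_ge0 // normrX expr_lt1 //.
  by rewrite normrM normfV (ger0_norm (ltW r0)) ltr_pdivrMr // mul1r => /ltW.
Qed.

End Bump.

(** * Smooth functions on a manifold *)

Section SmoothFunctions.
Context {R : realType} {m : nat} {M : manifold R m}.
Implicit Types (U V W : set M) (f g : M -> R) (x : M).

Lemma smooth_in_local U f :
  (forall x, U x -> exists2 V, V x & smooth_in V f) -> smooth_in U f.
Proof.
move=> loc i k; apply: Ck_on_local => _ [x [dx Ux] <-].
have [V Vx sV] := loc x Ux.
exists (chart M i @` (chart_dom M i `&` V)); last exact: sV.
by exists x.
Qed.

Lemma smooth_glue f :
  (forall x, exists V g, [/\ open V, V x, smooth_in V g & forall z, V z -> f z = g z]) ->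
  smooth f.
Proof.
move=> loc; apply: smooth_in_local => x _.
have [V [g [oV Vx sg fg]]] := loc x; exists V => //.
by apply: smooth_in_ext sg => // z Vz; rewrite fg.
Qed.

Lemma smooth_in_of_smooth U f : smooth f -> smooth_in U f.
Proof. by apply: smooth_in_sub. Qed.

Lemma smooth_inD U f g : open U -> smooth_in U f -> smooth_in U g ->
  smooth_in U (fun x => f x + g x).
Proof.
move=> oU sf sg i k.
by apply: Ck_onD; [exact: chart_image_open_in|exact: sf|exact: sg].
Qed.

Lemma smooth_inM U f g : open U -> smooth_in U f -> smooth_in U g ->
  smooth_in U (fun x => f x * g x).
Proof.
move=> oU sf sg i k.
by apply: Ck_onM; [exact: chart_image_open_in|exact: sf|exact: sg].
Qed.

Lemma smooth_in_sum U (I : Type) (r : seq I) (P : pred I) (F : I -> M -> R) :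
  open U -> (forall i, smooth_in U (F i)) ->
  smooth_in U (fun x => \sum_(i <- r | P i) F i x).
Proof.
move=> oU sF j k; apply: (@Ck_on_sum _ _ _ _ _ _ _ (fun i => F i \o chart_inv M j)).
  exact: chart_image_open_in.
by move=> i; apply: sF.
Qed.

Lemma smooth_in_prod U (I : Type) (r : seq I) (P : pred I) (F : I -> M -> R) :
  open U -> (forall i, smooth_in U (F i)) ->
  smooth_in U (fun x => \prod_(i <- r | P i) F i x).
Proof.
move=> oU sF; elim: r => [|i r IH].
  apply: (smooth_in_ext oU _ (smooth_in_cst U 1)) => x _.
  by rewrite big_nil.
apply: (@smooth_in_ext _ _ _ _ (fun x => (if P i then F i x else 1) * \prod_(i <- r | P i) F i x)) => //.
  by move=> x _; rewrite big_cons; case: (P i); rewrite ?mul1r.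
by apply: smooth_inM => //; case: (P i) => //; exact: smooth_in_cst.
Qed.

Lemma smooth_in_det n U (A : M -> 'M[R]_n) : open U ->
  (forall i j, smooth_in U (fun x => A x i j)) -> smooth_in U (fun x => \det (A x)).
Proof.
move=> oU sA; apply: smooth_in_sum => // s; apply: smooth_inM => //.
  exact: smooth_in_cst.
by apply: smooth_in_prod => // i; apply: sA.
Qed.

Lemma smooth_in_mulmx n p q U (A : M -> 'M[R]_(n, p)) (B : M -> 'M[R]_(p, q)) : open U ->
  (forall i j, smooth_in U (fun x => A x i j)) ->
  (forall i j, smooth_in U (fun x => B x i j)) ->
  forall i j, smooth_in U (fun x => (A x *m B x) i j).
Proof.
move=> oU sA sB i j.
apply: (@smooth_in_ext _ _ _ _ (fun x => \sum_k A x i k * B x k j)) => //.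
  by move=> x _; rewrite mxE.
by apply: smooth_in_sum => // k; apply: smooth_inM.
Qed.

Lemma smooth_inX U f n : open U -> smooth_in U f -> smooth_in U (fun x => f x ^+ n).
Proof.
move=> oU sf; elim: n => [|n IH].
  by apply: (smooth_in_ext oU _ (smooth_in_cst U 1)).
apply: (smooth_in_ext oU _ (smooth_inM oU sf IH)) => x _.
by rewrite exprS.
Qed.

Lemma smooth_inV U f : open U -> (forall x, U x -> f x != 0) -> smooth_in U f ->
  smooth_in U (fun x => (f x)^-1).
Proof.
move=> oU f0 sf i k.
apply: Ck_onV; [exact: chart_image_open_in| |exact: sf].
by move=> _ [x [dx Ux] <-] /=; rewrite chartK // f0.
Qed.

Lemma smooth_in_ln U f : open U -> (forall x, U x -> 0 < f x) -> smooth_in U f ->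
  smooth_in U (fun x => ln (f x)).
Proof.
move=> oU f0 sf i k.
apply: Ck_on_ln; [exact: chart_image_open_in| |exact: sf].
by move=> _ [x [dx Ux] <-] /=; rewrite chartK // f0.
Qed.

Lemma smooth_in_expR U f : open U -> smooth_in U f -> smooth_in U (fun x => expR (f x)).
Proof.
by move=> oU sf i k; apply: Ck_on_expR; [exact: chart_image_open_in|exact: sf].
Qed.

Lemma smooth_cst (c : R) : smooth (fun _ : M => c).
Proof. exact: smooth_in_cst. Qed.

Lemma smoothD f g : smooth f -> smooth g -> smooth (fun x => f x + g x).
Proof. exact: smooth_inD openT. Qed.

Lemma smoothM f g : smooth f -> smooth g -> smooth (fun x => f x * g x).
Proof. exact: smooth_inM openT. Qed.

Lemma smooth_sum (I : Type) (r : seq I) (P : pred I) (F : I -> M -> R) :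
  (forall i, smooth (F i)) -> smooth (fun x => \sum_(i <- r | P i) F i x).
Proof. by move=> sF; apply: smooth_in_sum openT sF. Qed.

Lemma smoothN f : smooth f -> smooth (fun x => - f x).
Proof.
move=> sf; have := smoothM (smooth_cst (-1)) sf.
by apply: smooth_in_ext openT _ => x _; rewrite mulN1r.
Qed.

Lemma smoothB f g : smooth f -> smooth g -> smooth (fun x => f x - g x).
Proof. by move=> sf sg; apply: smoothD => //; apply: smoothN. Qed.

Lemma chart_preimage_open i (V : set 'rV[R]_m) : open V ->
  open (chart_dom M i `&` (chart M i @^-1` V)).
Proof.
move=> oV; rewrite openE => x [dx Vx].
have n1 : nbhs x (chart_dom M i) := open_nbhs_nbhs (conj (chart_dom_open i) dx).
have n2 : nbhs (chart M i x) V := open_nbhs_nbhs (conj oV Vx).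
exact: filterI n1 (chart_continuous dx n2).
Qed.

Lemma smooth_in_chart i (V : set 'rV[R]_m) (F : 'rV[R]_m -> R) :
  open V -> smooth_on V F ->
  smooth_in (chart_dom M i `&` (chart M i @^-1` V)) (F \o chart M i).
Proof.
move=> oV sF j k.
apply: (@Ck_on_comp _ _ _ _ _ V F (chart M i \o chart_inv M j)) => //.
- exact/chart_image_open_in/chart_preimage_open.
- by move=> _ [x [dx [dix Vx]] <-] /=; rewrite chartK.
- move=> l; apply: Ck_on_sub (chart_transition j i l k).
  by apply: image_subset => x [dx [dix Vx]].
Qed.

Lemma smooth_in_continuous U f x : open U -> U x -> smooth_in U f -> {for x, continuous f}.
Proof.
move=> oU Ux sf; have [i dx] := chart_dom_cover x.
have cfi : {for chart M i x, continuous (f \o chart_inv M i)}.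
  by apply: Ck_on_continuous (sf i 0%N) _; exists x.
have c2 : {for x, continuous ((f \o chart_inv M i) \o chart M i)}.
  by apply: continuous_comp => //; exact: chart_continuous.
move=> A /= nA; have : nbhs (((f \o chart_inv M i) \o chart M i) x) A.
  by rewrite /= chartK.
move=> /c2 n1.
have n2 : nbhs x (chart_dom M i).
  exact: (open_nbhs_nbhs (conj (chart_dom_open i) dx)).
apply: (@filterS _ (nbhs x) (nbhs_filter x) _ _ _ (@filterI _ _ (nbhs_filter x) _ _ n1 n2)).
by move=> z [/= + dz]; rewrite chartK.
Qed.

(** The closed set [C] replaces the support of [rho]: a product with [rho] is
    smooth on [U] and zero on the complement of [C], two open sets that cover
    the manifold. *)
Definition cutoff U V (rho : M -> R) : Prop :=
  [/\ smooth rho, exists C, [/\ closed C, C `<=` U & forall z, ~ C z -> rho z = 0] &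
      forall z, V z -> rho z = 1].

(** Multiplying by a cutoff function turns a function that is smooth near the
    support, with arbitrary values elsewhere, into a globally smooth one. *)
Lemma cutoff_smooth U V rho g : open U -> cutoff U V rho -> smooth_in U g ->
  smooth (fun x => rho x * g x).
Proof.
move=> oU [srho [C [cC CU rho0]] _] sg; apply: smooth_glue => x.
have [Cx|nCx] := pselect (C x).
  exists U, (fun x => rho x * g x); split=> //; first exact: CU.
  by apply: smooth_inM => //; apply: smooth_in_of_smooth.
exists (~` C), (fun=> 0); split=> //; first exact: closed_openC.
  exact: smooth_in_cst.
by move=> z /rho0 ->; rewrite mul0r.
Qed.

Lemma cutoff_eq0 U V rho z : cutoff U V rho -> ~ U z -> rho z = 0.
Proof. by move=> [_ [C [_ CU rho0]] _] nUz; apply: rho0 => /CU. Qed.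

(** The bump function of a chart is supported in the image of a compact ball,
    which is closed because the manifold is Hausdorff. *)
Lemma exists_cutoff U x : open U -> U x ->
  exists V rho, [/\ open V, V x, V `<=` U & cutoff U V rho].
Proof.
move=> oU Ux; have [i dx] := chart_dom_cover x.
pose W := chart M i @` (chart_dom M i `&` U).
have oW : open W by exact: chart_image_open_in.
have Wy : W (chart M i x) by exists x.
have [e /= e0 BW] := (nbhs_ballP _ _).1 (open_nbhs_nbhs (conj oW Wy)).
pose r := e / 2; have r0 : 0 < r by rewrite divr_gt0.
have [rho0 [srho0 rho1 rhoK]] := bump_rV (chart M i x) r0.
pose K := [set y : 'rV[R]_m | `|y - chart M i x| <= r].
have KW : K `<=` W.
  move=> y Ky; apply: BW; rewrite -ball_normE /ball_ /= distrC.
  by apply: le_lt_trans Ky _; rewrite /r ltr_pdivrMr // ltr_pMr // ltr1n.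
have cK : compact K by exact: norm_ball_compact.
pose C := chart_inv M i @` K.
have WD y : W y -> (chart M i @` chart_dom M i) y by move=> [z [dz _] <-]; exists z.
have cC : closed C.
  apply: compact_closed; first exact: manifold_hausdorff.
  apply: continuous_compact => //; apply: continuous_in_subspaceT => y.
  rewrite inE => /KW/WD; exact: chart_inv_continuous.
have CdU : C `<=` chart_dom M i `&` U.
  by move=> _ [y /KW[z [dz Uz] <-] <-]; rewrite chartK.
pose rho z := if `[< chart_dom M i z >] then rho0 (chart M i z) else 0.
have rhoC z : ~ C z -> rho z = 0.
  rewrite /rho; case: asboolP => // dz nCz; apply/eqP; apply: contra_notT nCz => h.
  by exists (chart M i z); [exact: rhoK|rewrite chartK].
have [V' V'1 V'2] : exists2 V', open_nbhs (chart M i x) V' & forall y, V' y -> rho0 y = 1.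
  exists (interior [set y | rho0 y = 1]); last exact: interior_subset.
  by split; [exact: open_interior|exact: rho1].
exists ((chart_dom M i `&` (chart M i @^-1` V')) `&` U), rho; split.
- by apply: openI => //; apply: chart_preimage_open; case: V'1.
- by split=> //; split=> //; case: V'1.
- by move=> z [].
split.
- apply: smooth_glue => z; have [dz|ndz] := pselect (chart_dom M i z).
    exists (chart_dom M i `&` (chart M i @^-1` setT)), (rho0 \o chart M i); split=> //.
    + exact/chart_preimage_open/openT.
    + by apply: smooth_in_chart => //; exact: openT.
    + by move=> z' [dz' _]; rewrite /rho asboolT.
  exists (~` C), (fun=> 0); split=> //; first exact: closed_openC.
    by move=> /CdU[].
  exact: smooth_in_cst.
- by exists C; split=> //; move=> z /CdU[].
- by move=> z [[dz V'z] _]; rewrite /rho asboolT // V'2.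
Qed.

End SmoothFunctions.

(** * Tangent vectors in coordinates *)

Section TangentVectors.
Context {R : realType} {m : nat} {M : manifold R m}.
Implicit Types (U V W : set M) (f g : M -> R) (x : M) (D : tvec M).

Lemma tvecM x D f g : is_tvec x D -> smooth f -> smooth g ->
  D (fun z => f z * g z) = D f * g x + f x * D g.
Proof. by move=> [_ +]; apply. Qed.

Lemma tvecD x D f g : is_tvec x D -> smooth f -> smooth g ->
  D (fun z => f z + g z) = D f + D g.
Proof.
move=> [lin _] sf sg; have := lin 1 f g sf sg; rewrite mul1r => <-.
by congr D; apply/funext => z; rewrite mul1r.
Qed.

Lemma tvec0 x D : is_tvec x D -> D (fun=> 0) = 0.
Proof.
move=> tD; have := tvecD tD (@smooth_cst _ _ M 0) (@smooth_cst _ _ M 0).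
have -> : (fun z : M => 0 + 0 : R) = (fun=> 0) by apply/funext => z; rewrite addr0.
by move/eqP; rewrite -subr_eq subrr eq_sym => /eqP.
Qed.

Lemma tvecZ x D c f : is_tvec x D -> smooth f -> D (fun z => c * f z) = c * D f.
Proof.
move=> tD sf; have [lin _] := tD; have := lin c f _ sf (smooth_cst 0).
rewrite (tvec0 tD) addr0 => <-.
by congr D; apply/funext => z; rewrite addr0.
Qed.

Lemma tvec_cst x D c : is_tvec x D -> D (fun=> c) = 0.
Proof.
move=> tD; have s1 := @smooth_cst _ _ M 1.
have D1 : D (fun=> 1) = 0.
  have := tvecM tD s1 s1; rewrite !mulr1 mul1r.
  by move/eqP; rewrite -subr_eq subrr eq_sym => /eqP.
have := tvecZ c tD s1; rewrite D1 mulr0 => <-.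
by congr D; apply/funext => z; rewrite mulr1.
Qed.

Lemma tvecN x D f : is_tvec x D -> smooth f -> D (fun z => - f z) = - D f.
Proof.
move=> tD sf; have := tvecZ (-1) tD sf; rewrite mulN1r => <-.
by congr D; apply/funext => z; rewrite mulN1r.
Qed.

Lemma tvec_sum x D (I : Type) (r : seq I) (P : pred I) (F : I -> M -> R) :
  is_tvec x D -> (forall i, smooth (F i)) ->
  D (fun z => \sum_(i <- r | P i) F i z) = \sum_(i <- r | P i) D (F i).
Proof.
move=> tD sF; elim: r => [|i r IH].
  rewrite big_nil -[RHS](tvec0 tD); congr D; apply/funext => z; exact: big_nil.
rewrite big_cons; case: ifP => Pi; last first.
  by rewrite -IH; congr D; apply/funext => z; rewrite big_cons Pi.
rewrite -IH -(tvecD tD) //; last exact: smooth_sum.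
by congr D; apply/funext => z; rewrite big_cons Pi.
Qed.

Lemma tvec_prod x D (I : finType) (F : I -> M -> R) : is_tvec x D ->
  (forall i, smooth (F i)) -> D (fun z => \prod_i F i z) =
  \sum_i D (F i) * \prod_(j | j != i) F j x.
Proof.
move=> tD sF.
suff H (r : seq I) : uniq r -> D (fun z => \prod_(i <- r) F i z) =
    \sum_(i <- r) D (F i) * \prod_(j <- r | j != i) F j x.
  exact: H (index_enum_uniq I).
elim: r => [_|i r IH /= /andP[ir ur]].
  rewrite big_nil -[RHS](tvec_cst 1 tD); congr D; apply/funext => z; exact: big_nil.
have -> : (fun z => \prod_(j <- i :: r) F j z) = (fun z => F i z * \prod_(j <- r) F j z).
  by apply/funext => z; rewrite big_cons.
rewrite (tvecM tD) //; last by apply: smooth_in_prod => //; exact: openT.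
rewrite big_cons (IH ur) big_cons eqxx /=; congr (_ * _ + _).
  rewrite big_seq [RHS]big_seq_cond; apply: eq_bigl => j.
  by case jr: (j \in r) => //=; apply/esym; apply: contraNneq ir => <-.
rewrite mulr_sumr [LHS]big_seq [RHS]big_seq; apply: eq_bigr => j jr.
rewrite big_cons ifT; first by rewrite mulrCA.
by apply: contraNneq ir => ->.
Qed.

(** [f] and [g] have the same product with a cutoff function at [x]. *)
Lemma tvec_local x D f g U : is_tvec x D -> smooth f -> smooth g ->
  open U -> U x -> (forall z, U z -> f z = g z) -> D f = D g.
Proof.
move=> tD sf sg oU Ux fg.
have [V [rho [oV Vx VU cr]]] := exists_cutoff oU Ux.
have [srho _ rho1] := cr.
have := tvecM tD srho sf; have := tvecM tD srho sg.
have -> : (fun z => rho z * f z) = (fun z => rho z * g z).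
  apply/funext => z; have [Uz|nUz] := pselect (U z); first by rewrite fg.
  by rewrite (cutoff_eq0 cr nUz) !mul0r.
by move=> ->; rewrite rho1 // !mul1r (fg _ Ux) => /addrI.
Qed.

(** The coordinate vector field, multiplied by a function supported in the
    domain of the chart to be defined everywhere. *)
Definition coord_field i (rho : M -> R) (k : 'I_m) : vfield M :=
  fun z f => rho z * 'D_(delta_mx 0 k) (f \o chart_inv M i) (chart M i z).

Lemma smooth_chart_inv i f : smooth f ->
  smooth_on (chart M i @` chart_dom M i) (f \o chart_inv M i).
Proof. by move=> sf; have := sf i; rewrite setIT. Qed.

Lemma coord_field_smooth i rho k U V f : cutoff U V rho -> open U ->
  U `<=` chart_dom M i -> smooth f -> smooth (vf_app (coord_field i rho k) f).
Proof.
move=> cr oU Ud sf; apply: (cutoff_smooth oU cr (g := (fun y =>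
  'D_(delta_mx 0 k) (f \o chart_inv M i) y) \o chart M i)).
have sD : smooth_on (chart M i @` chart_dom M i)
    (fun y => 'D_(delta_mx 0 k) (f \o chart_inv M i) y).
  by move=> k'; apply: Ck_on_derive (smooth_chart_inv i sf k'.+1).
apply: smooth_in_sub (@smooth_in_chart _ _ M i _ _ (@chart_image_open _ _ M i) sD).
by move=> z /Ud dz; split=> //; exists z.
Qed.

Lemma coord_field_vfield i rho k U V : cutoff U V rho -> open U ->
  U `<=` chart_dom M i -> is_vfield (coord_field i rho k).
Proof.
move=> cr oU Ud; split; last first.
  by move=> f sf; exact: (coord_field_smooth k cr oU Ud sf).
move=> z; have [Uz|nUz] := pselect (U z); last first.
  rewrite /coord_field (cutoff_eq0 cr nUz).
  by split=> [c f g _ _|f g _ _]; rewrite /= !mul0r mulr0 addr0.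
have Wz : (chart M i @` chart_dom M i) (chart M i z) by exists z => //; apply: Ud.
have der f : smooth f -> is_derive (chart M i z) (delta_mx 0 k) (f \o chart_inv M i)
    ('D_(delta_mx 0 k) (f \o chart_inv M i) (chart M i z)).
  by move=> sf; apply: Ck_on_is_derive (smooth_chart_inv i sf 1%N) Wz.
split=> [c f g|f g] sf sg; rewrite /coord_field.
  have h := is_deriveD (is_deriveZ c (der f sf)) (der g sg).
  rewrite (_ : ((fun z => c * f z + g z) \o chart_inv M i) =
     c *: (f \o chart_inv M i) + (g \o chart_inv M i)) //.
  rewrite [X in rho z * X](@derive_val _ _ _ _ _ _ _ h) -[c *: _]/(c * _); ring.
have h := is_deriveM (der f sf) (der g sg).
rewrite (_ : ((fun z => f z * g z) \o chart_inv M i) =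
     (f \o chart_inv M i) * (g \o chart_inv M i)) //.
rewrite [X in rho z * X](@derive_val _ _ _ _ _ _ _ h) -![_ *: _]/(_ * _) /=.
rewrite chartK; [ring|exact: Ud].
Qed.

Lemma coord_field_coord i rho k h z (xi : M -> R) W : open W ->
  W `<=` chart_dom M i -> W z -> rho z = 1 ->
  (forall z, W z -> xi z = chart M i z 0 h) ->
  coord_field i rho k z xi = (h == k)%:R.
Proof.
move=> oW Wd Wz rz xiE; rewrite /coord_field rz mul1r.
have oI : open (chart M i @` (chart_dom M i `&` W)) by exact: chart_image_open_in.
have Iz : (chart M i @` (chart_dom M i `&` W)) (chart M i z).
  by exists z => //; split=> //; apply: Wd.
rewrite (@near_eq_derive _ _ _ _ (fun y : 'rV[R]_m => y 0 h)); last first.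
  apply: filterS (open_nbhs_nbhs (conj oI Iz)) => _ [z' [dz' Wz'] <-] /=.
  by rewrite chartK // xiE.
have := derive_mx (@derivable_id R 'rV[R]_m (chart M i z) (delta_mx 0 k)).
by rewrite derive_id => /matrixP/(_ 0 h); rewrite !mxE eqxx /= => <-.
Qed.

(** By Hadamard, near [x] a smooth function is its value at [x] plus a
    combination of the centred coordinates with smooth coefficients, on which
    the Leibniz rule determines [D]. *)
Lemma tvec_coordE x D i (xi : 'I_m -> M -> R) W f : is_tvec x D -> smooth f ->
  (forall h, smooth (xi h)) -> open W -> W x -> W `<=` chart_dom M i ->
  (forall z, W z -> forall h, xi h z = chart M i z 0 h) ->
  D f = \sum_h D (xi h) * 'D_(delta_mx 0 h) (f \o chart_inv M i) (chart M i x).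
Proof.
move=> tD sf sxi oW Wx Wd xiE.
set y0 := chart M i x; pose F := f \o chart_inv M i.
have oI : open (chart M i @` (chart_dom M i `&` W)) by exact: chart_image_open_in.
have Iy : (chart M i @` (chart_dom M i `&` W)) y0.
  by exists x => //; split=> //; apply: Wd.
have [e /= e0 BI] := (nbhs_ballP _ _).1 (open_nbhs_nbhs (conj oI Iy)).
have oB : open (ball y0 e) by exact: ball_open.
have sF : smooth_on (ball y0 e) F.
  move=> k; apply: Ck_on_sub (smooth_chart_inv i sf k) => y /BI[z [dz _] <-].
  by exists z.
pose U := (chart_dom M i `&` (chart M i @^-1` ball y0 e)) `&` W.
have oU : open U by apply: openI => //; apply: chart_preimage_open.
have Ux : U x by split=> //; split; [exact: Wd|exact: ballxx].
have [V [rho [oV Vx VU cr]]] := exists_cutoff oU Ux.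
have [srho _ rho1] := cr.
pose G l := radial_mean y0 0 (fun z => 'D_(delta_mx 0 l) F z).
have sG l : smooth_on (ball y0 e) (G l).
  apply: smooth_radial_mean => k; apply: Ck_on_derive (sF k.+1).
pose a l z := rho z * (xi l z - xi l x).
pose g l z := rho z * (G l \o chart M i) z.
have sg l : smooth (g l).
  apply: cutoff_smooth oU cr _; apply: smooth_in_sub (@smooth_in_chart _ _ M i _ _ oB (sG l)).
  by move=> z [].
have sd l : smooth (fun z => xi l z - xi l x).
  by apply: smoothB => //; exact: smooth_cst.
have sa l : smooth (a l) by apply: smoothM.
have sfx : smooth (fun z => f z - f x) by apply: smoothB => //; exact: smooth_cst.
have key : (fun z => rho z * (rho z * (f z - f x))) = (fun z => \sum_l a l z * g l z).
  apply/funext => z; have [Uz|nUz] := pselect (U z); last first.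
    rewrite /a /g (cutoff_eq0 cr nUz) !mul0r big1 // => l _.
    by rewrite !mul0r.
  have [[dz Bz] Wz] := Uz.
  have := Hadamard sF Bz; rewrite {1 2}/F /= !chartK //; last exact: Wd.
  move=> ->; rewrite addrAC subrr add0r !mulr_sumr; apply: eq_bigr => l _.
  rewrite /a /g /= !xiE //; rewrite /G /y0; ring.
have Dsub (h : M -> R) : smooth h -> D (fun z => h z - h x) = D h.
  by move=> sh; rewrite (tvecD tD sh (smooth_cst _)) (tvec_cst _ tD) addr0.
have := congr1 D key.
rewrite (tvecM tD srho (smoothM srho sfx)) subrr !mulr0 add0r.
rewrite (tvecM tD srho sfx) rho1 // subrr mulr0 add0r !mul1r (Dsub _ sf) => ->.
rewrite (tvec_sum _ _ tD) => [|l]; last exact: smoothM.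
apply: eq_bigr => l _; rewrite (tvecM tD (sa l) (sg l)).
rewrite {2}/a subrr mulr0 mul0r addr0 (tvecM tD srho (sd l)) subrr mulr0 add0r.
rewrite rho1 // mul1r (Dsub _ (sxi l)); congr (_ * _).
by rewrite /g rho1 // mul1r /= /G radial_mean_center.
Qed.

(** The coordinates of a chart and its partial derivatives, both cut off, are
    dual to each other where the cutoff function is [1]. The last clause is the
    chain rule of one variable for a partial derivative; by the clause before
    it, it passes to all tangent vectors ([tvec_expR]). *)
Lemma exists_coordinates x : exists W (xi : 'I_m -> M -> R) (Y : 'I_m -> vfield M),
  [/\ open W, W x, local_coordinates W xi, forall k, is_vfield (Y k) &
  forall z, W z ->
    [/\ forall h k, Y k z (xi h) = (h == k)%:R,
        forall D f, is_tvec z D -> smooth f -> D f = \sum_h D (xi h) * Y h z f &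
        forall k f, smooth f -> Y k z (fun z => expR (f z)) = expR (f z) * Y k z f]].
Proof.
have [i dx] := chart_dom_cover x.
have od := @chart_dom_open _ _ M i.
have [V [rho [oV Vx Vd cr]]] := exists_cutoff od dx.
have [srho _ rho1] := cr.
pose xi (h : 'I_m) z := rho z * chart M i z 0 h.
have sxi h : smooth (xi h).
  apply: cutoff_smooth od cr _.
  by move=> j k; apply: Ck_on_sub (chart_transition j i h k).
have xiE z : V z -> forall h, xi h z = chart M i z 0 h.
  by move=> Vz h; rewrite /xi rho1 // mul1r.
exists V, xi, (coord_field i rho); split=> //.
- by split=> //; exists i.
- by move=> k; apply: coord_field_vfield cr od _.
move=> z Vz; split.
- move=> h k; have xih z' : V z' -> xi h z' = chart M i z' 0 h by move=> /xiE.
  exact: coord_field_coord oV Vd Vz (rho1 z Vz) xih.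
- move=> D f tD sf; rewrite (tvec_coordE tD sf sxi oV Vz Vd xiE).
  by apply: eq_bigr => h _; rewrite /coord_field rho1 // mul1r.
- move=> k f sf; rewrite /coord_field rho1 // !mul1r.
  have Wz : (chart M i @` chart_dom M i) (chart M i z) by exists z => //; apply: Vd.
  have d := Ck_on_is_derive k (smooth_chart_inv i sf 1%N) Wz.
  have d2 := is_derive_comp1 (is_derive_expR _) d.
  rewrite (_ : (fun z => expR (f z)) \o _ = expR \o (f \o chart_inv M i)) //.
  rewrite (@derive_val _ _ _ _ _ _ _ d2) /= chartK //; exact: Vd.
Qed.

Lemma tvec_expR x D f : is_tvec x D -> smooth f ->
  D (fun z => expR (f z)) = expR (f x) * D f.
Proof.
move=> tD sf; have [W [xi [Y [oW Wx _ _ /(_ x Wx)[_ DE eE]]]]] := exists_coordinates x.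
rewrite (DE D f tD sf) DE //; last by apply: smooth_in_expR => //; exact: openT.
rewrite mulr_sumr; apply: eq_bigr => h _; rewrite eE //; ring.
Qed.

End TangentVectors.

(** * Frames and derivations of sections *)

Lemma lfun_traceE (K : fieldType) (V : vectType K) (f : 'End(V)) n
    (X : n.-tuple V) : basis_of fullv X ->
  lfun_trace f = \sum_i coord X i (f (tnth X i)).
Proof.
move=> bX; pose B := vbasis (@fullv K V); have bB : basis_of fullv B := vbasisP _.
have -> : lfun_trace f = \sum_k coord B k (f (tnth B k)).
  rewrite /lfun_trace /mxtrace; apply: eq_bigr => k _.
  rewrite /passmx.mxof mxE /= /passmx.rVof mxE; congr (coord _ k (f _)).
  rewrite /passmx.vecof (bigD1 k) //= mxE !eqxx scale1r big1 ?addr0.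
    by rewrite (tnth_nth 0).
  by move=> l /negPf lk; rewrite mxE lk andbF scale0r.
under eq_bigr => k _.
  rewrite {1}(coord_basis bX (memvf (tnth B k))) linear_sum linear_sum /=.
  over.
rewrite exchange_big /=; apply: eq_bigr => i _.
transitivity (coord X i (\sum_k coord B k (f (tnth X i)) *: tnth B k)).
  rewrite linear_sum; apply: eq_bigr => k _.
  by rewrite !linearZ /= -tnth_nth mulrC.
congr (coord X i _); rewrite [RHS](coord_basis bB (memvf _)).
by apply: eq_bigr => k _; rewrite -tnth_nth.
Qed.

Section Frames.
Context {R : realType} {m : nat} {M : manifold R m}.
Implicit Types (U V W : set M) (f g : M -> R) (x : M) (E F : vbundle M).

Lemma section_ext E (s t : section E) : (forall x, s x = t x) -> s = t.
Proof. by move=> st; apply: functional_extensionality_dep. Qed.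

Lemma is_section_add E (s t : section E) :
  is_section s -> is_section t -> is_section (sec_add s t).
Proof.
move=> ss st j p; have oU := @triv_dom_open _ _ _ E j.
apply: smooth_in_ext (smooth_inD oU (ss j p) (st j p)) => // x _.
by rewrite /sec_add linearD.
Qed.

Lemma is_section_scale E f (s : section E) :
  smooth f -> is_section s -> is_section (sec_scale f s).
Proof.
move=> sf ss j p; have oU := @triv_dom_open _ _ _ E j.
apply: smooth_in_ext (smooth_inM oU (@smooth_in_of_smooth _ _ _ _ _ sf) (ss j p)) => // x _.
by rewrite /sec_scale linearZ.
Qed.

Lemma is_section_sum E (I : Type) (r : seq I) (f : I -> M -> R) (s : I -> section E) :
  (forall i, smooth (f i)) -> (forall i, is_section (s i)) ->
  is_section (fun x => \sum_(i <- r) f i x *: s i x).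
Proof.
move=> sf ss j p; have oU := @triv_dom_open _ _ _ E j.
have h i : smooth_in (triv_dom E j) (fun x => f i x * coord (frame E j x) p (s i x)).
  by apply: smooth_inM => //; [exact: smooth_in_of_smooth|exact: ss].
have h2 : smooth_in (triv_dom E j)
  (fun x => \sum_(i <- r) f i x * coord (frame E j x) p (s i x)) by exact: smooth_in_sum.
apply: smooth_in_ext h2 => // x _.
by rewrite linear_sum; apply: eq_bigr => i _; rewrite linearZ.
Qed.

(** The frame and its coframe consist of global sections, because brackets and
    connections act on global sections only; they are dual over [W]. *)
Definition frame_on E W (b : 'I_(rank E) -> section E)
    (beta : 'I_(rank E) -> section (dual_bundle E)) : Prop :=
  [/\ open W, forall p, is_section (b p), forall p, is_section (beta p) &
    forall x, W x -> forall p q, (beta p x : 'Hom(E x, R^o)) (b q x) = (p == q)%:R].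

Lemma frame_onS E W W' b beta : @frame_on E W b beta -> open W' -> W' `<=` W ->
  frame_on W' b beta.
Proof. by move=> [_ sb sbeta d] oW' WW'; split=> // x /WW'; apply: d. Qed.

Lemma cutoff_section E U V rho (s : section E) j : cutoff U V rho ->
  U `<=` triv_dom E j ->
  (forall k p, smooth_in (triv_dom E j `&` triv_dom E k)
     (fun x => coord (frame E k x) p (s x))) ->
  is_section (fun x => rho x *: s x).
Proof.
move=> [srho [C [cC CU rho0]] _] Ud ss k p.
have oj := @triv_dom_open _ _ _ E j; have ok := @triv_dom_open _ _ _ E k.
have oU := openI oj ok.
apply: smooth_in_local => x kx; have [Cx|nCx] := pselect (C x).
  exists (triv_dom E j `&` triv_dom E k); first by split=> //; apply/Ud/CU.
  apply: smooth_in_ext (smooth_inM oU (@smooth_in_of_smooth _ _ _ _ _ srho) (ss k p)) => // z _.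
  by rewrite linearZ.
exists (~` C) => //; apply: smooth_in_ext (smooth_in_cst (~` C) 0).
  exact: closed_openC.
by move=> z /rho0 ->; rewrite scale0r linear0.
Qed.

Lemma exists_frame E x : exists W b beta, W x /\ @frame_on E W b beta.
Proof.
have [j jx] := triv_dom_cover E x.
have oj := @triv_dom_open _ _ _ E j.
have [V [rho [oV Vx Vd cr]]] := exists_cutoff oj jx.
have [_ _ rho1] := cr.
exists V, (fun p z => rho z *: tnth (frame E j z) p),
  (fun p z => rho z *: tnth (dual_basis (frame E j z)) p).
split=> //; split=> //.
- move=> p; apply: (cutoff_section cr (s := fun z => tnth (frame E j z) p) (@subset_refl _ _)).
  by move=> k q; rewrite setIC; apply: frame_smooth.
- move=> p; apply: (@cutoff_section (dual_bundle E) _ _ _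
      (fun z => tnth (dual_basis (frame E j z)) p) j cr (@subset_refl _ _)).
  by move=> k q; rewrite setIC; exact: (@dual_frame_smooth _ _ _ E k j q p).
- move=> z Vz p q; rewrite rho1 // !scale1r tnth_mktuple lfunE /=.
  rewrite (tnth_nth 0) coord_free ?(basis_free (frame_basis (Vd z Vz))) //.
  by rewrite eq_sym.
Qed.

Lemma frame_on_basis E W b beta x : @frame_on E W b beta -> W x ->
  basis_of fullv [tuple b j x | j < rank E] /\
  forall i v, coord [tuple b j x | j < rank E] i v = (beta i x : 'Hom(E x, R^o)) v.
Proof.
move=> [_ _ _ d] Wx; pose X := [tuple b j x | j < rank E].
have fX : free X.
  apply/freeP => k k0 i.
  have k0' : \sum_j k j *: b j x = 0.
    by rewrite -[RHS]k0; apply: eq_bigr => j _; rewrite -tnth_nth tnth_mktuple.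
  have := congr1 (beta i x : 'Hom(E x, R^o)) k0'.
  rewrite linear_sum linear0 (bigD1 i) //= big1 ?addr0 => [|j /negPf ji].
    by rewrite linearZ /= d // eqxx => <-; rewrite [RHS]mulr1.
  by rewrite linearZ /= d // eq_sym ji; apply: mulr0.
have bX : basis_of fullv X.
  rewrite basisEfree fX subvf size_tuple.
  have [j jx] := triv_dom_cover E x.
  by rewrite (size_basis (frame_basis jx)) leqnn.
split=> // i v.
have vE : v = \sum_j coord X j v *: b j x.
  rewrite {1}(coord_basis bX (memvf v)).
  by apply: eq_bigr => j _; rewrite -tnth_nth tnth_mktuple.
rewrite [in RHS]vE [RHS]linear_sum (bigD1 i) //= big1 ?addr0 => [|j /negPf ji].
  by rewrite [RHS]linearZ /= d // eqxx -[RHS]/(_ * 1) mulr1.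
by rewrite [LHS]linearZ /= d // eq_sym ji; apply: mulr0.
Qed.

Lemma frame_on_expand E W b beta x v : @frame_on E W b beta -> W x ->
  v = \sum_i (beta i x : 'Hom(E x, R^o)) v *: b i x.
Proof.
move=> fr Wx; have [bX cE] := frame_on_basis fr Wx.
rewrite [LHS](coord_basis bX (memvf v)); apply: eq_bigr => i _.
by rewrite cE -tnth_nth tnth_mktuple.
Qed.

Lemma smooth_pairing E (nu : section (dual_bundle E)) (s : section E) :
  is_section nu -> is_section s -> smooth (pairing nu s).
Proof.
move=> snu ss; apply: smooth_glue => x.
have [j jx] := triv_dom_cover E x; have oj := @triv_dom_open _ _ _ E j.
exists (triv_dom E j), (fun x => \sum_p coord (dual_basis (frame E j x)) p (nu x) *
  coord (frame E j x) p (s x)); split=> //.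
  by apply: smooth_in_sum => [//|p]; apply: smooth_inM; [exact: oj|exact: snu|exact: ss].
move=> z jz; have bX := frame_basis jz; have [_ dE] := dual_basisP bX.
rewrite /pairing [in LHS](coord_basis bX (memvf (s z))) linear_sum.
apply: eq_bigr => p _; rewrite linearZ /= dE (tnth_nth 0); exact: mulrC.
Qed.

(** Brackets and connections are derivations with [S] the identity, tensors are
    derivations with [X = 0]; all three are expanded in frames at once. *)
Definition is_derivation E F (X : vfield M) (S : forall x, 'Hom(E x, F x))
    (D : section E -> section F) : Prop :=
  (forall s t, is_section s -> is_section t -> forall x,
     D (sec_add s t) x = D s x + D t x) /\
  (forall f s, smooth f -> is_section s -> forall x,
     D (sec_scale f s) x = f x *: D s x + X x f *: S x (s x)).

Lemma is_section0 E : is_section (fun x => 0 : E x).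
Proof.
move=> j p; apply: smooth_in_ext (smooth_in_cst (triv_dom E j) 0).
  exact: triv_dom_open.
by move=> x _; rewrite linear0.
Qed.

Lemma derivation_sum E F (X : vfield M) (S : forall x, 'Hom(E x, F x)) (D : section E -> section F) (I : Type)
    (r : seq I) (f : I -> M -> R) (b : I -> section E) x :
  is_tvec x (X x) -> is_derivation X S D ->
  (forall i, smooth (f i)) -> (forall i, is_section (b i)) ->
  D (fun z => \sum_(i <- r) f i z *: b i z) x =
  \sum_(i <- r) (f i x *: D (b i) x + X x (f i) *: S x (b i x)).
Proof.
move=> tX [Dadd Dscale] sf sb; elim: r => [|i r IH].
  have -> : (fun z => \sum_(i <- [::]) f i z *: b i z) =
      sec_scale (fun=> 0) (fun x => 0 : E x).
    by apply: section_ext => z; rewrite big_nil /sec_scale scale0r.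
  rewrite big_nil Dscale; [|exact: smooth_cst|exact: is_section0].
  by rewrite (tvec0 tX) !scale0r addr0.
have -> : (fun z => \sum_(j <- i :: r) f j z *: b j z) =
    sec_add (sec_scale (f i) (b i)) (fun z => \sum_(j <- r) f j z *: b j z).
  by apply: section_ext => z; rewrite big_cons.
rewrite Dadd; [|exact: is_section_scale|exact: is_section_sum].
by rewrite IH big_cons Dscale.
Qed.

(** Cutting off [s] and the coframe near [x] gives a genuine global expansion
    of [s]; the derivatives of the cutoff cancel. *)
Lemma derivation_expand E F (X : vfield M) (S : forall x, 'Hom(E x, F x)) (D : section E -> section F)
    W b beta (s : section E) x :
  (forall x, is_tvec x (X x)) -> is_derivation X S D ->
  @frame_on E W b beta -> W x -> is_section s ->
  D s x = \sum_i (pairing (beta i) s x *: D (b i) x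
                  + X x (pairing (beta i) s) *: S x (b i x)).
Proof.
move=> tX dD fr Wx ss; have [oW sb sbeta d] := fr.
have [V [rho [oV Vx VW cr]]] := exists_cutoff oW Wx.
have [srho _ rho1] := cr.
have sp i : smooth (pairing (beta i) s) by apply: smooth_pairing.
have E1 : sec_scale rho s =
    (fun z => \sum_i (rho z * pairing (beta i) s z) *: b i z).
  apply: section_ext => z; rewrite /sec_scale.
  have [Wz|nWz] := pselect (W z); last first.
    rewrite (cutoff_eq0 cr nWz) scale0r big1 // => i _.
    by rewrite mul0r scale0r.
  rewrite {1}(frame_on_expand (s z) fr Wz) scaler_sumr.
  by apply: eq_bigr => i _; rewrite scalerA.
have := congr1 (fun s => D s x) E1.
rewrite (derivation_sum _ (tX x) dD) => [|i|//]; last exact: smoothM.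
rewrite dD.2 // rho1 // scale1r => E2; apply: (addIr (X x rho *: S x (s x))).
rewrite {}E2 [in RHS](frame_on_expand (s x) fr Wx) linear_sum scaler_sumr -big_split /=.
apply: eq_bigr => i _; rewrite (tvecM (tX x) srho (sp i)) rho1 // !mul1r.
by rewrite linearZ /= scalerA scalerDl [X in _ + X = _]addrC addrA.
Qed.

End Frames.

(** * Traces, kernels and determinants *)

Section LinearAlgebra.
Variable K : fieldType.

(** [Z *m P] squares to zero when [P *m Z *m P = 0]; a generalised inverse of
    [P] makes the vanishing of its trace explicit. *)
Lemma mxtrace_mulmx_eq0 s s' (P : 'M[K]_(s', s)) (Z : 'M[K]_(s, s')) :
  P *m Z *m P = 0 -> \tr (Z *m P) = 0.
Proof.
move=> PZP; have [Q PQP] : exists Q, P *m Q *m P = P.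
  by exists (pinvmx P); rewrite mulmxKpV ?submx_refl.
have -> : Z *m P = (Z *m P *m Q) *m P by rewrite -{1}PQP !mulmxA.
by rewrite mxtrace_mulC !mulmxA PZP !mul0mx linear0.
Qed.

(** With [t = N2 *m P], given by the kernel condition, the difference of the
    traces is the trace of [(N2 - N) *m P], and [P *m (N2 - N) *m P = 0]. *)
Lemma mxtrace_intertwine s s' (P : 'M[K]_(s', s)) (t : 'M[K]_s) (t' : 'M[K]_s')
    (N : 'M[K]_(s, s')) :
  P *m t = t' *m P -> t' = P *m N -> (forall v : 'cV[K]_s, P *m v = 0 -> t *m v = 0) ->
  \tr t = \tr t'.
Proof.
move=> Pt t'E kerPt.
have tP : (t <= P)%MS.
  rewrite submxE; apply/eqP/matrixP => i j.
  have /kerPt : P *m (cokermx P *m delta_mx j (0 : 'I_1)) = 0.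
    by rewrite mulmxA mulmx_coker mul0mx.
  by rewrite mulmxA -colE => /colP/(_ i); rewrite !mxE.
have tE := mulmxKpV tP; set N2 := t *m pinvmx P in tE.
apply/eqP; rewrite -subr_eq0 t'E mxtrace_mulC -tE -raddfB -mulmxBl; apply/eqP.
apply: mxtrace_mulmx_eq0; rewrite mulmxBr mulmxBl -mulmxA tE Pt t'E.
by rewrite subrr.
Qed.

(** Cramer's rule, without division, for the kernel of a matrix of rank at
    most [r] with an invertible compression of size [r]. *)
Lemma mulmx_kernel_vector s s' r (P : 'M[K]_(s', s)) (F : 'M[K]_(r, s'))
    (E : 'M[K]_(s, r)) (v : 'cV[K]_s) :
  (\rank P <= r)%N -> \det (F *m P *m E) != 0 ->
  P *m (\det (F *m P *m E) *: v - E *m \adj (F *m P *m E) *m (F *m P *m v)) = 0.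
Proof.
move=> rP d0; set S := F *m P *m E.
have rS : \rank S = r by apply/eqP; rewrite -[_ == _]/(row_free S) row_free_unit unitmxE unitfE.
have sFP : (F *m P <= P)%MS by exact: submxMl.
have rFP : (r <= \rank (F *m P))%N by rewrite -[r in (r <= _)%N]rS mxrankM_maxl.
have [N PE] : exists N, P = N *m (F *m P).
  apply/submxP; have [_ <-] := mxrank_leqif_sup sFP.
  by rewrite eqn_leq mxrankS //= (leq_trans rP).
have ker (u : 'cV[K]_s) : F *m P *m u = 0 -> P *m u = 0.
  by move=> FPu; rewrite PE -mulmxA FPu mulmx0.
apply: ker; rewrite mulmxBr -scalemxAr !mulmxA -/S mul_mx_adj -!mulmxA.
by rewrite mul_scalar_mx subrr.
Qed.

Lemma cofactor_eq n (A B : 'M[K]_n) i h :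
  (forall l k, k != h -> A l k = B l k) -> cofactor A i h = cofactor B i h.
Proof.
move=> AB; rewrite /cofactor; congr (_ * \det _); apply/matrixP => l k.
by rewrite !mxE AB // eq_sym neq_lift.
Qed.

Lemma det_subst_col n (v : 'I_n -> K) h :
  \det (\matrix_(l, k) (if k == h then v l else (l == k)%:R)) = v h.
Proof.
rewrite (expand_det_col _ h) (bigD1 h) //= big1 ?addr0 => [|l /negPf lh].
  rewrite mxE eqxx (@cofactor_eq _ _ 1%:M) => [|l k /negPf kh]; last by rewrite !mxE kh.
  have /matrixP/(_ h h) := mul_mx_adj (1%:M : 'M[K]_n).
  by rewrite mul1mx det1 !mxE eqxx => ->; rewrite mulr1.
rewrite (@cofactor_eq _ _ 1%:M) => [|l' k /negPf kh]; last by rewrite !mxE kh.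
have /matrixP/(_ h l) := mul_mx_adj (1%:M : 'M[K]_n).
by rewrite mul1mx det1 !mxE eq_sym lh => ->; rewrite mulr0.
Qed.

End LinearAlgebra.

(** Jacobi's formula for the derivative of a determinant. *)
Lemma tvec_det (R : realType) m (M : manifold R m) (x : M) (D : tvec M) n
    (A : M -> 'M[R]_n) : is_tvec x D -> (forall i j, smooth (fun z => A z i j)) ->
  D (fun z => \det (A z)) = \sum_i \sum_j D (fun z => A z i j) * cofactor (A x) i j.
Proof.
move=> tD sA; rewrite /determinant.
have sp (s : 'S_n) : smooth (fun z => \prod_i A z i (s i)).
  by apply: smooth_in_prod => [|i]; [exact: openT|exact: sA].
rewrite (tvec_sum _ _ tD) => [|s]; last by apply: smoothM => //; exact: smooth_cst.
under eq_bigr => s _.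
  rewrite (tvecZ _ tD (sp s)) (tvec_prod tD) => [|i]; last exact: sA.
  rewrite mulr_sumr.
  over.
rewrite exchange_big /=; apply: eq_bigr => i _.
rewrite (partition_big (fun s : 'S_n => s i) xpredT) //=.
apply: eq_bigr => j _; rewrite expand_cofactor mulr_sumr.
apply: eq_bigr => s /eqP <-; rewrite mulrCA; congr (_ * (_ * _)).
by apply: eq_bigl => k; rewrite eq_sym.
Qed.

(** The shape of the derivative is that of the Gram matrix of a frame under a
    metric connection with matrix [w]. *)
Lemma tvec_det_gram (R : realType) m (M : manifold R m) (x : M) (D : tvec M) n
    (A : M -> 'M[R]_n) (w : 'M[R]_n) :
  is_tvec x D -> (forall i j, smooth (fun z => A z i j)) ->
  (forall i j, D (fun z => A z i j) = (w^T *m A x + A x *m w) i j) ->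
  D (fun z => \det (A z)) = 2 * \tr w * \det (A x).
Proof.
move=> tD sA DA; rewrite (tvec_det tD sA).
transitivity (\tr ((w^T *m A x + A x *m w) *m \adj (A x))).
  rewrite /mxtrace; apply: eq_bigr => i _; rewrite [RHS]mxE; apply: eq_bigr => j _.
  by rewrite DA; congr (_ * _); rewrite [RHS]mxE.
rewrite mulmxDl linearD /= -mulmxA mul_mx_adj mul_mx_scalar.
rewrite [X in _ + X]mxtrace_mulC mulmxA mul_adj_mx mul_scalar_mx !linearZ /= mxtrace_tr.
ring.
Qed.

(** * The modular form in local data *)

Section ModularForm.
Context {R : realType} {m : nat} {M : manifold R m}.
Implicit Types (U V W : set M) (f g : M -> R) (x : M) (A : lie_algebroid M).

Lemma anchor_sum A x (I : Type) (r : seq I) (c : I -> R) (v : I -> A x) f :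
  smooth f -> anchor A (\sum_(i <- r) c i *: v i) f =
              \sum_(i <- r) c i * anchor A (v i) f.
Proof.
move=> sf; elim: r => [|i r IH]; last by rewrite !big_cons anchor_linear // IH.
rewrite !big_nil; have := @anchor_linear _ _ _ A x 1 0 0 f sf.
by rewrite scaler0 addr0 mul1r => /eqP; rewrite -subr_eq subrr eq_sym => /eqP.
Qed.

Lemma sharp_vfield A (a : section A) : is_section a -> is_vfield (sharp a).
Proof. by move=> sa; split=> [x|f sf]; [exact: anchor_tvec|exact: anchor_smooth]. Qed.

Lemma bracket_derivation A (a : section A) : is_section a ->
  is_derivation (sharp a) (fun x => \1%VF) (bracket A a).
Proof.
move=> sa; split=> [s t ss st x|f s sf ss x]; first exact: bracketDr.
by rewrite bracket_leibniz // id_lfunE.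
Qed.

Lemma connection_derivation A (E : vbundle M) (D : conn_op A E) (a : section A) :
  is_connection D -> is_section a -> is_derivation (sharp a) (fun x => \1%VF) (D a).
Proof.
move=> [_ _ Dadd _ Dscale] sa; split=> [s t ss st x|f s sf ss x]; first exact: Dadd.
by rewrite Dscale // id_lfunE.
Qed.

(** As for frames, functions and fields are global and the conditions on them
    local; [Y k] plays the part of the partial derivative along [xi k]. *)
Definition dual_coordinates W (xi : 'I_m -> M -> R) (Y : 'I_m -> vfield M) : Prop :=
  [/\ open W, local_coordinates W xi, forall k, is_vfield (Y k),
      forall z, W z -> forall h k, Y k z (xi h) = (h == k)%:R &
      forall z, W z -> forall D f, is_tvec z D -> smooth f ->
        D f = \sum_h D (xi h) * Y h z f].

Lemma dual_coordinatesS W W' xi Y : dual_coordinates W xi Y -> open W' ->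
  W' `<=` W -> dual_coordinates W' xi Y.
Proof.
move=> [_ [sxi [i Wd xiE]] vY d e] oW' WW'; split=> //; last first.
- by move=> z /WW'; apply: e.
- by move=> z /WW'; apply: d.
by split=> //; exists i => [z /WW'/Wd|z /WW'/xiE].
Qed.

Lemma exists_dual_coordinates x : exists W xi Y, W x /\ dual_coordinates W xi Y.
Proof.
have [W [xi [Y [oW Wx cx vY H]]]] := exists_coordinates x.
by exists W, xi, Y; split=> //; split=> // z /H[].
Qed.

Lemma wedge_d_dual W xi Y x : dual_coordinates W xi Y -> W x ->
  wedge_d xi x (fun k => Y k x) = 1.
Proof.
move=> [_ _ _ d _] Wx; rewrite /wedge_d -[RHS](det1 R m); congr (\det _).
by apply/matrixP => h k; rewrite !mxE d.
Qed.

Definition divergence (xi : 'I_m -> M -> R) (Y : 'I_m -> vfield M) (X : vfield M) x :=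
  \sum_h Y h x (vf_app X (xi h)).

(** The function [det (Y k (xi h))] is constant over [W], so that only the
    brackets [[X, Y h]] contribute, each through one column. *)
Lemma lie_derivative_dual W xi Y X x : dual_coordinates W xi Y -> W x ->
  is_vfield X -> lie_derivative X (wedge_d xi) Y x = divergence xi Y X x.
Proof.
move=> dc Wx [tX sX]; have [oW [sxi _] vY d _] := dc.
rewrite /lie_derivative.
have -> : X x (fun z => wedge_d xi z (fun k => Y k z)) = 0.
  rewrite -[RHS](tvec_cst 1 (tX x)).
  apply: (tvec_local (tX x) _ (smooth_cst 1) oW Wx).
    apply: smooth_in_det => [|h k]; first exact: openT.
    have [_ sY] := vY k; have := sY _ (sxi h).
    by apply: smooth_in_ext => [|z _]; [exact: openT|rewrite mxE].
  by move=> z Wz; rewrite (wedge_d_dual dc Wz).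
rewrite sub0r -sumrN; apply: eq_bigr => h _.
have XY : X x (vf_app (Y h) (xi h)) = 0.
  rewrite -[RHS](tvec_cst 1 (tX x)).
  apply: (tvec_local (tX x) _ (smooth_cst 1) oW Wx); first by have [_] := vY h; apply.
  by move=> z Wz; rewrite /vf_app d // eqxx.
have -> : wedge_d xi x (fun k => (if k == h then vf_bracket X (Y h) else Y k) x) =
    vf_bracket X (Y h) x (xi h).
  rewrite -[RHS](det_subst_col (fun l => vf_bracket X (Y h) x (xi l)) h).
  congr (\det _); apply/matrixP => l k; rewrite !mxE.
  by case: eqP => // _; rewrite d.
by rewrite /vf_bracket XY sub0r opprK.
Qed.

Lemma wedge_sec_dual A W b beta x : @frame_on _ _ _ A W b beta -> W x ->
  wedge_sec b (fun l => beta l x) = 1.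
Proof.
move=> [_ _ _ d] Wx; rewrite /wedge_sec -[RHS](det1 R (rank A)); congr (\det _).
by apply/matrixP => h k; rewrite !mxE d.
Qed.

Definition adjoint_trace A (b : 'I_(rank A) -> section A)
    (beta : 'I_(rank A) -> section (dual_bundle A)) (a : section A) x : R :=
  \sum_j pairing (beta j) (bracket A a (b j)) x.

Lemma lconn_gen_dual A W b beta xi Y x i : @frame_on _ _ _ A W b beta ->
  dual_coordinates W xi Y -> W x ->
  lconn_gen b xi i beta Y x = adjoint_trace b beta (b i) x + divergence xi Y (sharp (b i)) x.
Proof.
move=> fr dc Wx; have [_ sb _ d] := fr.
rewrite /lconn_gen (wedge_d_dual dc Wx) (wedge_sec_dual fr Wx) mulr1 mul1r.
rewrite (lie_derivative_dual dc Wx (sharp_vfield (sb i))); congr (_ + _).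
apply: eq_bigr => j _; rewrite /wedge_sec.
rewrite -[RHS](det_subst_col (fun l => pairing (beta l) (bracket A (b i) (b j)) x) j).
congr (\det _); apply/matrixP => l k; rewrite !mxE /pairing.
by case: eqP => // _; rewrite d.
Qed.

(** Neither the trace of [ad a] in a frame nor the divergence of the anchor of
    [a] is tensorial in [a], but the defects cancel in their sum. *)
Lemma adjoint_trace_divergence A W b beta xi Y (a : section A) x :
  @frame_on _ _ _ A W b beta -> dual_coordinates W xi Y -> W x -> is_section a ->
  adjoint_trace b beta a x + divergence xi Y (sharp a) x =
  \sum_i pairing (beta i) a x *
    (adjoint_trace b beta (b i) x + divergence xi Y (sharp (b i)) x).
Proof.
move=> fr dc Wx sa; have [oW sb sbeta d] := fr; have [_ [sxi _] vY _ cE] := dc.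
pose c i := pairing (beta i) a.
have sc i : smooth (c i) by apply: smooth_pairing.
have adE : adjoint_trace b beta a x =
    \sum_i c i x * adjoint_trace b beta (b i) x - \sum_i anchor A (b i x) (c i).
  rewrite /adjoint_trace.
  under [X in _ = X - _]eq_bigr do rewrite mulr_sumr.
  rewrite exchange_big -sumrB; apply: eq_bigr => j _.
  rewrite /pairing bracket_anti // linearN.
  rewrite (derivation_expand (fun x => anchor_tvec _) (bracket_derivation (sb j)) fr Wx sa).
  rewrite linear_sum /=.
  under eq_bigr => i _.
    rewrite linearD /= !linearZ /= id_lfunE d // bracket_anti // linearN.
    over.
  rewrite big_split /= opprD -sumrN; congr (_ + _).
    by apply: eq_bigr => i _; rewrite -[_ *: _]/(_ * _) mulrN opprK.
  rewrite (bigD1 j) //= eqxx big1 ?addr0 => [|i /negPf ij].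
    by rewrite -[_ *: _]/(_ * _) mulr1.
  by rewrite eq_sym ij -[_ *: _]/(_ * _) mulr0.
have divE : divergence xi Y (sharp a) x =
    \sum_i c i x * divergence xi Y (sharp (b i)) x + \sum_i anchor A (b i x) (c i).
  have aE h : Y h x (vf_app (sharp a) (xi h)) =
      \sum_i (Y h x (c i) * anchor A (b i x) (xi h) +
              c i x * Y h x (vf_app (sharp (b i)) (xi h))).
    have [tY _] := vY h.
    have sbx i : smooth (vf_app (sharp (b i)) (xi h)) by apply: anchor_smooth.
    rewrite (tvec_local (tY x) (g := fun z => \sum_i c i z * vf_app (sharp (b i)) (xi h) z)
      _ _ oW Wx).
    + rewrite (tvec_sum _ _ (tY x)) => [|i]; last exact: smoothM.
      by apply: eq_bigr => i _; rewrite (tvecM (tY x)).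
    + exact: anchor_smooth.
    + by apply: smooth_sum => i; apply: smoothM.
    + move=> z Wz; rewrite /vf_app /sharp {1}(frame_on_expand (a z) fr Wz).
      by rewrite anchor_sum.
  rewrite /divergence; under eq_bigr do rewrite aE big_split /=.
  rewrite big_split /= addrC; congr (_ + _).
    rewrite exchange_big /=; apply: eq_bigr => i _; by rewrite mulr_sumr.
  rewrite exchange_big /=; apply: eq_bigr => i _.
  rewrite [RHS](cE x Wx _ _ (anchor_tvec _) (sc i)).
  by apply: eq_bigr => h _; rewrite mulrC.
rewrite adE divE addrACA addNr addr0 -big_split /=.
by apply: eq_bigr => i _; rewrite mulrDr.
Qed.

(** The identity that defines [lambda] is evaluated on the coframe and on the
    dual fields, where the generator [lgen] takes the value [1]. The sign
    ambiguity of [sigma] disappears in its square. *)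
Lemma modular_form_local A sigma (lambda : form1 A) W b beta xi Y x0 :
  is_modular_form sigma lambda -> @frame_on _ _ _ A W b beta ->
  dual_coordinates W xi Y -> W x0 ->
  exists U f, [/\ open U, U x0, U `<=` W, smooth f & forall x, U x -> [/\ f x != 0,
     forall nu Y', (forall k, is_tvec x (Y' k)) ->
       sigma x nu Y' ^+ 2 = (f x * lgen b xi nu Y') ^+ 2 &
     forall a, is_section a -> form1_app lambda a x * f x =
       f x * (adjoint_trace b beta a x + divergence xi Y (sharp a) x) + sharp a x f]].
Proof.
move=> mf fr dc Wx0; have [oW sb sbeta d] := fr; have [_ cx vY _ _] := dc.
have lb : local_basis W b.
  by split=> // x Wx; have [] := frame_on_basis fr Wx.
have [U [f [oU Ux0 UW sf H]]] := mf W b xi oW lb cx x0 Wx0.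
exists U, f; split=> // x Ux; have [f0 [e se] lE] := H x Ux; split=> //.
  by move=> nu Y' tY; rewrite se // exprMn sqrr_sign mul1r.
move=> a sa; have Wx := UW x Ux.
have := lE a beta Y sa sbeta vY.
rewrite /lconn /lgen (wedge_sec_dual fr Wx) (wedge_d_dual dc Wx) !mulr1 => <-.
congr (_ * _ + _); rewrite (adjoint_trace_divergence fr dc Wx sa).
apply: eq_bigr => i _; have [_ ->] := frame_on_basis fr Wx.
by rewrite (lconn_gen_dual _ fr dc Wx).
Qed.

End ModularForm.

(** * The traces of a distinguished pair *)

Section Distinguished.
Context {R : realType} {m : nat} {M : manifold R m}.
Implicit Types (U V W : set M) (f g : M -> R) (x : M) (E F : vbundle M).

Lemma is_section_sub E (s t : section E) :
  is_section s -> is_section t -> is_section (fun x => s x - t x).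
Proof.
move=> ss st; have := is_section_add ss (is_section_scale (smooth_cst (-1)) st).
by have -> : sec_add s (sec_scale (fun=> -1) t) = (fun x => s x - t x)
  by apply: section_ext => x; rewrite /sec_add /sec_scale scaleN1r.
Qed.

Lemma smooth_adj n (B : M -> 'M[R]_n) : (forall i j, smooth (fun x => B x i j)) ->
  forall i j, smooth (fun x => (\adj (B x)) i j).
Proof.
move=> sB i j; have h : smooth (fun x => (-1) ^+ (j + i) * \det (row' j (col' i (B x)))).
  apply: smoothM; first exact: smooth_cst.
  apply: smooth_in_det => [|k l]; first exact: openT.
  by apply: smooth_in_ext (sB (lift j k) (lift i l)) => [|x _]; [exact: openT|rewrite !mxE].
by apply: smooth_in_ext h => [|x _]; [exact: openT|rewrite mxE].
Qed.

Lemma smooth_mulmx n p q (A : M -> 'M[R]_(n, p)) (B : M -> 'M[R]_(p, q)) :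
  (forall i j, smooth (fun x => A x i j)) -> (forall i j, smooth (fun x => B x i j)) ->
  forall i j, smooth (fun x => (A x *m B x) i j).
Proof. by move=> sA sB; apply: smooth_in_mulmx openT sA sB. Qed.

Lemma smooth_mx_cst n p (A : 'M[R]_(n, p)) i j : smooth (fun _ : M => A i j).
Proof. exact: smooth_cst. Qed.

Lemma smooth_neq0_open f : smooth f -> open [set x | f x != 0].
Proof.
move=> sf; have -> : [set x | f x != 0] = f @^-1` (~` [set 0]).
  by apply/seteqP; split=> x /=; move/eqP.
apply: open_comp => [x _|]; first exact: smooth_in_continuous openT I sf.
exact/closed_openC/closed_eq.
Qed.

Definition is_tensor E F (T : section E -> section F) : Prop :=
  is_derivation (fun _ _ => 0) (fun x => 0) T.

Lemma derivationB E F (X : vfield M) (S : forall x, 'Hom(E x, F x))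
    (D1 D2 : section E -> section F) : is_derivation X S D1 -> is_derivation X S D2 ->
  is_tensor (fun s x => D1 s x - D2 s x).
Proof.
move=> [a1 l1] [a2 l2]; split=> [s t ss st x|f s sf ss x].
  by rewrite a1 // a2 // opprD addrACA.
by rewrite l1 // l2 // scale0r addr0 opprD addrACA subrr addr0 scalerBr.
Qed.

Lemma zero_tvec x : is_tvec x (fun _ : M -> R => 0).
Proof. by split=> *; rewrite ?mulr0 ?mul0r ?addr0. Qed.

Lemma tensor_expand E F (T : section E -> section F) W b beta (s : section E) x :
  is_tensor T -> @frame_on _ _ _ E W b beta -> W x -> is_section s ->
  T s x = \sum_i pairing (beta i) s x *: T (b i) x.
Proof.
move=> tT fr Wx ss; rewrite (derivation_expand zero_tvec tT fr Wx ss).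
by apply: eq_bigr => i _; rewrite scale0r addr0.
Qed.

Lemma tensor_sum E F (T : section E -> section F) (I : Type) (r : seq I)
    (f : I -> M -> R) (b : I -> section E) x : is_tensor T ->
  (forall i, smooth (f i)) -> (forall i, is_section (b i)) ->
  T (fun z => \sum_(i <- r) f i z *: b i z) x = \sum_(i <- r) f i x *: T (b i) x.
Proof.
move=> tT sf sb; rewrite (derivation_sum r (zero_tvec x) tT sf sb).
by apply: eq_bigr => i _; rewrite scale0r addr0.
Qed.

Section Pair.
Variables (A A' : lie_algebroid M) (phi : la_morphism A A').
Variables (D : conn_op A A) (D' : conn_op A A').
Hypothesis dist : distinguished_pair phi D D'.
Variables (a : section A) (sa : is_section a).

Let T (s : section A) : section A := fun x => D a s x - bracket A a s x.
Let T' (s : section A') : section A' :=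
  fun x => D' a s x - bracket A' (push phi a) s x.

Let cD : is_connection D. Proof. by case: dist. Qed.
Let cD' : is_connection D'. Proof. by case: dist. Qed.
Let sphia : is_section (push phi a). Proof. exact: la_map_smooth. Qed.

Let tT : is_tensor T.
Proof. exact: derivationB (connection_derivation cD sa) (bracket_derivation sa). Qed.

Let tT' : is_tensor T'.
Proof.
apply: derivationB (connection_derivation cD' sa) _.
have [Badd Bl] := bracket_derivation sphia; split=> // f s sf ss x.
by rewrite Bl // /sharp /push la_map_anchor.
Qed.

Let sT s : is_section s -> is_section (T s).
Proof.
move=> ss; apply: is_section_sub; last exact: bracket_smooth.
by have [h _ _ _ _] := cD; apply: h.
Qed.

Let sT' s : is_section s -> is_section (T' s).
Proof.
move=> ss; apply: is_section_sub; last exact: bracket_smooth.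
by have [h _ _ _ _] := cD'; apply: h.
Qed.

Let TT' s x : is_section s -> phi x (T s x) = T' (push phi s) x.
Proof.
move=> ss; have [_ _ h _ _] := dist.
rewrite /T /T' linearB /= h //; congr (_ - _).
exact: la_map_bracket.
Qed.

Variables (W : set M) (b : 'I_(rank A) -> section A)
  (beta : 'I_(rank A) -> section (dual_bundle A))
  (b' : 'I_(rank A') -> section A') (beta' : 'I_(rank A') -> section (dual_bundle A')).
Hypothesis fr : frame_on W b beta.
Hypothesis fr' : frame_on W b' beta'.

Let sb i : is_section (b i). Proof. by case: fr. Qed.
Let sb' i : is_section (b' i). Proof. by case: fr'. Qed.
Let sbeta i : is_section (beta i). Proof. by case: fr. Qed.
Let sbeta' i : is_section (beta' i). Proof. by case: fr'. Qed.

Let P z : 'M[R]_(rank A', rank A) :=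
  \matrix_(i, j) pairing (beta' i) (push phi (b j)) z.

Let sP i j : smooth (fun z => P z i j).
Proof.
have h : smooth (pairing (beta' i) (push phi (b j))).
  by apply: smooth_pairing => //; apply: la_map_smooth.
by apply: smooth_in_ext h => [|z _]; [exact: openT|rewrite mxE].
Qed.

Let phib z j : W z -> phi z (b j z) = \sum_i P z i j *: b' i z.
Proof.
move=> Wz; rewrite {1}(frame_on_expand (phi z (b j z)) fr' Wz).
by apply: eq_bigr => i _; rewrite mxE.
Qed.

(** Where the rank of [phi] is locally maximal, [mulmx_kernel_vector] extends
    every vector of the kernel to a local section of the kernel. After a cutoff
    it is a global one, on which [T] vanishes. *)
Let kernel_tensor U x (v : 'cV[R]_(rank A)) : open U -> U x -> U `<=` W ->
  (forall z, U z -> (\rank (P z) <= \rank (P x))%N) ->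
  P x *m v = 0 -> \sum_j v j 0 *: T (b j) x = 0.
Proof.
move=> oU Ux UW maxr Pv0; have [oW _ _ _] := fr.
pose r := \rank (P x).
pose F : 'M[R]_(r, rank A') := pinvmx (col_base (P x)).
pose E : 'M[R]_(rank A, r) := pinvmx (row_base (P x)).
have FPE : F *m P x *m E = 1%:M.
  have FC : F *m col_base (P x) = 1%:M by apply: mulVpmx; exact: col_base_full.
  have RE : row_base (P x) *m E = 1%:M by apply: mulmxVp; exact: row_base_free.
  have -> : F *m P x = row_base (P x).
    by rewrite -[X in _ *m X = _](mulmx_base (P x)) mulmxA FC mul1mx.
  exact: RE.
pose S z := F *m P z *m E.
have sFP i j : smooth (fun z => (F *m P z) i j).
  by apply: (@smooth_mulmx _ _ _ (fun=> F)) => // *; exact: smooth_mx_cst.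
have sS i j : smooth (fun z => S z i j).
  by apply: (@smooth_mulmx _ _ _ (fun z => F *m P z) (fun=> E)) => // *; exact: smooth_mx_cst.
pose kappa z := \det (S z) *: v - E *m \adj (S z) *m (F *m P z *m v).
have skappa j : smooth (fun z => kappa z j 0).
  have s1 : smooth (fun z => \det (S z) * v j 0).
    apply: smoothM; last exact: smooth_cst.
    by apply: smooth_in_det => //; exact: openT.
  have s2 : smooth (fun z => (E *m \adj (S z) *m (F *m P z *m v)) j 0).
    apply: (@smooth_mulmx _ _ _ (fun z => E *m \adj (S z)) (fun z => F *m P z *m v)) => k l.
      apply: (@smooth_mulmx _ _ _ (fun=> E) (fun z => \adj (S z))) => [p q|].
        exact: smooth_mx_cst.
      exact: smooth_adj.
    apply: (@smooth_mulmx _ _ _ (fun z => F *m P z) (fun=> v)) => // *.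
    exact: smooth_mx_cst.
  by apply: smooth_in_ext (smoothB s1 s2) => [|z _]; [exact: openT|rewrite !mxE].
have kappax : kappa x = v.
  by rewrite /kappa /S FPE det1 scale1r -(mulmxA F) Pv0 !mulmx0 subr0.
have sdet : smooth (fun z => \det (S z)) by apply: smooth_in_det => //; exact: openT.
pose O := U `&` [set z | \det (S z) != 0].
have oO : open O by apply: openI => //; exact: smooth_neq0_open.
have Ox : O x by split=> //=; rewrite /S FPE det1 oner_neq0.
have [V [chi [oV Vx VO cr]]] := exists_cutoff oO Ox.
have [schi _ chi1] := cr.
pose k : section A := fun z => \sum_j (chi z * kappa z j 0) *: b j z.
have sck j : smooth (fun z => chi z * kappa z j 0) by apply: smoothM.
have sk : is_section k by apply: is_section_sum.
have phik z : phi z (k z) = 0.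
  have [[Uz dz]|nOz] := pselect (O z); last first.
    by rewrite /k big1 ?linear0 // => j _; rewrite (cutoff_eq0 cr nOz) mul0r scale0r.
  have Pk := mulmx_kernel_vector v (maxr z Uz) dz.
  rewrite linear_sum /=.
  transitivity (chi z *: \sum_i (P z *m kappa z) i 0 *: b' i z); last first.
    by rewrite Pk big1 ?scaler0 // => i _; rewrite mxE scale0r.
  rewrite scaler_sumr; under eq_bigr => j _.
    rewrite linearZ /= phib; last exact: UW.
    rewrite scaler_sumr.
    over.
  rewrite exchange_big /=; apply: eq_bigr => i _.
  rewrite [(P z *m kappa z) i 0]mxE scaler_suml scaler_sumr; apply: eq_bigr => j _.
  by rewrite !scalerA; congr (_ *: _); ring.
have [_ _ _ ker _] := dist.
have := ker a k sa sk phik x => DK.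
transitivity (T k x); last by rewrite /T DK subrr.
rewrite (tensor_sum _ x tT sck sb); apply: eq_bigr => j _.
by rewrite chi1 // mul1r kappax.
Qed.

Let trT z := \sum_i pairing (beta i) (T (b i)) z.
Let trT' z := \sum_i pairing (beta' i) (T' (b' i)) z.

(** In the frames, [P], [T] and [T'] satisfy the hypotheses of
    [mxtrace_intertwine]. *)
Let trace_regular U x : open U -> U x -> U `<=` W ->
  (forall z, U z -> (\rank (P z) <= \rank (P x))%N) -> trT x = trT' x.
Proof.
move=> oU Ux UW maxr; have Wx := UW x Ux.
have [_ _ _ d] := fr; have [_ _ _ d'] := fr'.
pose t : 'M[R]_(rank A) := \matrix_(k, j) pairing (beta k) (T (b j)) x.
pose t' : 'M[R]_(rank A') := \matrix_(k, j) pairing (beta' k) (T' (b' j)) x.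
have exv j : exists v : A x, T' (b' j) x = phi x v.
  have [_ _ _ _ im] := dist; have [v vE] := im a (b' j) sa (sb' j) x.
  by exists v; rewrite /T' vE addrAC subrr add0r.
have [v vE] := choice exv.
pose N : 'M[R]_(rank A, rank A') := \matrix_(k, j) (beta k x : 'Hom(A x, R^o)) (v j).
have phiE u : phi x u = \sum_k (beta k x : 'Hom(A x, R^o)) u *: phi x (b k x).
  rewrite {1}(frame_on_expand u fr Wx) linear_sum; apply: eq_bigr => k _.
  by rewrite linearZ.
have PE u i : (beta' i x : 'Hom(A' x, R^o)) (phi x u) =
    \sum_k P x i k * (beta k x : 'Hom(A x, R^o)) u.
  rewrite phiE linear_sum; apply: eq_bigr => k _.
  by rewrite linearZ /= mxE /pairing /push mulrC.
have -> : trT x = \tr t by apply: eq_bigr => i _; rewrite mxE.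
have -> : trT' x = \tr t' by apply: eq_bigr => i _; rewrite mxE.
apply: (@mxtrace_intertwine _ _ _ (P x) t t' N).
- apply/matrixP => i j; rewrite [LHS]mxE [RHS]mxE.
  transitivity ((beta' i x : 'Hom(A' x, R^o)) (phi x (T (b j) x))).
    by rewrite PE; apply: eq_bigr => k _; rewrite [t k j]mxE.
  rewrite TT' // (tensor_expand tT' fr' Wx (la_map_smooth phi (sb j))) linear_sum.
  by apply: eq_bigr => k _; rewrite linearZ /= [P x k j]mxE [t' i k]mxE mulrC.
- apply/matrixP => i j; rewrite [LHS]mxE [RHS]mxE /pairing vE PE.
  by apply: eq_bigr => k _; rewrite [N k j]mxE.
- move=> u Pu; have Tu := kernel_tensor oU Ux UW maxr Pu.
  apply/colP => i; rewrite [LHS]mxE [RHS]mxE.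
  have := congr1 (beta i x : 'Hom(A x, R^o)) Tu; rewrite linear_sum linear0 => H0.
  rewrite -[RHS]H0; apply: eq_bigr => k _; rewrite linearZ /= [t i k]mxE; exact: mulrC.
Qed.

(** The difference of the traces is continuous and vanishes on the dense set
    of points where the rank of [phi] is locally maximal. *)
Lemma distinguished_trace x : W x ->
  \sum_i pairing (beta i) (fun z => D a (b i) z - bracket A a (b i) z) x =
  \sum_i pairing (beta' i)
    (fun z => D' a (b' i) z - bracket A' (push phi a) (b' i) z) x.
Proof.
move=> Wx; rewrite -[LHS]/(trT x) -[RHS]/(trT' x); have [oW _ _ _] := fr.
apply/eqP; rewrite -subr_eq0; apply: contraT => dx.
have sd : smooth (fun z => trT z - trT' z).
  by apply: smoothB; apply: smooth_sum => i; apply: smooth_pairing => //;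
    [exact: sT|exact: sT'].
pose U := W `&` [set z | trT z - trT' z != 0].
have oU : open U by apply: openI => //; exact: smooth_neq0_open.
pose Q n := `[< exists2 z, U z & \rank (P z) = n >].
have Q0 : exists n, Q n by exists (\rank (P x)); apply/asboolP; exists x.
have Qmax n : Q n -> (n <= rank A)%N.
  by move=> /asboolP[z _ <-]; exact: rank_leq_col.
case: (ex_maxnP Q0 Qmax) => n /asboolP[x1 Ux1 <-] maxn.
have [_ /=] := Ux1; rewrite (@trace_regular U x1) ?subrr ?eqxx //; first by move=> z [].
by move=> z Uz; apply: maxn; apply/asboolP; exists z.
Qed.

End Pair.
End Distinguished.

(** * The secondary form in frames *)

Section SecondaryForm.
Context {R : realType} {m : nat} {M : manifold R m}.
Implicit Types (U V W : set M) (f : M -> R) (x : M) (E F : vbundle M).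

Lemma is_section_pair E F (s : section E) (t : section F) :
  is_section s -> is_section t -> is_section ((fun x => (s x, t x)) : section (sum_bundle E F)).
Proof.
move=> ss st [j k] p.
have oU := @triv_dom_open _ _ _ (sum_bundle E F) (j, k).
pose f x := match fintype.split p with
  | inl i => coord (frame E j x) i (s x)
  | inr i => coord (frame F k x) i (t x) end.
apply: (smooth_in_ext (f := f) oU) => [x [jx kx]|].
  by have [_ ->] := sum_basisP (frame_basis jx) (frame_basis kx).
rewrite /f; case: (fintype.split p) => i.
  by apply: smooth_in_sub (ss j i) => x [].
by apply: smooth_in_sub (st k i) => x [].
Qed.

Definition frame_trace E (b : 'I_(rank E) -> section E)
    (beta : 'I_(rank E) -> section (dual_bundle E)) (T : section E -> section E) x : R :=
  \sum_i pairing (beta i) (T (b i)) x.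

Lemma frame_traceB E b beta (T1 T2 : section E -> section E) x :
  @frame_trace E b beta (fun s z => T1 s z - T2 s z) x =
  frame_trace b beta T1 x - frame_trace b beta T2 x.
Proof. by rewrite -sumrB; apply: eq_bigr => i _; rewrite /pairing linearB. Qed.

(** The trace over the dual summand is that of minus the transpose. *)
Lemma delta_c1_frames (A : lie_algebroid M) E F (D D0 : conn_op A E) (D' D0' : conn_op A F)
    (Dd D0d : conn_op A (dual_bundle F)) (w : form1 A) W b beta b' beta' (a : section A) x :
  is_dual_connection D' Dd -> is_dual_connection D0' D0d ->
  is_delta_c1 (sum_connection D0 D0d) (sum_connection D Dd) w ->
  @frame_on _ _ _ E W b beta -> @frame_on _ _ _ F W b' beta' -> W x -> is_section a ->
  form1_app w a x =
    (frame_trace b beta (D a) x - frame_trace b beta (D0 a) x)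
    - (frame_trace b' beta' (D' a) x - frame_trace b' beta' (D0' a) x).
Proof.
move=> [_ dD'] [_ dD0'] dw fr fr' Wx sa.
have [_ sb _ _] := fr; have [_ sb' sbeta' _] := fr'.
have [T TE ->] := dw a sa x.
have [bX cX] := frame_on_basis fr Wx; have [bX' cX'] := frame_on_basis fr' Wx.
set X := [tuple b j x | j < rank E] in bX cX.
set X' := [tuple b' j x | j < rank F] in bX' cX'.
have [bdX' cdX'] := dual_basisP bX'.
have [bS cS] := sum_basisP bX bdX'.
have XE i : tnth X i = b i x by rewrite tnth_mktuple.
have X'E i : tnth X' i = b' i x by rewrite tnth_mktuple.
have dE i : tnth (dual_basis X') i = beta' i x.
  by apply/lfunP => v; rewrite tnth_mktuple lfunE /= cX'.
rewrite (lfun_traceE T bS) big_split_ord /=; congr (_ + _).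
  rewrite -frame_traceB; apply: eq_bigr => i _.
  rewrite cS tnth_mktuple (unsplitK (inl i)) XE.
  pose s : section (sum_bundle E (dual_bundle F)) := fun z => (b i z, 0).
  have ss : is_section s by apply: is_section_pair => //; exact: is_section0.
  by rewrite -[(b i x, 0)]/(s x) TE // cX.
rewrite -frame_traceB -sumrN; apply: eq_bigr => i _.
rewrite cS tnth_mktuple (unsplitK (inr i)) dE.
pose s : section (sum_bundle E (dual_bundle F)) := fun z => (0, beta' i z).
have ss : is_section s by apply: is_section_pair => //; exact: is_section0.
rewrite -[(0, beta' i x)]/(s x) TE // cdX' X'E.
rewrite -[LHS]/((Dd a (beta' i) x - D0d a (beta' i) x : 'Hom(F x, R^o)) (b' i x)).
rewrite add_lfunE opp_lfunE -[Dd a _ x _]/(pairing (Dd a (beta' i)) (b' i) x).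
rewrite -[D0d a _ x _]/(pairing (D0d a (beta' i)) (b' i) x) dD' // dD0' //.
rewrite /pairing linearB /=; ring.
Qed.

Definition gram E (g : forall x, E x -> E x -> R) (b : 'I_(rank E) -> section E) x :
  'M[R]_(rank E) := \matrix_(i, j) g x (b i x) (b j x).

Lemma metric_suml E (g : forall x, E x -> E x -> R) x (I : Type) (r : seq I)
    (c : I -> R) (u : I -> E x) v : is_metric g ->
  g x (\sum_(i <- r) c i *: u i) v = \sum_(i <- r) c i * g x (u i) v.
Proof.
move=> [lin _ _ _]; elim: r => [|i r IH]; last by rewrite !big_cons lin IH.
rewrite !big_nil; have := lin x 1 0 0 v.
by rewrite scaler0 addr0 mul1r => /eqP; rewrite -subr_eq subrr eq_sym => /eqP.
Qed.

Lemma metric_sumr E (g : forall x, E x -> E x -> R) x (I : Type) (r : seq I)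
    (c : I -> R) (u : I -> E x) v : is_metric g ->
  g x v (\sum_(i <- r) c i *: u i) = \sum_(i <- r) c i * g x v (u i).
Proof.
move=> mg; have [_ sym _ _] := mg; rewrite sym metric_suml //.
by apply: eq_bigr => i _; rewrite sym.
Qed.

Lemma gram_smooth E (g : forall x, E x -> E x -> R) b i j : is_metric g ->
  (forall i, is_section (b i)) -> smooth (fun x => @gram E g b x i j).
Proof.
move=> [_ _ _ sg] sb; apply: smooth_in_ext (sg _ _ (sb i) (sb j)) => [|x _].
  exact: openT.
by rewrite mxE.
Qed.

Lemma det_gram_smooth E (g : forall x, E x -> E x -> R) b : is_metric g ->
  (forall i, is_section (b i)) -> smooth (fun x => \det (@gram E g b x)).
Proof.
move=> mg sb; apply: smooth_in_det => [|i j]; first exact: openT.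
exact: gram_smooth.
Qed.

(** A combination of the frame that is orthogonal to the whole frame has norm
    zero. *)
Lemma det_gram_neq0 E (g : forall x, E x -> E x -> R) W b beta x : is_metric g ->
  @frame_on _ _ _ E W b beta -> W x -> \det (gram g b x) != 0.
Proof.
move=> mg [_ _ _ d] Wx; have [_ _ pos _] := mg.
rewrite -unitfE -unitmxE -row_free_unit; apply/row_freeP.
suff K0 : kermx (gram g b x) = 0.
  by apply/row_freeP; rewrite -kermx_eq0 K0.
apply/row_matrixP => i; rewrite row0; set u := row i _.
have uG : u *m gram g b x = 0 by rewrite /u -row_mul mulmx_ker row0.
pose v := \sum_j u 0 j *: b j x.
have gv k : g x v (b k x) = 0.
  rewrite /v metric_suml //; have /rowP/(_ k) := uG; rewrite [LHS]mxE [RHS]mxE => H0.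
  by rewrite -[RHS]H0; apply: eq_bigr => j _; rewrite [gram _ _ _ _ _]mxE.
have v0 : v = 0.
  apply/eqP; apply: contraT => /pos; rewrite {2}/v metric_sumr // big1 ?ltxx // => j _.
  by rewrite gv mulr0.
apply/rowP => j; rewrite [RHS]mxE; have := congr1 (beta j x : 'Hom(E x, R^o)) v0.
rewrite linear0 linear_sum (bigD1 j) //= big1 ?addr0 => [|k /negPf kj].
  by rewrite linearZ /= d // eqxx => <-; rewrite [RHS]mulr1.
by rewrite linearZ /= d // eq_sym kj; apply: mulr0.
Qed.

(** With [w] the matrix of the connection in the frame, orthogonality says that
    the Gram matrix [G] has derivative [w^T G + G w]; Jacobi's formula gives
    twice the trace of [w] as logarithmic derivative of [det G]. *)
Lemma orthogonal_trace (A : lie_algebroid M) E (g : forall x, E x -> E x -> R)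
    (D : conn_op A E) W b beta (a : section A) x :
  is_metric g -> Defs.is_orthogonal g D -> @frame_on _ _ _ E W b beta -> W x -> is_section a ->
  sharp a x (fun z => \det (gram g b z)) =
    2 * frame_trace b beta (D a) x * \det (gram g b x).
Proof.
move=> mg [cD oD] fr Wx sa; have [_ sb _ _] := fr; have [_ sym _ _] := mg.
pose w : 'M[R]_(rank E) := \matrix_(k, j) pairing (beta k) (D a (b j)) x.
have -> : frame_trace b beta (D a) x = \tr w by apply: eq_bigr => i _; rewrite mxE.
apply: tvec_det_gram => [|i j|i j]; first exact: anchor_tvec.
  exact: gram_smooth.
have -> : (fun z => gram g b z i j) = (fun z => g z (b i z) (b j z)).
  by apply/funext => z; rewrite mxE.
rewrite oD // [RHS]mxE; congr (_ + _); rewrite [RHS]mxE.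
  rewrite {1}(frame_on_expand (D a (b i) x) fr Wx) metric_suml //.
  by apply: eq_bigr => k _; rewrite !mxE.
rewrite {1}(frame_on_expand (D a (b j) x) fr Wx) metric_sumr //.
by apply: eq_bigr => k _; rewrite !mxE mulrC.
Qed.

End SecondaryForm.

(** * Cohomology in degree one *)

Section Cohomology.
Context {R : realType} {m : nat} {M : manifold R m}.
Implicit Types (A : lie_algebroid M) (x : M).

Lemma cohomologous_sym A (w w' : form1 A) : cohomologous w w' -> cohomologous w' w.
Proof.
move=> [f sf fE]; exists (fun x => - f x) => [|x v]; first exact: smoothN.
by rewrite (tvecN (anchor_tvec v) sf) -fE -opp_lfunE opprB.
Qed.

Lemma cohomologous_trans A (w1 w2 w3 : form1 A) :
  cohomologous w1 w2 -> cohomologous w2 w3 -> cohomologous w1 w3.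
Proof.
move=> [f sf fE] [g sg gE]; exists (fun x => f x + g x) => [|x v]; first exact: smoothD.
rewrite (tvecD (anchor_tvec v) sf sg) -fE -gE -add_lfunE.
by rewrite addrA subrK.
Qed.

Lemma cohomologous_refl A (w : form1 A) : cohomologous w w.
Proof.
exists (fun=> 0) => [|x v]; first exact: smooth_cst.
by rewrite subrr lfunE (tvec0 (anchor_tvec v)).
Qed.

Lemma cohomologous_sub A (u u' v v' : form1 A) :
  cohomologous u u' -> cohomologous v v' ->
  cohomologous ((fun x => u x - v x) : form1 A) (fun x => u' x - v' x).
Proof.
move=> [f sf fE] [g sg gE]; exists (fun x => f x - g x) => [|x a]; first exact: smoothB.
rewrite (tvecD (anchor_tvec a) sf (smoothN sg)) (tvecN (anchor_tvec a) sg).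
rewrite -fE -gE -opp_lfunE -add_lfunE; congr (fun_of_lfun _ a).
by rewrite [in LHS]opprD addrACA [in RHS]opprD.
Qed.

Variables (A A' : lie_algebroid M) (phi : la_morphism A A').

Lemma cohomologous_pull (u u' : form1 A') : cohomologous u u' ->
  cohomologous (pull_form1 phi u) (pull_form1 phi u').
Proof.
move=> [f sf fE]; exists f => // x v; rewrite -(la_map_anchor phi v sf) -fE.
by rewrite !add_lfunE !opp_lfunE !comp_lfunE.
Qed.

Lemma is_section_dual (E : vbundle M) (nu : section (dual_bundle E)) :
  (forall s, is_section s -> smooth (pairing nu s)) -> is_section nu.
Proof.
move=> snu j p; apply: smooth_in_local => x jx.
have oj := @triv_dom_open _ _ _ E j.
have [V [rho [oV Vx Vd cr]]] := exists_cutoff oj jx; have [_ _ rho1] := cr.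
exists V => //; pose s : section E := fun z => rho z *: tnth (frame E j z) p.
have ss : is_section s.
  apply: (cutoff_section cr (s := fun z => tnth (frame E j z) p) (@subset_refl _ _)).
  by move=> k q; rewrite setIC; apply: frame_smooth.
apply: smooth_in_ext (@smooth_in_of_smooth _ _ _ V _ (snu s ss)) => // z Vz.
rewrite /pairing /s rho1 // scale1r.
by have [_ ->] := dual_basisP (frame_basis (Vd z Vz)).
Qed.

Lemma closed_pull (w : form1 A') : closed_form1 w -> closed_form1 (pull_form1 phi w).
Proof.
move=> [sw dw].
have pE (s : section A) : form1_app (pull_form1 phi w) s = form1_app w (push phi s).
  by apply/funext => x; rewrite /form1_app /pull_form1 comp_lfunE.
have spush (s : section A) : is_section s -> smooth (form1_app w (push phi s)).
  by move=> ss; apply: smooth_pairing => //; apply: la_map_smooth.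
split=> [|a b sa sb x].
  by apply: is_section_dual => s ss; rewrite -[pairing _ _]/(form1_app _ _) pE; apply: spush.
rewrite !pE -[RHS](dw _ _ (la_map_smooth phi sa) (la_map_smooth phi sb) x).
rewrite /sharp /push !(la_map_anchor phi) //; [|exact: spush|exact: spush].
by rewrite {3}/form1_app [la_map phi x _](la_map_bracket phi sa sb).
Qed.

Lemma extend_section (E : vbundle M) x (v : E x) :
  exists2 s : section E, is_section s & s x = v.
Proof.
have [W [b [beta [Wx fr]]]] := exists_frame E x; have [_ sb _ _] := fr.
exists (fun z => \sum_i (beta i x : 'Hom(E x, R^o)) v *: b i z).
  apply: (@is_section_sum _ _ _ E _ _ (fun i _ => (beta i x : 'Hom(E x, R^o)) v)) => // i.
  exact: smooth_cst.
by rewrite -(frame_on_expand v fr Wx).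
Qed.

End Cohomology.

(** * The ratio of the modular forms *)

Section Comparison.
Context {R : realType} {m : nat} {M : manifold R m}.
Variables (A A' : lie_algebroid M).
Variables (sigma : forall x, lfiber A x) (sigma' : forall x, lfiber A' x).
Variables (lambda : form1 A) (lambda' : form1 A').
Hypothesis mf : is_modular_form sigma lambda.
Hypothesis mf' : is_modular_form sigma' lambda'.
Variables (g : forall x, A x -> A x -> R) (g' : forall x, A' x -> A' x -> R).
Hypothesis mg : is_metric g.
Hypothesis mg' : is_metric g'.

Let fits (B : lie_algebroid M) (s : forall x, lfiber B x) b xi x (c : R) :=
  c != 0 /\ forall nu Y, (forall k, is_tvec x (Y k)) ->
    s x nu Y ^+ 2 = (c * @lgen R m M B b xi x nu Y) ^+ 2.

Let local_frames W b beta b' beta' xi Y : Prop :=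
  [/\ @frame_on _ _ _ A W b beta, @frame_on _ _ _ A' W b' beta' &
      dual_coordinates W xi Y].

(** The square of a ratio of squared norms: it is positive without appeal to the
    sign of the Gram determinants. *)
Let ratio (b : 'I_(rank A) -> section A) (b' : 'I_(rank A') -> section A') (c c' : R) x : R :=
  ((c' ^+ 2 * \det (gram g' b' x)) / (c ^+ 2 * \det (gram g b x))) ^+ 2.

Lemma det_gram_change (B : lie_algebroid M) (gB : forall x, B x -> B x -> R)
    W b beta (b2 : 'I_(rank B) -> section B) x : is_metric gB ->
  @frame_on _ _ _ B W b beta -> W x ->
  \det (gram gB b2 x) = wedge_sec b2 (fun l => beta l x) ^+ 2 * \det (gram gB b x).
Proof.
move=> mB fr Wx; rewrite /wedge_sec; set C := \matrix_(i, j) _.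
have -> : gram gB b2 x = C^T *m gram gB b x *m C.
  apply/matrixP => i j; rewrite [LHS]mxE [RHS]mxE.
  rewrite (frame_on_expand (b2 i x) fr Wx) (frame_on_expand (b2 j x) fr Wx).
  rewrite metric_sumr //; apply: eq_bigr => l _; rewrite mulrC; congr (_ * _); last by rewrite mxE.
  by rewrite metric_suml // [RHS]mxE; apply: eq_bigr => k _; rewrite !mxE.
by rewrite !det_mulmx det_tr; ring.
Qed.

(** The ratio of the squared norms of the two modular forms, computed with the
    metrics and a volume of the coordinates, depends on no choice: a change of
    coordinates affects both norms in the same way. *)
Let ratio_unique W1 b1 beta1 b1' beta1' xi1 Y1 W2 b2 beta2 b2' beta2' xi2 Y2
    c1 c1' c2 c2' x :
  local_frames W1 b1 beta1 b1' beta1' xi1 Y1 -> W1 x ->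
  local_frames W2 b2 beta2 b2' beta2' xi2 Y2 -> W2 x ->
  fits sigma b1 xi1 x c1 -> fits sigma' b1' xi1 x c1' ->
  fits sigma b2 xi2 x c2 -> fits sigma' b2' xi2 x c2' ->
  ratio b1 b1' c1 c1' x = ratio b2 b2' c2 c2' x.
Proof.
move=> [fr1 fr1' dc1] W1x _ W2x [c10 s1] [c10' s1'] [c20 s2] [c20' s2'].
have tY k : is_tvec x (Y1 k x) by have [_ _ vY _ _] := dc1; have [] := vY k.
pose p := wedge_sec b2 (fun l => beta1 l x).
pose p' := wedge_sec b2' (fun l => beta1' l x).
pose q := wedge_d xi2 x (fun k => Y1 k x).
have e : c1 ^+ 2 = (c2 * (p * q)) ^+ 2.
  rewrite -[RHS](s2 (fun l => beta1 l x) (fun k => Y1 k x) tY) s1 //.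
  by rewrite /lgen (wedge_sec_dual fr1 W1x) (wedge_d_dual dc1 W1x) !mulr1.
have e' : c1' ^+ 2 = (c2' * (p' * q)) ^+ 2.
  rewrite -[RHS](s2' (fun l => beta1' l x) (fun k => Y1 k x) tY) s1' //.
  by rewrite /lgen (wedge_sec_dual fr1' W1x) (wedge_d_dual dc1 W1x) !mulr1.
have G0 := det_gram_neq0 mg fr1 W1x.
have [p0 q0] : p != 0 /\ q != 0.
  have : (c2 * (p * q)) ^+ 2 != 0 by rewrite -e expf_neq0.
  by rewrite expf_eq0 /= !mulf_eq0 !negb_or => /andP[_ /andP[]].
rewrite /ratio e e' (det_gram_change b2 mg fr1 W1x) (det_gram_change b2' mg' fr1' W1x).
rewrite -/p -/p'; congr (_ ^+ 2).
by move: G0 (\det _) => G0 G'; field; rewrite c20 p0 q0 G0.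
Qed.

Let exists_local x0 : exists V b beta b' beta' xi Y f f',
  [/\ V x0, local_frames V b beta b' beta' xi Y, smooth f, smooth f' &
    forall x, V x ->
    [/\ fits sigma b xi x (f x), fits sigma' b' xi x (f' x),
       forall a, is_section a -> form1_app lambda a x * f x =
         f x * (adjoint_trace b beta a x + divergence xi Y (sharp a) x) + sharp a x f &
       forall a, is_section a -> form1_app lambda' a x * f' x =
         f' x * (adjoint_trace b' beta' a x + divergence xi Y (sharp a) x) + sharp a x f']].
Proof.
have [W1 [b [beta [W1x fr]]]] := exists_frame A x0.
have [W2 [b' [beta' [W2x fr']]]] := exists_frame A' x0.
have [W3 [xi [Y [W3x dc]]]] := exists_dual_coordinates x0.
have [oW1 _ _ _] := fr; have [oW2 _ _ _] := fr'; have [oW3 _ _ _ _] := dc.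
pose W := W1 `&` (W2 `&` W3); have oW : open W by do 2?apply: openI.
have Wx : W x0 by [].
have frW := frame_onS fr oW (@subIsetl _ _ _).
have frW' : frame_on W b' beta' by apply: frame_onS fr' oW _ => x [_ []].
have dcW : dual_coordinates W xi Y by apply: dual_coordinatesS dc oW _ => x [_ []].
have [U [f [oU Ux UW sf H]]] := modular_form_local mf frW dcW Wx.
have [U' [f' [oU' Ux' UW' sf' H']]] := modular_form_local mf' frW' dcW Wx.
pose V := U `&` U'; have oV : open V by apply: openI.
have VW : V `<=` W by move=> x [/UW].
exists V, b, beta, b', beta', xi, Y, f, f'; split=> //.
  by split; [exact: frame_onS frW oV VW|exact: frame_onS frW' oV VW|
             exact: dual_coordinatesS dcW oV VW].
by move=> x [/H[? ? ?] /H'[? ? ?]].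
Qed.

(** The primitive is the logarithm of the ratio of the norms of the modular
    forms, where a factor [1 / 4] undoes the fourth power in [ratio]. The value
    at each point is chosen through arbitrary local data; [ratio_unique] makes
    the function agree with every local formula, hence smooth. It is
    characterised by its exponential, in a form free of quotients that
    tangent vectors differentiate by the Leibniz rule. *)
Lemma modular_potential : exists2 h : M -> R, smooth h & forall x0,
  exists W b beta b' beta' xi Y f f',
  [/\ W x0, local_frames W b beta b' beta' xi Y, smooth f, smooth f' &
     [/\ f x0 != 0, f' x0 != 0,
      forall a, is_section a -> form1_app lambda a x0 * f x0 =
         f x0 * (adjoint_trace b beta a x0 + divergence xi Y (sharp a) x0) + sharp a x0 f,
      forall a, is_section a -> form1_app lambda' a x0 * f' x0 =
         f' x0 * (adjoint_trace b' beta' a x0 + divergence xi Y (sharp a) x0) + sharp a x0 f' &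
      forall x, W x -> expR (4 * h x) * (f x ^+ 2 * \det (gram g b x)) ^+ 2 =
         (f' x ^+ 2 * \det (gram g' b' x)) ^+ 2]].
Proof.
have ext x0 : exists t, forall V b beta b' beta' xi Y c c',
    local_frames V b beta b' beta' xi Y -> V x0 ->
    fits sigma b xi x0 c -> fits sigma' b' xi x0 c' -> t = ratio b b' c c' x0.
  have [V [b [beta [b' [beta' [xi [Y [f [f' [Vx lf _ _ /(_ x0 Vx)[s s' _ _]]]]]]]]]]] := exists_local x0.
  exists (ratio b b' (f x0) (f' x0) x0) => V2 b2 beta2 b2' beta2' xi2 Y2 c2 c2' lf2 Vx2 s2 s2'.
  exact: ratio_unique lf Vx lf2 Vx2 s s' s2 s2'.
have [t tE] := choice ext.
have loc x0 : exists V b beta b' beta' xi Y f f',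
  [/\ V x0, local_frames V b beta b' beta' xi Y, smooth f, smooth f' &
    forall x, V x -> [/\ f x != 0, f' x != 0, t x = ratio b b' (f x) (f' x) x,
       forall a, is_section a -> form1_app lambda a x * f x =
         f x * (adjoint_trace b beta a x + divergence xi Y (sharp a) x) + sharp a x f &
       forall a, is_section a -> form1_app lambda' a x * f' x =
         f' x * (adjoint_trace b' beta' a x + divergence xi Y (sharp a) x) + sharp a x f']].
  have [V [b [beta [b' [beta' [xi [Y [f [f' [Vx lf sf sf' H]]]]]]]]]] := exists_local x0.
  exists V, b, beta, b', beta', xi, Y, f, f'; split=> // x Vx'.
  have [s s' l l'] := H x Vx'; split=> //; [by case: s|by case: s'|].
  exact: tE lf Vx' s s'.
have ratio_gt0 W b beta b' beta' xi Y c c' x : local_frames W b beta b' beta' xi Y ->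
    W x -> c != 0 -> c' != 0 -> 0 < ratio b b' c c' x.
  move=> [fr fr' _] Wx c0 c0'; rewrite /ratio exprn_even_gt0 //=.
  by rewrite mulf_neq0 ?invr_neq0 // mulf_neq0 ?expf_neq0 //;
    [exact: det_gram_neq0 mg' fr' Wx|exact: det_gram_neq0 mg fr Wx].
exists (fun x => 4^-1 * ln (t x)).
  apply: smooth_glue => x0.
  have [V [b [beta [b' [beta' [xi [Y [f [f' [Vx lf sf sf' H]]]]]]]]]] := loc x0.
  have [fr fr' _] := lf; have [oV sb _ _] := fr; have [_ sb' _ _] := fr'.
  exists V, (fun x => 4^-1 * ln (ratio b b' (f x) (f' x) x)); split=> //.
    apply: smooth_inM => //; first exact: smooth_in_cst.
    apply: smooth_in_ln => // [x Vx'|].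
      by have [f0 f0' _ _ _] := H x Vx'; exact: ratio_gt0 lf Vx' f0 f0'.
    apply: smooth_inX => //; apply: smooth_inM => //.
      apply: smooth_in_of_smooth; apply: smoothM; last exact: det_gram_smooth.
      by apply: smooth_inX => //; exact: openT.
    apply: smooth_inV => // [x Vx'|].
      have [f0 _ _ _ _] := H x Vx'; rewrite mulf_neq0 ?expf_neq0 //.
      exact: det_gram_neq0 mg fr Vx'.
    apply: smooth_in_of_smooth; apply: smoothM; last exact: det_gram_smooth.
    by apply: smooth_inX => //; exact: openT.
  by move=> z /H[_ _ ->].
move=> x0; have [V [b [beta [b' [beta' [xi [Y [f [f' [Vx lf sf sf' H]]]]]]]]]] := loc x0.
exists V, b, beta, b', beta', xi, Y, f, f'; split=> //.
have [f0 f0' _ l l'] := H x0 Vx; split=> // x Vx'.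
have [{}f0 {}f0' tx _ _] := H x Vx'; have [fr _ _] := lf.
have G0 := det_gram_neq0 mg fr Vx'.
rewrite mulVKf ?pnatr_eq0 // lnK; last by rewrite posrE tx (ratio_gt0 _ _ _ _ _ _ _ _ _ _ lf).
rewrite tx /ratio; field; by rewrite f0 G0.
Qed.

End Comparison.

(** * Comparison of the two classes *)

(** Solves for [h] the derivative of [E * N ^ 2 = N' ^ 2], where [E] is the
    exponential of [4 * h], [N = F ^ 2 * G] and [N' = F' ^ 2 * G']. In the
    hypotheses [h], [dF] and [dF'] stand for derivatives, and [s], [s'] for half
    the logarithmic derivatives of [G] and [G']. *)
Lemma log_derivative_ratio (K : realFieldType) (E F G F' G' h dF dF' s s' : K) :
  F != 0 -> G != 0 -> F' != 0 -> G' != 0 ->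
  let N := F * F * G in let N' := F' * F' * G' in
  let dN := (dF * F + F * dF) * G + F * F * (2 * s * G) in
  let dN' := (dF' * F' + F' * dF') * G' + F' * F' * (2 * s' * G') in
  E * (N * N) = N' * N' ->
  E * (4 * h) * (N * N) + E * (dN * N + N * dN) = dN' * N' + N' * dN' ->
  h = dF' / F' + s' - (dF / F + s).
Proof.
move=> F0 G0 F0' G0' N N' dN dN' EN eq.
have N0 : N != 0 by rewrite !mulf_neq0.
have N0' : N' != 0 by rewrite !mulf_neq0.
have EE : E = N' * N' / (N * N) by rewrite -EN; field; rewrite N0.
apply/eqP; rewrite -subr_eq0.
have : (h - (dF' / F' + s' - (dF / F + s))) * (4 * (N' * N')) = 0.
  transitivity ((E * (4 * h) * (N * N) + E * (dN * N + N * dN)) - (dN' * N' + N' * dN')).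
    by rewrite EE /dN /dN' /N /N'; field; rewrite ?F0 ?G0 ?F0' ?G0'.
  by rewrite eq subrr.
have q0 : 4 * (N' * N') != 0 by rewrite mulf_neq0 ?pnatr_eq0 // mulf_neq0.
by move/eqP; rewrite mulf_eq0 (negPf q0) orbF.
Qed.

(** The fields [sharp a] and [sharp (phi a)] act alike on smooth functions, so
    the divergences in the two modular forms cancel. The traces of [D] and [D']
    are absorbed by [distinguished_trace], those of the orthogonal connections
    by the derivative of the Gram determinants in the potential. *)
Lemma modular_cohomologous (R : realType) (m : nat) (M : manifold R m)
    (A A' : lie_algebroid M) (phi : la_morphism A A')
    (D : conn_op A A) (D' : conn_op A A') (D'd : conn_op A (dual_bundle A'))
    (g : forall x, A x -> A x -> R) (g' : forall x, A' x -> A' x -> R)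
    (Dg : conn_op A A) (Dg' : conn_op A A') (Dg'd : conn_op A (dual_bundle A'))
    (w : form1 A) sigma sigma' (lambda : form1 A) (lambda' : form1 A') :
  distinguished_pair phi D D' -> is_dual_connection D' D'd ->
  is_metric g -> Defs.is_orthogonal g Dg ->
  is_metric g' -> Defs.is_orthogonal g' Dg' -> is_dual_connection Dg' Dg'd ->
  is_delta_c1 (sum_connection Dg Dg'd) (sum_connection D D'd) w ->
  is_modular_form sigma lambda -> is_modular_form sigma' lambda' ->
  cohomologous w (fun x => lambda x - pull_form1 phi lambda' x : 'Hom(A x, R^o)).
Proof.
move=> dist dD mg oDg mg' oDg' dDg dw mf mf'.
have [h sh H] := modular_potential mf mf' mg mg'; exists h => // x v.
have [a sa <-] := extend_section v.
have [W [b [beta [b' [beta' [xi [Y [f [f' [Wx [fr fr' dc] sf sf' [f0 f0' l l' eN]]]]]]]]]]] := H x.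
have spa : is_section (push phi a) := la_map_smooth phi sa.
have G0 := det_gram_neq0 mg fr Wx; have G0' := det_gram_neq0 mg' fr' Wx.
have [oW sb _ _] := fr; have [_ sb' _ _] := fr'; have [_ [sxi _] _ _ _] := dc.
have tw := delta_c1_frames dD dDg dw fr fr' Wx sa.
have div' : divergence xi Y (sharp (push phi a)) x = divergence xi Y (sharp a) x.
  apply: eq_bigr => k _; congr (Y k x _); apply/funext => z.
  by rewrite /vf_app /sharp /push la_map_anchor.
have lE := l a sa; have lE' := l' _ spa.
rewrite div' /sharp /push la_map_anchor // in lE'.
have trE := distinguished_trace dist sa fr fr' Wx.
rewrite -[LHS]/(frame_trace b beta (fun s z => D a s z - bracket A a s z) x)
  -[RHS]/(frame_trace b' beta' (fun s z => D' a s z - bracket A' (push phi a) s z) x)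
  !frame_traceB in trE.
have gE := orthogonal_trace mg oDg fr Wx sa.
have gE' := orthogonal_trace mg' oDg' fr' Wx sa.
set ta := anchor A (a x); have tv : is_tvec x ta by exact: anchor_tvec.
pose G z := \det (gram g b z); pose G' z := \det (gram g' b' z).
have sG : smooth G by apply: det_gram_smooth.
have sG' : smooth G' by apply: det_gram_smooth.
pose N z := f z * f z * G z; pose N' z := f' z * f' z * G' z.
have sff : smooth (fun z => f z * f z) by apply: smoothM.
have sff' : smooth (fun z => f' z * f' z) by apply: smoothM.
have sN : smooth N by apply: smoothM.
have sN' : smooth N' by apply: smoothM.
have s4h : smooth (fun z => 4 * h z) by apply: smoothM => //; exact: smooth_cst.
have sE : smooth (fun z => expR (4 * h z)) by apply: smooth_in_expR => //; exact: openT.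
have sNN : smooth (fun z => N z * N z) by apply: smoothM.
have dN : ta N = (ta f * f x + f x * ta f) * G x + f x * f x * (2 * frame_trace b beta (Dg a) x * G x).
  by rewrite (tvecM tv sff sG) (tvecM tv sf sf) [ta G]gE.
have dN' : ta N' = (ta f' * f' x + f' x * ta f') * G' x +
    f' x * f' x * (2 * frame_trace b' beta' (Dg' a) x * G' x).
  by rewrite (tvecM tv sff' sG') (tvecM tv sf' sf') [ta G']gE'.
have : ta (fun z => expR (4 * h z) * (N z * N z)) = ta (fun z => N' z * N' z).
  apply: (tvec_local tv _ _ oW Wx); [exact: smoothM|exact: smoothM|].
  by move=> z Wz; have := eN z Wz; rewrite !expr2.
rewrite (tvecM tv sE sNN) (tvec_expR tv s4h) (tvecZ 4 tv sh) (tvecM tv sN sN) (tvecM tv sN' sN').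
rewrite dN dN' => eq2.
have eq1 := eN x Wx; rewrite !expr2 in eq1.
rewrite (log_derivative_ratio f0 G0 f0' G0' eq1 eq2).
have lamE : form1_app lambda a x = adjoint_trace b beta a x + divergence xi Y (sharp a) x + ta f / f x.
  by apply: (mulIf f0); rewrite lE /sharp -/ta; field; rewrite f0.
have lamE' : form1_app lambda' (push phi a) x =
    adjoint_trace b' beta' (push phi a) x + divergence xi Y (sharp a) x + ta f' / f' x.
  by apply: (mulIf f0'); rewrite lE' -/ta; field; rewrite f0'.
have -> : (w x - (lambda x - pull_form1 phi lambda' x) : 'Hom(A x, R^o)) (a x) =
    form1_app w a x - (form1_app lambda a x - form1_app lambda' (push phi a) x).
  by rewrite add_lfunE opp_lfunE add_lfunE opp_lfunE comp_lfunE.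
rewrite tw lamE lamE'.
have e1 : frame_trace b beta (D a) x =
  frame_trace b' beta' (D' a) x - adjoint_trace b' beta' (push phi a) x + adjoint_trace b beta a x.
  by rewrite -trE subrK.
rewrite e1; ring.
Qed.

Theorem proposition3p6 (R : realType) (m : nat) (M : manifold R m)
    (A A' : lie_algebroid M) (phi : la_morphism A A')
    (mu1_phi mu_A : set (form1 A)) (mu_A' : set (form1 A')) :
  is_mu1 phi mu1_phi -> is_modular_class mu_A -> is_modular_class mu_A' ->
  mu1_phi = coh_sub mu_A (coh_pull phi mu_A').
Proof.
move=> [D [D' [D'd [g [g' [Dg [Dg' [Dg'd [w]]]]]]]]].
move=> [[dist dD] [mg oDg] [mg' oDg' dDg] [cw dw] ->].
move=> [sigma [lambda [mf cl ->]]] [sigma' [lambda' [mf' cl' ->]]].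
have key := modular_cohomologous dist dD mg oDg mg' oDg' dDg dw mf mf'.
apply/seteqP; split=> [z [cz zw]|z [u [v [[_ ul] [u' [_ ul'] [_ vu']] [cz zuv]]]]].
  exists lambda, (pull_form1 phi lambda'); split.
  - by split=> //; exact: cohomologous_refl.
  - exists lambda'; first by split=> //; exact: cohomologous_refl.
    by split; [exact: closed_pull|exact: cohomologous_refl].
  - by split=> //; apply: cohomologous_trans zw key.
split=> //; apply: cohomologous_trans zuv _.
apply: cohomologous_trans (cohomologous_sym key).
apply: cohomologous_sub => //.
by apply: cohomologous_trans vu' _; exact: cohomologous_pull.
Qed.
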